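(* Let $0<\beta<1$, let $M\ge 1$ be a large constant, and let $u$ satisfy $$-\Delta u+V(x)u=0\quad\text{in } B_{10}\subset\mathbb{R}^n,$$ with $\|V\|_{C^{0,\beta}(B_{10})}\le M$, together with the normalization $$\|u\|_{L^\infty(B_{10})}\le C_0,\qquad \|u\|_{L^2(B_1)}\ge 1 .$$ Then the vanishing order of $u$ at every point of $B_{1/2}$ is at most $C M^{\frac{2}{\beta+3}}$, where $C$ depends only on $n$, $\beta$ and $C_0$.
   Context: $B_r\subset\mathbb{R}^n$ is the Euclidean ball of radius $r$ centered at the origin, and $B_r(x_0)$ the one centered at $x_0$. $\|V\|_{C^{0,\beta}(B_{10})}=\max\{\|V\|_{L^\infty(B_{10})},[V]_{C^{0,\beta}(B_{10})}\}$ with $[V]_{C^{0,\beta}(B_{10})}=\sup_{x\ne y\in B_{10}}\frac{|V(x)-V(y)|}{|x-y|^\beta}$. $V$ is allowed to be complex-valued (and then $u$ as well). Solutions are classical, equivalently weak. The vanishing order of $u$ at a point $x_0$ is the largest (supremum) $N\ge 0$ such that $|B_r(x_0)|^{-1/2}\|u\|_{L^2(B_r(x_0))}=O(r^N)$ as $r\to0$; for smooth $u$ it is the order of the first nonvanishing derivative at $x_0$. *)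

(* Defs.v *)
From HB Require Import structures.
From mathcomp Require Import all_boot all_order all_algebra.
From mathcomp Require Import all_classical all_reals all_analysis.
From mathcomp Require Import measurable_realfun complex.

Set Implicit Arguments.
Unset Strict Implicit.
Unset Printing Implicit Defensive.

Import Order.TTheory GRing.Theory Num.Theory.
Import numFieldNormedType.Exports.

Local Open Scope classical_set_scope.
Local Open Scope ring_scope.

Fact rV_display : measure_display. Proof. exact. Qed.

Section borel_rV.
Context (R : realType) (n : nat).

Let borel0 : <<s (@open 'rV[R]_n) >> set0.
Proof. exact: sigma_algebra0. Qed.

Let borelC A : <<s (@open 'rV[R]_n) >> A -> <<s (@open 'rV[R]_n) >> (~` A).
Proof. exact: sigma_algebraC. Qed.

Let borel_bigcup (F : (set 'rV[R]_n)^nat) :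
  (forall i, <<s (@open 'rV[R]_n) >> (F i)) ->
  <<s (@open 'rV[R]_n) >> (\bigcup_i F i).
Proof. exact: sigma_algebra_bigcup. Qed.

HB.instance Definition _ := @isMeasurable.Build rV_display 'rV[R]_n
  <<s (@open 'rV[R]_n) >> borel0 borelC borel_bigcup.

Lemma open_measurable_rV (U : set 'rV[R]_n) : open U -> measurable U.
Proof. by move=> oU; apply: sub_sigma_algebra. Qed.

End borel_rV.

Section rcons.
Context (R : realType) (n : nat).

Definition row_cons (p : measurableTypeR R * 'rV[R]_n) : 'rV[R]_n.+1 :=
  row_mx (p.1%:M : 'M[R]_1) p.2.

Lemma row_cons_head p i : row_cons p i ord0 = p.1.
Proof.
rewrite ord1; transitivity (row_mx (p.1%:M : 'M[R]_1) p.2 ord0 (lshift n ord0)).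
  by congr (row_mx _ _ _ _); exact: val_inj.
by rewrite row_mxEl mxE eqxx mulr1n.
Qed.

Lemma row_cons_tail p i (j : 'I_n) : row_cons p i (lift ord0 j) = p.2 i j.
Proof.
transitivity (row_mx (p.1%:M : 'M[R]_1) p.2 i (rshift 1 j)).
  by congr (row_mx _ _ _ _); exact: val_inj.
by rewrite row_mxEr.
Qed.

Let row_uncons (v : 'rV[R]_n.+1) : measurableTypeR R * 'rV[R]_n :=
  (v ord0 ord0, \row_j v ord0 (lift ord0 j)).

Let row_consK : cancel row_cons row_uncons.
Proof.
case=> a v; rewrite /row_uncons row_cons_head; congr pair.
by apply/rowP => j; rewrite mxE row_cons_tail.
Qed.

Let row_unconsK : cancel row_uncons row_cons.
Proof.
move=> v; apply/rowP => i; case: (unliftP ord0 i) => [j|] ->.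
  by rewrite row_cons_tail mxE.
exact: row_cons_head.
Qed.

Lemma open_bigcup_ball (U : set 'rV[R]_n.+1) : open U ->
  U = \bigcup_(q in [set q : 'rV[rat]_n.+1 * nat |
        ball (map_mx ratr q.1 : 'rV[R]_n.+1) q.2.+1%:R^-1 `<=` U])
      ball (map_mx ratr q.1 : 'rV[R]_n.+1) q.2.+1%:R^-1.
Proof.
move=> oU; apply/seteqP; split=> [v Uv|v [q /= + ?]]; last exact.
have /nbhs_ballP[e /= e0 eU] : nbhs v U by exact: open_nbhs_nbhs.
have [k ke] : exists k : nat, k.+1%:R^-1 < e / 2.
  exists (Num.truncn (e / 2)^-1); rewrite invf_plt ?posrE ?divr_gt0//.
  exact: truncnS_gt.
have k0 : (0 : R) < k.+1%:R^-1 by rewrite invr_gt0.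
have /choice[q qP] : forall i, exists q : rat,
    ball (v ord0 i) k.+1%:R^-1 (ratr q : R).
  move=> i; have [|r] := @rat_in_itvoo R (v ord0 i) (v ord0 i + k.+1%:R^-1).
    by rewrite ltrDl.
  rewrite in_itv /= => /andP[r1 r2]; exists r.
  by rewrite /ball /= distrC ger0_norm ?subr_ge0 ?(ltW r1)// ltrBlDl.
have bq : ball (map_mx ratr (\row_i q i) : 'rV[R]_n.+1) k.+1%:R^-1 v.
  split=> // i j; rewrite ord1 !mxE; apply/ball_sym; exact: qP.
exists (\row_i q i, k) => //= w bw; apply: eU.
rewrite (splitr e); apply: (@ball_triangle _ _ (map_mx ratr (\row_i q i) : 'rV[R]_n.+1)).
  by apply: le_ball (ltW ke) _ _; apply/ball_sym.
by apply: le_ball (ltW ke) _ _.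
Qed.

Lemma measurable_row_cons : measurable_fun setT row_cons.
Proof.
apply: (measurability (@open 'rV[R]_n.+1)) => // _ [U oU <-]; rewrite setTI.
rewrite (open_bigcup_ball oU) preimage_bigcup bigcup_mkcond.
apply: countable_bigcupT_measurable; first exact: countableP.
case=> q k; case: ifPn => // _ /=.
set e : R := k.+1%:R^-1.
have e0 : 0 < e by rewrite invr_gt0.
have -> : row_cons @^-1` ball (map_mx ratr q : 'rV[R]_n.+1) e =
    ball (ratr (q ord0 ord0) : R) e `*`
    ball (\row_j (ratr (q ord0 (lift ord0 j)) : R) : 'rV[R]_n) e.
  apply/seteqP; split=> -[a v] /=.
    move=> [_ b]; split=> /=.
      by have := b ord0 ord0; rewrite mxE row_cons_head.
    split=> // i j; have := b i (lift ord0 j).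
    by rewrite row_cons_tail ord1 !mxE.
  move=> [b [_ c]]; split=> // i j; rewrite ord1 mxE.
  case: (unliftP ord0 j) => [l|] ->; last by rewrite row_cons_head.
  by rewrite row_cons_tail; have := c ord0 l; rewrite mxE.
apply: measurableX; first exact: measurable_ball.
by apply: open_measurable_rV; exact: ball_open.
Qed.

Let measurable_row_uncons : measurable_fun setT row_uncons.
Proof.
apply/measurable_fun_pairP; split.
  apply: (measurability _ (RGenOpens.measurableE R)).
  move=> _ [_ [a [b ->]] <-]; rewrite setTI; apply: open_measurable_rV.
  apply: open_comp; last exact: interval_open.
  by move=> v _; exact: coord_continuous.
apply: (measurability (@open 'rV[R]_n)) => // _ [U oU <-]; rewrite setTI.
apply: open_measurable_rV; apply: open_comp oU => v _ A.
move=> /nbhs_ballP[e e0 eA]; apply/nbhs_ballP; exists e => // w [_ vw].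
by apply: eA; split=> // i j; rewrite !mxE; exact: vw.
Qed.

Variable mu : {sigma_finite_measure set 'rV[R]_n -> \bar R}.

Let lam : {sigma_finite_measure set (measurableTypeR R) -> \bar R} :=
  lebesgue_measure.

Definition lebesgue_rcons := pushforward (lam \x mu)%E row_cons.

Let lebesgue_rcons0 : lebesgue_rcons set0 = 0%E.
Proof. by rewrite /lebesgue_rcons /pushforward preimage_set0 measure0. Qed.

Let lebesgue_rcons_ge0 A : (0 <= lebesgue_rcons A)%E.
Proof. by rewrite /lebesgue_rcons /pushforward; exact: measure_ge0. Qed.

Let lebesgue_rcons_sigma_additive : semi_sigma_additive lebesgue_rcons.
Proof.
move=> F mF tF mUF; rewrite /lebesgue_rcons /pushforward preimage_bigcup.
have mcons A : measurable A -> measurable (row_cons @^-1` A).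
  by move=> mA; rewrite -[X in measurable X]setTI; exact: measurable_row_cons.
apply: measure_semi_sigma_additive; first by move=> k; exact: mcons.
  apply/trivIsetP => /= i j _ _ ij; rewrite -preimage_setI.
  by move/trivIsetP : tF => /(_ _ _ _ _ ij) ->//; rewrite preimage_set0.
by rewrite -preimage_bigcup; exact: mcons.
Qed.

HB.instance Definition _ := isMeasure.Build _ _ _ lebesgue_rcons
  lebesgue_rcons0 lebesgue_rcons_ge0 lebesgue_rcons_sigma_additive.

Let lebesgue_rcons_sigma_finite : sigma_finite setT lebesgue_rcons.
Proof.
have /sigma_finiteP[F [TF ndF Foo]] := sigma_finiteT lam.
have /sigma_finiteP[G [TG ndG Goo]] := sigma_finiteT mu.
exists (fun k => row_uncons @^-1` (F k `*` G k)).
  apply/seteqP; split=> // v _.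
  have : setT (row_uncons v).1 by [].
  rewrite TF => -[k _ Fk].
  have : setT (row_uncons v).2 by [].
  rewrite TG => -[l _ Gl].
  exists (maxn k l) => //; split.
    by move: Fk; exact/subsetPset/ndF/leq_maxl.
  by move: Gl; exact/subsetPset/ndG/leq_maxr.
move=> k; have [? ?] := Foo k; have [? ?] := Goo k; split.
  rewrite -[X in measurable X]setTI; apply: measurable_row_uncons => //.
  exact: measurableX.
rewrite /lebesgue_rcons /pushforward -comp_preimage.
rewrite (_ : _ \o _ = id); last exact/funext/row_consK.
by rewrite preimage_id product_measure1E// lte_mul_pinfty// ge0_fin_numE.
Qed.

HB.instance Definition _ := Measure_isSigmaFinite.Build _ _ _ lebesgue_rcons
  lebesgue_rcons_sigma_finite.

End rcons.

(* Lebesgue measure on R^n: the n-fold product of the one-dimensional one. *)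
Fixpoint lebesgue_rV (R : realType) (n : nat) :
    {sigma_finite_measure set 'rV[R]_n -> \bar R} :=
  match n with
  | 0 => \d_(0 : 'rV[R]_0)
  | m.+1 => lebesgue_rcons (lebesgue_rV R m)
  end.

Lemma lebesgue_rV_box (R : realType) (n : nat) (a b : 'I_n -> R) :
  (forall i, a i <= b i) ->
  lebesgue_rV R n [set x : 'rV[R]_n | forall i, x ord0 i \in `]a i, b i[] =
  (\prod_i (b i - a i))%:E.
Proof.
elim: n a b => [|n IHn] a b ab.
  rewrite big_ord0 /= diracE mem_set//; by case.
rewrite big_ord_recl /= /lebesgue_rcons /pushforward.
have -> : @row_cons R n @^-1` [set x : 'rV[R]_n.+1 | forall i, x ord0 i \in `]a i, b i[] =
    `]a ord0, b ord0[%classic `*`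
    [set x : 'rV[R]_n | forall i, x ord0 i \in `]a (lift ord0 i), b (lift ord0 i)[].
  apply/seteqP; split=> -[t v] /=.
    move=> h; split; first by have := h ord0; rewrite row_cons_head.
    by move=> i; have := h (lift ord0 i); rewrite row_cons_tail.
  move=> [h1 h2] i; case: (unliftP ord0 i) => [j|] ->.
    by rewrite row_cons_tail; exact: h2.
  by rewrite row_cons_head.
rewrite product_measure1E//=; last first.
  rewrite [X in measurable X](_ : _ = \bigcap_(i in [set: 'I_n])
      (fun x : 'rV[R]_n => x ord0 i) @^-1`
        `]a (lift ord0 i), b (lift ord0 i)[%classic).
    apply: fin_bigcap_measurable => // i _; apply: open_measurable_rV.
    apply: open_comp; last exact: interval_open.
    by move=> v _; exact: coord_continuous.
  by apply/seteqP; split=> x /= h i; [move=> _; exact: h|exact: (h i I)].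
rewrite lebesgue_measure_itv /= lte_fin IHn// EFinM.
have := ab ord0; rewrite le_eqVlt => /predU1P[->|->//].
by rewrite ltxx subrr.
Qed.

Section euclidean.
Context (R : realType) (n : nat).
Implicit Types (x y : 'rV[R]_n) (A : set 'rV[R]_n) (f : 'rV[R]_n -> R).
Implicit Types (u V : 'rV[R]_n -> R[i]).

(* The library's norm and [ball] on 'rV[R]_n are those of the sup norm. *)
Definition enorm x : R := Num.sqrt (\sum_i x ord0 i ^+ 2).

Definition eball x (r : R) : set 'rV[R]_n := [set y | enorm (y - x) < r].

(* L^p norm over A of a complex-valued function, via extension by 0; for
   p = +oo the library's Lnorm is the essential supremum. *)
Definition LpC (p : \bar R) A u : \bar R :=
  Lnorm (lebesgue_rV R n) p (EFin \o patch (cst 0) A (@Normc.normc R \o u)).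

Definition holder_seminorm (beta : R) A V : \bar R :=
  ereal_sup [set (Normc.normc (V z.1 - V z.2) / enorm (z.1 - z.2) `^ beta)%:E |
    z in [set z | [/\ A z.1, A z.2 & z.1 <> z.2]]].

Definition holder_norm (beta : R) A V : \bar R :=
  maxe (LpC +oo A V) (holder_seminorm beta A V).

Definition partial (i : 'I_n) f : 'rV[R]_n -> R :=
  fun x => 'D_(delta_mx ord0 i) f x.

Definition C2 A f := forall x, A x ->
  [/\ {for x, continuous f},
      forall i, derivable f x (delta_mx ord0 i) /\
        {for x, continuous (partial i f)} &
      forall i j, derivable (partial i f) x (delta_mx ord0 j) /\
        {for x, continuous (partial j (partial i f))}].

Definition laplacian f : 'rV[R]_n -> R :=
  fun x => \sum_(i < n) partial i (partial i f) x.

(* R[i] is not a normed module over R in the library: differentiation of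
   complex-valued functions is done on real and imaginary parts. *)
Definition laplacianC u : 'rV[R]_n -> R[i] := fun x =>
  Complex (laplacian (@complex.Re R \o u) x) (laplacian (@complex.Im R \o u) x).

Definition classical_solution A V u :=
  [/\ C2 A (@complex.Re R \o u), C2 A (@complex.Im R \o u) &
      forall x, A x -> - laplacianC u x + V x * u x = 0].

(* The supremum of the real N >= 0 such that
   |B_r(x0)|^(-1/2) ||u||_{L^2(B_r(x0))} = O(r^N) as r -> 0+; possibly +oo. *)
Definition vanishing_order u x0 : \bar R :=
  ereal_sup [set N%:E | N in [set N : R | 0 <= N /\ exists K : R,
    \forall r \near 0^'+,
      (lebesgue_rV R n (eball x0 r) `^ (- 2^-1) * LpC 2%:E (eball x0 r) u
        <= (K * r `^ N)%:E)%E]].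

End euclidean.

(* Main.v *)
From HB Require Import structures.
Require Import Defs.
From mathcomp Require Import all_boot all_order all_algebra.
From mathcomp Require Import all_classical all_reals all_analysis.
From mathcomp Require Import measurable_realfun ess_sup_inf complex ring lra.

Set Implicit Arguments.
Unset Strict Implicit.
Unset Printing Implicit Defensive.

Import Order.TTheory GRing.Theory Num.Theory.
Import numFieldNormedType.Exports.

Local Open Scope classical_set_scope.
Local Open Scope ring_scope.

(** The order of vanishing at [x0] is controlled by a Carleman inequality whose
    weight [g] behaves like [|x - x0|^(-t)].  After multiplication by such a weight
    the operator [|x - x0|^2 Laplacian] splits into a symmetric and an
    antisymmetric part (for the measure [|x - x0|^(-n) dx], the product of
    Lebesgue measure in the logarithm [tau] of the radius and of surface
    measure on the sphere), and a slight convexity of the exponent in [tau]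
    makes their commutator positive, of size [t^3].  A bounded potential of size
    at most a constant times [t^(3/2)] is therefore a perturbation.  A C^1
    potential [W] is better placed: its real part joins the symmetric part, its
    imaginary part the antisymmetric one, and only one derivative of [W] enters the commutator, so
    [|W|] and [|grad W|] may be as large as a constant times [t^2].  This is
    [carleman], and [cutoff_estimate] applies it to a solution times a cutoff.

    A potential that is only Hoelder is interpolated between the two cases.  Put
    [S = M^(1/(3+beta))], so that [M = S^(3+beta)], and smooth [V] at a
    scale comparable with [1/S].  The result [W] satisfies [|V - W| <= C S^3] and
    [|W| + |grad W| <= C S^4] ([mollifier], [oscillation],
    [smooth_component]).  Both conditions of the Carleman inequality hold as soon as [t = T S^2] with [T]
    large, and [S^2 = M^(2/(3+beta))] is the exponent claimed.

    It remains to exploit the inequality ([mass_inequality], [vanishing_le]).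
    The cutoff equals 1 between a radius comparable with [r] and the radius 8, all
    radii being measured from [x0]; the ball of radius 9 around [x0] lies in [B_10]
    and the ball of radius 3/2 contains [B_1].  If [u] vanishes at [x0] to an order
    [N > t + 1], the error made by the inner cutoff is at most a constant times
    [r^(2(N - t - 1))], and disappears as [r] tends to 0.  The error of the outer
    cutoff carries the weight at distance at least 8, which is smaller than the
    weight on the ball of radius 3/2, where [u] has mass at least 1.  What remains
    is [t <= cutoff_const C0^2 18^n], contradicting the choice of [T].
    Hence [N <= t + 1 <= (T + 1) M^(2/(3+beta))].

    The equation is treated as a real system for the real and imaginary parts
    [a], [b] of [u]. *)

(** * Calculus of partial derivatives *)

Section Slices.
Context (R : realType) (V : normedModType R).
Implicit Types (f : V -> R) (x v : V).

Lemma is_derive_slice f x v (t : R) (d : R) :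
  is_derive (x + t *: v) v f d -> is_derive t 1 (fun t => f (x + t *: v)) d.
Proof.
move=> [df <-].
have E : (fun h : R => h^-1 *: (((fun t => f (x + t *: v)) \o shift t) (h *: 1)
            - f (x + t *: v))) =
       (fun h : R => h^-1 *: ((f \o shift (x + t *: v)) (h *: v) - f (x + t *: v))).
  apply/funext => h /=; congr (_ *: (f _ - _)).
  by rewrite [_%:A]mulr1 scalerDl addrCA.
by apply: DeriveDef; rewrite /derivable /derive E.
Qed.

Lemma is_derive_of_slice f x v (d : R) :
  is_derive (0 : R) 1 (fun t => f (x + t *: v)) d -> is_derive x v f d.
Proof.
have E : (fun h : R => h^-1 *: (((fun t => f (x + t *: v)) \o shift 0) (h *: 1)
            - f (x + 0 *: v))) =
       (fun h : R => h^-1 *: ((f \o shift x) (h *: v) - f x)).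
  apply/funext => h /=; rewrite scale0r !addr0; congr (_ *: (f _ - _)).
  by rewrite [_%:A]mulr1 addrC.
by move=> [df <-]; apply: DeriveDef; move: df; rewrite /derivable /derive E.
Qed.

Lemma is_derive_comp1 (k : R -> R) (f : V -> R) x v (dk df : R) :
  is_derive (f x) 1 k dk -> is_derive x v f df ->
  is_derive x v (k \o f) (dk * df).
Proof.
move=> hk hf; apply: is_derive_of_slice.
have hs : is_derive (0 : R) 1 (fun t => f (x + t *: v)) df.
  by apply: is_derive_slice; rewrite scale0r addr0.
have hk' : is_derive (f (x + 0 *: v)) 1 k dk by rewrite scale0r addr0.
exact: (@is_derive1_comp _ k (fun t => f (x + t *: v)) 0 dk df).
Qed.

End Slices.

Section Calculus.
Context (R : realType) (n : nat).
Implicit Types (x y : 'rV[R]_n) (A K : set 'rV[R]_n) (f g : 'rV[R]_n -> R).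

Notation e_ i := (delta_mx ord0 i : 'rV[R]_n).

Definition C1 A f := forall x, A x -> {for x, continuous f} /\
  forall i, derivable f x (e_ i) /\ {for x, continuous (partial i f)}.

Lemma C2_C1 A f : C2 A f -> C1 A f.
Proof. by move=> h x /h[? ? _]. Qed.

Lemma C2_C1_partial A f i : C2 A f -> C1 A (partial i f).
Proof. by move=> h x /h[_ h1 h2]; split; [case: (h1 i)|move=> j; exact: h2]. Qed.

Lemma C1_C2 A f : C1 A f -> (forall i, C1 A (partial i f)) -> C2 A f.
Proof.
move=> h1 h2 x Ax; have [c d] := h1 x Ax; split=> // i j.
by have [_] := h2 i x Ax; exact.
Qed.

Lemma C1_cont A f x : C1 A f -> A x -> {for x, continuous f}.
Proof. by move=> h /h[]. Qed.

Lemma C1_der A f x i : C1 A f -> A x -> is_derive x (e_ i) f (partial i f x).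
Proof. by move=> h /h[_ /(_ i)[d _]]; exact: derivableP. Qed.

Lemma is_derive_partial f x i d : is_derive x (e_ i) f d -> partial i f x = d.
Proof. by move=> h; rewrite /partial derive_val. Qed.

Lemma C1_of A f (df : 'I_n -> 'rV[R]_n -> R) : open A ->
  (forall x, A x -> {for x, continuous f}) ->
  (forall x i, A x -> is_derive x (e_ i) f (df i x)) ->
  (forall x i, A x -> {for x, continuous (df i)}) ->
  C1 A f.
Proof.
move=> oA cf df1 cdf x Ax; split; first exact: cf.
move=> i; split; first by have [] := df1 x i Ax.
have E : {near x, df i =1 partial i f}.
  near=> y; rewrite (is_derive_partial (df1 y i _))//.
  by near: y; exact: open_nbhs_nbhs.
rewrite /prop_for /continuous_at.
have -> : partial i f x = df i x by exact: (is_derive_partial (df1 x i Ax)).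
by apply: cvg_trans (cdf x i Ax); exact: near_eq_cvg E.
Unshelve. all: by end_near. Qed.

Lemma eq_cont A f g x : open A -> (forall y, A y -> f y = g y) -> A x ->
  {for x, continuous f} -> {for x, continuous g}.
Proof.
move=> oA fg Ax cf; rewrite /prop_for /continuous_at -(fg x Ax).
have E : {near x, f =1 g}.
  near=> y; apply: fg; near: y; exact: open_nbhs_nbhs.
by apply: cvg_trans cf; exact: near_eq_cvg E.
Unshelve. all: by end_near. Qed.

Lemma eq_is_derive A f g x v d : open A -> (forall y, A y -> f y = g y) -> A x ->
  is_derive x v f d -> is_derive x v g d.
Proof.
move=> oA fg Ax; have E : {near x, f =1 g}.
  near=> y; apply: fg; near: y; exact: open_nbhs_nbhs.
exact: near_eq_is_derive E.
Unshelve. all: by end_near. Qed.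

Lemma eq_C1 A f g : open A -> (forall y, A y -> f y = g y) -> C1 A f -> C1 A g.
Proof.
move=> oA fg h; apply: (@C1_of A g (fun i => partial i f)) => // x.
- by move=> Ax; apply: (eq_cont oA fg Ax); case: (h x Ax).
- by move=> i Ax; apply: (eq_is_derive oA fg Ax); exact: C1_der h Ax.
- by move=> i Ax; have [_ /(_ i)[]] := h x Ax.
Qed.

Lemma eq_partial A f g x i : open A -> (forall y, A y -> f y = g y) -> A x ->
  C1 A f -> partial i g x = partial i f x.
Proof.
move=> oA fg Ax h; apply: is_derive_partial.
by apply: (eq_is_derive oA fg Ax); exact: C1_der h Ax.
Qed.

Lemma C1_cst A c : C1 A (cst c).
Proof.
move=> x Ax; split; first exact: cst_continuous.
move=> i; split; first exact: derivable_cst.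
rewrite (_ : partial i _ = cst 0); first exact: cst_continuous.
by apply/funext => y; rewrite /partial derive_cst.
Qed.

Lemma partial_cst c i x : partial i (cst c) x = 0.
Proof. by rewrite /partial derive_cst. Qed.

Lemma partialD A f g x i : C1 A f -> C1 A g -> A x ->
  partial i (fun y => f y + g y) x = partial i f x + partial i g x.
Proof.
move=> hf hg Ax; apply: is_derive_partial.
have df := C1_der i hf Ax; have dg := C1_der i hg Ax; exact: is_deriveD.
Qed.

Lemma partialM A f g x i : C1 A f -> C1 A g -> A x ->
  partial i (fun y => f y * g y) x = partial i f x * g x + f x * partial i g x.
Proof.
move=> hf hg Ax; apply: is_derive_partial.
have df := C1_der i hf Ax; have dg := C1_der i hg Ax.
by apply: is_derive_eq (is_deriveM df dg) _; rewrite addrC /GRing.scale /= mulrC.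
Qed.

Lemma contD f g x : {for x, continuous f} -> {for x, continuous g} ->
  {for x, continuous (fun y => f y + g y)}.
Proof. move=> cf cg; exact: continuousD. Qed.

Lemma contM f g x : {for x, continuous f} -> {for x, continuous g} ->
  {for x, continuous (fun y => f y * g y)}.
Proof. move=> cf cg; exact: continuousM. Qed.

Lemma contN f x : {for x, continuous f} -> {for x, continuous (fun y => - f y)}.
Proof. move=> cf; exact: continuousN. Qed.

Lemma cont_cst (c : R) x : {for x, continuous (fun=> c : R)}.
Proof. exact: cst_continuous. Qed.

Lemma C1_pcont A f x i : C1 A f -> A x -> {for x, continuous (partial i f)}.
Proof. by move=> h /h[_ /(_ i)[]]. Qed.

Lemma C1D A f g : open A -> C1 A f -> C1 A g -> C1 A (fun x => f x + g x).
Proof.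
move=> oA hf hg.
apply: (C1_of oA (df := fun i x => partial i f x + partial i g x)) => x.
- by move=> Ax; apply: contD; [exact: C1_cont Ax|exact: C1_cont Ax].
- by move=> i Ax; have df := C1_der i hf Ax; have dg := C1_der i hg Ax;
    exact: is_deriveD.
- by move=> i Ax; apply: contD; [exact: C1_pcont Ax|exact: C1_pcont Ax].
Qed.

Lemma C1M A f g : open A -> C1 A f -> C1 A g -> C1 A (fun x => f x * g x).
Proof.
move=> oA hf hg.
apply: (C1_of oA
  (df := fun i x => partial i f x * g x + f x * partial i g x)) => x.
- by move=> Ax; apply: contM; [exact: C1_cont Ax|exact: C1_cont Ax].
- move=> i Ax; have df := C1_der i hf Ax; have dg := C1_der i hg Ax.
  by apply: is_derive_eq (is_deriveM df dg) _; rewrite addrC /GRing.scale /= mulrC.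
- move=> i Ax; apply: contD; apply: contM;
    by [exact: C1_pcont Ax|exact: C1_cont Ax].
Qed.

Lemma C1Z A c f : open A -> C1 A f -> C1 A (fun x => c * f x).
Proof. move=> oA hf; apply: (C1M (f := cst c) (g := f) oA _ hf). exact: C1_cst. Qed.

Lemma partialZ A c f x i : C1 A f -> A x ->
  partial i (fun y => c * f y) x = c * partial i f x.
Proof.
move=> hf Ax; rewrite (partialM (f := cst c) i (@C1_cst A c) hf Ax).
by rewrite partial_cst mul0r add0r.
Qed.

Lemma C1N A f : open A -> C1 A f -> C1 A (fun x => - f x).
Proof.
move=> oA hf; rewrite (_ : (fun x => - f x) = fun x => (-1) * f x).
  exact: C1Z.
by apply/funext => x; rewrite mulN1r.
Qed.

Lemma partialN A f x i : C1 A f -> A x ->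
  partial i (fun y => - f y) x = - partial i f x.
Proof.
move=> hf Ax; rewrite (_ : (fun x => - f x) = fun x => (-1) * f x).
  by rewrite (partialZ _ _ hf Ax) mulN1r.
by apply/funext => y; rewrite mulN1r.
Qed.

Lemma C1B A f g : open A -> C1 A f -> C1 A g -> C1 A (fun x => f x - g x).
Proof. by move=> oA hf hg; exact: (C1D (g := fun x => - g x) oA hf (C1N oA hg)). Qed.

Lemma partialB A f g x i : open A -> C1 A f -> C1 A g -> A x ->
  partial i (fun y => f y - g y) x = partial i f x - partial i g x.
Proof.
by move=> oA hf hg Ax; rewrite (partialD _ hf (C1N oA hg))// (partialN _ hg).
Qed.

Lemma C1_sum (I : Type) (r : seq I) A (F : I -> 'rV[R]_n -> R) : open A ->
  (forall k, C1 A (F k)) -> C1 A (fun x => \sum_(k <- r) F k x).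
Proof.
move=> oA h; elim: r => [|k r IH].
  rewrite (_ : (fun x => _) = cst 0); first exact: C1_cst.
  by apply/funext => x; rewrite big_nil.
rewrite (_ : (fun x => _) = fun x => F k x + \sum_(k <- r) F k x).
  exact: C1D.
by apply/funext => x; rewrite big_cons.
Qed.

Lemma partial_sum (I : Type) (r : seq I) A (F : I -> 'rV[R]_n -> R) x i :
  open A -> (forall k, C1 A (F k)) -> A x ->
  partial i (fun x => \sum_(k <- r) F k x) x = \sum_(k <- r) partial i (F k) x.
Proof.
move=> oA h Ax; elim: r => [|k r IH].
  rewrite (_ : (fun x => _) = cst 0) ?partial_cst ?big_nil//.
  by apply/funext => y; rewrite big_nil.
rewrite (_ : (fun x => _) = fun x => F k x + \sum_(k <- r) F k x).
  by rewrite (partialD _ (h k) (C1_sum r oA h) Ax) IH big_cons.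
by apply/funext => y; rewrite big_cons.
Qed.

Lemma is_derive_coord (j : 'I_n) x v :
  is_derive x v (fun y : 'rV[R]_n => y ord0 j) (v ord0 j).
Proof.
apply: is_derive_of_slice.
rewrite (_ : (fun t => _) = (fun t => x ord0 j + t * v ord0 j)); last first.
  by apply/funext => t; rewrite !mxE.
have h : is_derive (0 : R) 1 (fun t : R => t * v ord0 j) (v ord0 j).
  apply: is_derive_eq (@is_deriveM _ _ id (cst (v ord0 j)) 0 1 1 0 _ _) _.
  by rewrite scaler0 add0r /GRing.scale /= mulr1.
by apply: is_derive_eq (is_deriveD (is_derive_cst (x ord0 j) _ _) h) _; rewrite add0r.
Qed.

Lemma C1_coord A (j : 'I_n) : open A -> C1 A (fun y => y ord0 j).
Proof.
move=> oA; apply: (C1_of oA (df := fun i _ => (e_ i) ord0 j)) => x.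
- by move=> _; exact: coord_continuous.
- by move=> i _; exact: is_derive_coord.
- by move=> i _; exact: cont_cst.
Qed.

Lemma partial_coord (i j : 'I_n) x :
  partial i (fun y => y ord0 j) x = (i == j)%:R.
Proof.
by rewrite (is_derive_partial (is_derive_coord _ _ _)) mxE eqxx /= eq_sym.
Qed.

Lemma C1_comp A (k dk : R -> R) f : open A -> C1 A f ->
  (forall x, A x -> is_derive (f x) 1 k (dk (f x))) ->
  (forall x, A x -> {for f x, continuous dk}) ->
  C1 A (fun x => k (f x)).
Proof.
move=> oA hf hk ck.
apply: (C1_of oA (df := fun i x => dk (f x) * partial i f x)) => x.
- move=> Ax; apply: continuous_comp; first exact: C1_cont Ax.
  apply: differentiable_continuous; apply/derivable1_diffP.
  by have [] := hk x Ax.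
- move=> i Ax; have := C1_der i hf Ax; have := hk x Ax; exact: is_derive_comp1.
- move=> i Ax; apply: contM; last exact: C1_pcont Ax.
  by apply: continuous_comp; [exact: C1_cont Ax|exact: ck].
Qed.

Lemma partial_comp A (k dk : R -> R) f x i : C1 A f -> A x ->
  is_derive (f x) 1 k (dk (f x)) ->
  partial i (fun x => k (f x)) x = dk (f x) * partial i f x.
Proof.
move=> hf Ax hk; apply: is_derive_partial.
exact: is_derive_comp1 hk (C1_der i hf Ax).
Qed.

Lemma C1_off K f : closed K -> (forall x, ~ K x -> f x = 0) -> C1 (~` K) f.
Proof.
move=> cK f0; apply: (@eq_C1 _ (cst 0)); [exact: closed_openC| |exact: C1_cst].
by move=> y /f0 ->.
Qed.

Lemma partial_off K f x i : closed K -> (forall x, ~ K x -> f x = 0) -> ~ K x ->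
  partial i f x = 0.
Proof.
move=> cK f0 Kx; rewrite (@eq_partial (~` K) (cst 0)) ?partial_cst//.
- exact: closed_openC.
- by move=> y /f0 ->.
- exact: C1_cst.
Qed.

Lemma delta_ball (i j : 'I_n) (s t h : R) x : 0 <= s <= h -> 0 <= t <= h -> 0 < h ->
  ball x (3 * h) (x + s *: e_ i + t *: e_ j).
Proof.
move=> /andP[s0 sh] /andP[t0 th] h0; split; first by rewrite mulr_gt0.
move=> k l; rewrite /ball /= !mxE !ord1 eqxx /=.
rewrite -addrA opprD addrA subrr add0r normrN.
apply: le_lt_trans (_ : s + t < _); last by lra.
rewrite (le_trans (ler_normD _ _))// lerD// normrM ger0_norm//.
  by rewrite ler_piMr// ger0_norm ?ler0n// -[leRHS]/(1%:R) ler_nat; case: (l == i).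
by rewrite ler_piMr// ger0_norm ?ler0n// -[leRHS]/(1%:R) ler_nat; case: (l == j).
Qed.

(** Two applications of the mean value theorem: first along [e_ i] to the
    difference in direction [e_ j], then along [e_ j] to the derivative.  The
    left-hand side is symmetric in [i] and [j], whence [partial_sym]. *)
Lemma second_difference A f x i j (h : R) : C2 A f -> 0 < h ->
  ball x (3 * h) `<=` A ->
  exists2 y, ball x (3 * h) y &
   f (x + h *: e_ i + h *: e_ j) - f (x + h *: e_ i) - f (x + h *: e_ j) + f x
   = partial j (partial i f) y * h ^+ 2.
Proof.
move=> hf h0 bA.
pose phi s := f (x + h *: e_ j + s *: e_ i) - f (x + s *: e_ i).
have bx s t : 0 <= s <= h -> 0 <= t <= h -> ball x (3 * h) (x + s *: e_ i + t *: e_ j).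
  by move=> ? ?; exact: delta_ball.
pose dphi s := partial i f (x + h *: e_ j + s *: e_ i) - partial i f (x + s *: e_ i).
have phi' s : s \in `[0, h]%R -> is_derive s 1 phi (dphi s).
  rewrite in_itv /= => sh; apply: is_deriveB; apply: is_derive_slice.
    apply: (C1_der i (C2_C1 hf)); apply: bA; rewrite addrAC; apply: bx => //.
    by rewrite lexx ltW.
  apply: (C1_der i (C2_C1 hf)); apply: bA.
  by rewrite -[X in ball _ _ X]addr0 -(scale0r (e_ j)); apply: bx => //; rewrite lexx ltW.
have cphi : {within `[0, h], continuous phi}.
  by apply: derivable_within_continuous => s sh; have [] := phi' s sh.
have phi'' s : s \in `]0, h[%R -> is_derive s 1 phi (dphi s).
  by move=> sh; apply: phi'; exact: subset_itv_oo_cc sh.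
have [s sh E1] := MVT_segment (ltW h0) phi'' cphi.
pose psi t := partial i f (x + s *: e_ i + t *: e_ j).
pose dpsi t := partial j (partial i f) (x + s *: e_ i + t *: e_ j).
have psi' t : t \in `[0, h]%R -> is_derive t 1 psi (dpsi t).
  rewrite in_itv /= => th; apply: is_derive_slice.
  by apply: (C1_der j (C2_C1_partial i hf)); apply: bA; apply: bx.
have cpsi : {within `[0, h], continuous psi}.
  by apply: derivable_within_continuous => t th; have [] := psi' t th.
have psi'' t : t \in `]0, h[%R -> is_derive t 1 psi (dpsi t).
  by move=> th; apply: psi'; exact: subset_itv_oo_cc th.
have [t th] := MVT_segment (ltW h0) psi'' cpsi.
rewrite /psi scale0r addr0 subr0 => E2.
exists (x + s *: e_ i + t *: e_ j); first by apply: bx.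
move: E1; rewrite subr0 /dphi (addrAC x (h *: e_ j)) E2 /phi scale0r !addr0.
rewrite (addrAC x (h *: e_ j)) => E1.
by rewrite expr2 mulrA -E1; ring.
Qed.

Lemma partial_sym A f x i j : open A -> C2 A f -> A x ->
  partial i (partial j f) x = partial j (partial i f) x.
Proof.
move=> oA hf Ax.
apply/eqP; rewrite -subr_eq0 -normr_le0; apply/ler_addgt0Pr => e e0.
rewrite add0r.
have e2 : 0 < e / 2 by rewrite divr_gt0.
have c1 : {for x, continuous (partial i (partial j f))}.
  exact: C1_pcont (C2_C1_partial j hf) Ax.
have c2 : {for x, continuous (partial j (partial i f))}.
  exact: C1_pcont (C2_C1_partial i hf) Ax.
have N : nbhs x (A `&` ((fun y => `|partial i (partial j f) x - partial i (partial j f) y| < e / 2)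
   `&` (fun y => `|partial j (partial i f) x - partial j (partial i f) y| < e / 2))).
  apply: filterI; first exact: open_nbhs_nbhs.
  apply: filterI.
  - by move/cvgr_dist_lt : c1; apply.
  - by move/cvgr_dist_lt : c2; apply.
move/nbhs_ballP : N => [r /= r0 rN].
have h0 : 0 < r / 3 by rewrite divr_gt0.
have r3 : 3 * (r / 3) = r by field.
have bA : ball x (3 * (r / 3)) `<=` A by rewrite r3; move=> y /rN[].
have [y1 b1 E1] := second_difference i j hf h0 bA.
have [y2 b2 E2] := second_difference j i hf h0 bA.
rewrite r3 in b1 b2.
have [_ [_ l1]] := rN _ b1.
have [_ [l2 _]] := rN _ b2; cbv beta in l1, l2.
have E : partial j (partial i f) y1 = partial i (partial j f) y2.
  apply: (@mulIf _ ((r / 3) ^+ 2)); first by rewrite expf_neq0// gt_eqF.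
  apply: etrans (esym E1) _; apply: etrans _ E2.
  rewrite [x + _ *: e_ j + _ *: e_ i]addrAC.
  by congr (_ + _); rewrite -!addrA; congr (_ + _); rewrite addrC.
apply/ltW; rewrite [e]splitr; move: l1 l2; rewrite E.
move: (partial i _ x) (partial j _ x) (partial i _ y2) => p q r' l1 l2.
have -> : p - q = (p - r') + (r' - q) by ring.
apply: le_lt_trans (ler_normD _ _) _; apply: ltrD; first exact: l2.
by rewrite distrC; exact: l1.
Qed.

End Calculus.

(** * Integrals of derivatives over R^n *)

Section Integral1.
Context (R : realType).
Notation mu := (@lebesgue_measure R).

(** The fundamental theorem of calculus on an interval whose end points lie
    outside the support. *)
Lemma integral_derivative_compact (g dg : R -> R) (B : R) :
  (forall t : R, is_derive t (1 : R) g (dg t)) -> continuous dg ->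
  (forall t, B < `|t| -> g t = 0) ->
  (\int[mu]_t (dg t)%:E = 0)%E.
Proof.
move=> gd cdg g0.
pose C := `|B| + 1.
have C0 : 0 < C by rewrite ltr_pwDr.
have BC t : C <= `|t| -> B < `|t|.
  by apply: lt_le_trans; rewrite (le_lt_trans (ler_norm _))// ltrDl.
have dg0 t : C < `|t| -> dg t = 0.
  move=> Ct; have := gd t; rewrite -(@derive_val _ _ _ _ _ _ _ (gd t)) => _.
  rewrite -[RHS](derive_cst (0 : R) t (1 : R)); apply: near_eq_derive.
  have : \forall s \near t, C < `|s|.
    have cn : {for t, continuous (fun s : R => `|s|)} by exact: norm_continuous.
    by move/cvgr_gt : cn; apply.
  by apply: filterS => s Cs; rewrite g0//; apply: BC; exact: ltW.
have cg : continuous g.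
  move=> t; apply: differentiable_continuous; apply/derivable1_diffP.
  by have [] := gd t.
rewrite (_ : (fun t => _) = ((EFin \o dg) \_ `[- C, C])).
  rewrite -integral_mkcond (@continuous_FTC2 _ dg g).
  - by rewrite !g0 ?subee//; apply: BC; rewrite ?normrN ger0_norm// ltW.
  - by rewrite gtrN.
  - by apply: continuous_subspaceT.
  - split; first by move=> t _; have [] := gd t.
      by apply: cvg_at_right_filter; exact: cg.
    by apply: cvg_at_left_filter; exact: cg.
  - by move=> t _; rewrite derive1E (@derive_val _ _ _ _ _ _ _ (gd t)).
apply/funext => t; rewrite patchE; case: ifPn => // /negP tC /=.
rewrite dg0// ltNge; apply/negP => tC'; apply: tC.
by rewrite inE /= in_itv /= -ler_norml.
Qed.

End Integral1.

Section Integral.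
Context (R : realType).
Implicit Types (n : nat).

Definition bsupp n (F : 'rV[R]_n -> R) :=
  exists B : R, forall x, F x != 0 -> forall i, `|x ord0 i| <= B.

Definition box n (c : R) : set 'rV[R]_n :=
  [set x : 'rV[R]_n | forall i, x ord0 i \in `]- c, c[].

Lemma box_measurable n c : measurable (@box n c).
Proof.
rewrite [X in measurable X](_ : _ = \bigcap_(i in [set: 'I_n])
    (fun x : 'rV[R]_n => x ord0 i) @^-1` `]- c, c[%classic).
  apply: fin_bigcap_measurable => // i _; apply: open_measurable_rV.
  apply: open_comp; last exact: interval_open.
  by move=> v _; exact: coord_continuous.
by apply/seteqP; split=> x /= h i; [move=> _; exact: h|exact: (h i I)].
Qed.

Lemma box_lty n c : 0 <= c -> (lebesgue_rV R n (@box n c) < +oo)%E.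
Proof.
move=> c0; have := @lebesgue_rV_box R n (fun=> - c) (fun=> c).
rewrite -/(@box n c) => ->; first by rewrite ltry.
by move=> _; rewrite ge0_cp.
Qed.

Lemma measurable_cont n (F : 'rV[R]_n -> R) (D : set 'rV[R]_n) : open D ->
  (forall x, D x -> {for x, continuous F}) -> measurable_fun D F.
Proof.
move=> oD cF; apply: (measurability _ (RGenOpens.measurableE R)).
move=> _ [_ [a [b ->]] <-]; apply: open_measurable_rV.
rewrite openE => x [Dx /= Fx].
have := cF x Dx => /(_ _ (open_nbhs_nbhs (conj (interval_open _ _) Fx))).
rewrite /= => N; apply: filterI; first exact: open_nbhs_nbhs.
by apply: N.
Qed.

Lemma measurable_contT n (F : 'rV[R]_n -> R) : continuous F -> measurable_fun setT F.
Proof. by move=> cF; apply: measurable_cont; [exact: openT|move=> x _; exact: cF]. Qed.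

Lemma Cc_bounded n (F : 'rV[R]_n -> R) : continuous F -> bsupp F ->
  exists2 M, 0 <= M & forall x, `|F x| <= M.
Proof.
move=> cF [B hB].
have cK := @rV_compact _ n (fun=> `[- B, B]%classic) (fun=> @segment_compact R _ _).
have := continuous_compact (continuous_subspaceT cF) cK.
move/compact_bounded => [M [_ hM]].
exists (`|M| + 1) => [|x]; first by rewrite addr_ge0.
have [->|Fx] := eqVneq (F x) 0; first by rewrite normr0 addr_ge0.
apply: hM; first by rewrite (le_lt_trans (ler_norm _))// ltrDl.
exists x => // i /=; rewrite in_itv /= -ler_norml; exact: hB.
Qed.

Lemma Cc_integrable n (F : 'rV[R]_n -> R) : continuous F -> bsupp F ->
  (lebesgue_rV R n).-integrable setT (EFin \o F).
Proof.
move=> cF bF; have [M M0 hM] := Cc_bounded cF bF; have [B hB] := bF.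
have -> : EFin \o F = (EFin \o F) \_ (@box n (`|B| + 1)).
  apply/funext => x; rewrite patchE; case: ifPn => // /negP xb /=.
  have [->//|Fx] := eqVneq (F x) 0; case: xb; rewrite inE => i.
  rewrite in_itv /= -ltr_norml (le_lt_trans (hB x Fx i))//.
  by rewrite (le_lt_trans (ler_norm _))// ltrDl.
rewrite -integrable_mkcond; last exact: box_measurable.
apply: measurable_bounded_integrable; first exact: box_measurable.
- by apply: box_lty; rewrite addr_ge0.
- apply: (@measurable_funS _ _ _ _ setT) => //; exact: measurable_contT.
- exists M; split; first exact: num_real.
  by move=> y My x _; apply: le_trans (hM x) _; exact: ltW.
Qed.

Lemma integrable_comp_row_cons n (F : 'rV[R]_n.+1 -> R) : measurable_fun setT F ->
  (lebesgue_rV R n.+1).-integrable setT (EFin \o F) ->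
  (lebesgue_measure \x lebesgue_rV R n)%E.-integrable setT
     ((EFin \o F) \o @row_cons R n).
Proof.
move=> mF /integrableP[_ iF]; apply/integrableP; split.
  apply: measurableT_comp; last exact: measurable_row_cons.
  exact/measurable_EFinP.
move: iF; rewrite /= /lebesgue_rcons ge0_integral_pushforward//.
- exact: measurable_row_cons.
- by apply/measurable_EFinP; apply: measurableT_comp.
Qed.

Lemma integral_rcons n (F : 'rV[R]_n.+1 -> R) : measurable_fun setT F ->
  (lebesgue_rV R n.+1).-integrable setT (EFin \o F) ->
  (\int[lebesgue_rV R n.+1]_x (F x)%:E =
   \int[(lebesgue_measure \x lebesgue_rV R n)%E]_z (F (row_cons z))%:E)%E.
Proof.
move=> mF iF; rewrite /= /lebesgue_rcons (@integral_pushforward _ _ _ _ _ (@row_cons R n)) //.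
- exact: measurable_row_cons.
- exact/measurable_EFinP.
- exact: integrable_comp_row_cons.
Qed.

Lemma row_cons_addl n t (s : R) (v : 'rV[R]_n) :
  row_cons (t + s, v) = row_cons (t, v) + s *: delta_mx ord0 ord0.
Proof.
apply/rowP => k; rewrite [RHS]mxE [X in _ = _ + X]mxE [X in _ = _ + _ * X]mxE.
case: (unliftP ord0 k) => [j|] ->; rewrite ?row_cons_tail ?row_cons_head /=.
  by rewrite mulr0 addr0.
by rewrite mulr1.
Qed.

Lemma row_cons_addr n (t s : R) (v : 'rV[R]_n) j :
  row_cons (t, v + s *: delta_mx ord0 j) =
  row_cons (t, v) + s *: delta_mx ord0 (lift ord0 j).
Proof.
apply/rowP => k; rewrite [RHS]mxE [X in _ = _ + X]mxE [X in _ = _ + _ * X]mxE.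
case: (unliftP ord0 k) => [l|] ->; rewrite ?row_cons_tail ?row_cons_head /=.
  by rewrite !mxE (inj_eq lift_inj).
by rewrite mulr0 addr0.
Qed.

Lemma row_cons_ball n (p q : R * 'rV[R]_n) e : 0 < e -> ball p.1 e q.1 ->
  ball p.2 e q.2 -> ball (row_cons p) e (row_cons q).
Proof.
move=> e0 h1 h2; split=> // i j; rewrite ord1.
case: (unliftP ord0 j) => [l|] ->; rewrite ?row_cons_tail ?row_cons_head //.
by case: h2 => _; apply.
Qed.

Lemma row_cons_contr n (t : R) : continuous (fun v : 'rV[R]_n => row_cons (t, v)).
Proof.
move=> v A /nbhs_ballP[e e0 eA]; apply/nbhs_ballP; exists e => // w bw; apply: eA.
by apply: row_cons_ball => //=; exact: ballxx.
Qed.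

Lemma row_cons_contl n (v : 'rV[R]_n) : continuous (fun t : R => row_cons (t, v)).
Proof.
move=> t A /nbhs_ballP[e e0 eA]; apply/nbhs_ballP; exists e => // w bw; apply: eA.
by apply: row_cons_ball => //=; exact: ballxx.
Qed.

Lemma bsupp_partial n (F : 'rV[R]_n -> R) i : bsupp F -> bsupp (partial i F).
Proof.
move=> [B hB]; exists B => x + j; apply: contraNT; rewrite -ltNge => xB.
rewrite /partial -(derive_cst (0 : R) x (delta_mx ord0 i)); apply/eqP.
apply: near_eq_derive.
have c : {for x, continuous (fun y : 'rV[R]_n => `|y ord0 j|)}.
  apply: continuous_comp; first exact: coord_continuous.
  exact: norm_continuous.
have : nbhs x [set y : 'rV[R]_n | B < `|y ord0 j|] by move/cvgr_gt : c; apply.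
apply: filterS => y By; apply: contraTeq By => Fy.
by rewrite -leNgt; exact: hB.
Qed.

(** Fubini.  If [i] is the first coordinate, the inner integral is that of a
    derivative on the line; otherwise the inner integral is an instance of the
    same statement in dimension [n]. *)
Lemma integral_partial n (F : 'rV[R]_n -> R) i : C1 setT F -> bsupp F ->
  (\int[lebesgue_rV R n]_x (partial i F x)%:E = 0)%E.
Proof.
elim: n F i => [|n IH] F i hF bF; first by case: i.
have cdF : continuous (partial i F) by move=> x; exact: C1_pcont hF I.
have mdF : measurable_fun setT (partial i F) by exact: measurable_contT.
have idF := Cc_integrable cdF (bsupp_partial i bF).
rewrite integral_rcons//.
have ipF := integrable_comp_row_cons mdF idF.
have [B hB] := bF.
case: (unliftP ord0 i) => [j|] Ei.
- rewrite -(integral12_prod_meas1 ipF); apply: integral0_eq => t _.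
  pose G := fun v : 'rV[R]_n => F (row_cons (t, v)).
  have dG (v : 'rV[R]_n) k :
     is_derive v (delta_mx ord0 k) G (partial (lift ord0 k) F (row_cons (t, v))).
    apply: is_derive_of_slice; rewrite /G.
    under eq_fun do rewrite row_cons_addr.
    by apply: is_derive_slice; rewrite scale0r addr0; exact: C1_der hF I.
  have cG : C1 setT G.
    apply: (C1_of (df := fun k v => partial (lift ord0 k) F (row_cons (t, v)))).
    + exact: openT.
    + move=> v _; apply: (continuous_comp (f := fun v => row_cons (t, v)) (g := F)).
        exact: row_cons_contr.
      exact: C1_cont hF I.
    + move=> v k _; apply: (continuous_comp (f := fun v => row_cons (t, v))
        (g := partial (lift ord0 k) F)).
        exact: row_cons_contr.
      exact: C1_pcont hF I.
  have bG : bsupp G.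
    by exists B => v /hB hv k; rewrite -(row_cons_tail (t, v)).
  rewrite -[RHS](IH G j cG bG); apply: eq_integral => v _ /=.
  by rewrite (is_derive_partial (dG v j)) Ei.
- rewrite -(integral21_prod_meas1 ipF); apply: integral0_eq => v _.
  apply: (@integral_derivative_compact _ (fun t => F (row_cons (t, v))) _ B).
  + move=> t; rewrite Ei; apply: is_derive_of_slice.
    under eq_fun do rewrite [_ *: _]mulr1 row_cons_addl.
    by apply: is_derive_slice; rewrite scale0r addr0; exact: C1_der hF I.
  + move=> t; apply: (continuous_comp (f := fun t => row_cons (t, v))
        (g := partial i F)).
      exact: row_cons_contl.
    exact: cdF.
  + move=> t Bt; apply: contraTeq Bt => /hB/(_ ord0).
    by rewrite row_cons_head -leNgt.
Qed.

End Integral.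

(** * Euler field, scaled gradient form and cylindrical Laplacian *)

Lemma sum_CS (R : realType) (n : nat) (a b : 'I_n -> R) :
  (\sum_i a i * b i) ^+ 2 <= (\sum_i a i ^+ 2) * (\sum_i b i ^+ 2).
Proof.
set S := \sum_i a i * b i; set P := \sum_i a i ^+ 2; set Q := \sum_i b i ^+ 2.
have P0 : 0 <= P by apply: sumr_ge0 => i _; exact: sqr_ge0.
have h (t : R) : 0 <= t ^+ 2 * P - 2 * t * S + Q.
  have -> : t ^+ 2 * P - 2 * t * S + Q = \sum_i (t * a i - b i) ^+ 2.
    rewrite /S /P /Q !mulr_sumr -sumrB -big_split /=.
    by apply: eq_bigr => i _; ring.
  by apply: sumr_ge0 => i _; exact: sqr_ge0.
have [P00|Pn0] := eqVneq P 0.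
  have a0 i : a i = 0.
    apply/eqP; rewrite -sqrf_eq0.
    have /eqP := P00; rewrite psumr_eq0 => [/allP/(_ i)|? _]; last exact: sqr_ge0.
    by rewrite mem_index_enum; apply.
  rewrite /S big1 ?expr0n ?P00 ?mul0r// => i _; by rewrite a0 mul0r.
have Pp : 0 < P by rewrite lt_def Pn0.
have := h (S / P).
have -> : (S / P) ^+ 2 * P - 2 * (S / P) * S + Q = (P * Q - S ^+ 2) / P by field.
by rewrite pmulr_lge0 ?invr_gt0// subr_ge0.
Qed.

Lemma cont_sum (R : realType) (n : nat) (I : Type) (r : seq I)
    (F : I -> 'rV[R]_n -> R) x : (forall i, {for x, continuous (F i)}) ->
  {for x, continuous (fun x => \sum_(i <- r) F i x)}.
Proof.
move=> h; elim: r => [|k r IH].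
  rewrite (_ : (fun x => _) = cst 0); first exact: cst_continuous.
  by apply/funext => y; rewrite big_nil.
rewrite (_ : (fun x => _) = fun x => F k x + \sum_(k <- r) F k x).
  exact: contD.
by apply/funext => y; rewrite big_cons.
Qed.

(** In polar coordinates around [p], with [tau] the logarithm of the radius,
    [eul] is the derivative in [tau], [lap0] is the Laplacian of the cylinder
    (second derivative in [tau] plus spherical Laplacian), and [gam] is the
    squared-gradient form of the cylinder.  Written in Cartesian coordinates
    they avoid any coordinate change. *)
Section Radial.
Context (R : realType) (n : nat) (p : 'rV[R]_n).
Implicit Types (x : 'rV[R]_n) (A K : set 'rV[R]_n) (f g : 'rV[R]_n -> R).

Definition crd (i : 'I_n) x : R := x ord0 i - p ord0 i.
Definition sq x : R := \sum_i crd i x ^+ 2.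
Definition eul f x : R := \sum_i crd i x * partial i f x.
Definition gam f g x : R := sq x * \sum_i partial i f x * partial i g x.
Definition lap0 f x : R := sq x * laplacian f x - (n%:R - 2) * eul f x.

Lemma sq_ge0 x : 0 <= sq x.
Proof. by apply: sumr_ge0 => i _; exact: sqr_ge0. Qed.

Lemma C1_crd A i : open A -> C1 A (crd i).
Proof. by move=> oA; apply: (C1B oA (C1_coord _ oA)); exact: C1_cst. Qed.

Lemma partial_crd i j x : partial i (crd j) x = (i == j)%:R.
Proof.
rewrite /crd (@partialB _ _ setT (fun x => x ord0 j) (cst (p ord0 j)))//.
- by rewrite partial_coord partial_cst subr0.
- exact: openT.
- by apply: C1_coord; exact: openT.
- exact: C1_cst.
Qed.

Lemma C1_sq A : open A -> C1 A sq.
Proof.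
move=> oA; apply: (C1_sum _ oA (F := fun i x => crd i x ^+ 2)) => i.
by apply: (C1M oA); exact: C1_crd.
Qed.

Lemma partial_sq i x : partial i sq x = 2 * crd i x.
Proof.
have oT := @openT 'rV[R]_n.
rewrite (partial_sum _ (F := fun i x => crd i x ^+ 2) _ oT)//; last first.
  by move=> k; apply: (C1M oT); exact: C1_crd.
rewrite (bigD1 i)//= big1 ?addr0 => [|j ji].
  rewrite (@partialM _ _ setT (crd i) (crd i))//; try exact: C1_crd.
  by rewrite partial_crd eqxx mul1r mulr1 mulr_natl mulr2n.
rewrite (@partialM _ _ setT (crd j) (crd j))//; try exact: C1_crd.
by rewrite partial_crd eq_sym (negbTE ji) mul0r mulr0 addr0.
Qed.

Section Rules.
Variables (A : set 'rV[R]_n).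
Hypothesis oA : open A.

Lemma C1_eul f : C2 A f -> C1 A (eul f).
Proof.
move=> hf; apply: (C1_sum _ oA (F := fun i x => crd i x * partial i f x)) => i.
by apply: (C1M oA); [exact: C1_crd|exact: C2_C1_partial].
Qed.

Lemma cont_eul f x : C1 A f -> A x -> {for x, continuous (eul f)}.
Proof.
move=> hf Ax; rewrite /eul.
apply: (cont_sum _ (F := fun i x => crd i x * partial i f x)) => i.
by apply: contM; [exact: C1_cont (C1_crd i oA) Ax|exact: C1_pcont Ax].
Qed.

Lemma cont_gam f g x : C1 A f -> C1 A g -> A x -> {for x, continuous (gam f g)}.
Proof.
move=> hf hg Ax; apply: contM; first exact: C1_cont (C1_sq oA) Ax.
apply: (cont_sum _ (F := fun i x => partial i f x * partial i g x)) => i.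
by apply: contM; exact: C1_pcont Ax.
Qed.

Lemma cont_laplacian f x : C2 A f -> A x -> {for x, continuous (laplacian f)}.
Proof.
move=> hf Ax.
apply: (cont_sum _ (F := fun i => partial i (partial i f))) => i.
exact: C1_pcont (C2_C1_partial i hf) Ax.
Qed.

Lemma cont_lap0 f x : C2 A f -> A x -> {for x, continuous (lap0 f)}.
Proof.
move=> hf Ax; apply: contD; first apply: contM.
- exact: C1_cont (C1_sq oA) Ax.
- exact: cont_laplacian.
- by apply: contN; apply: contM; [exact: cont_cst|apply: cont_eul => //; exact: C2_C1].
Qed.

Lemma C1_gam f g : C2 A f -> C2 A g -> C1 A (gam f g).
Proof.
move=> hf hg; apply: (C1M oA (C1_sq oA)).
apply: (C1_sum _ oA (F := fun i x => partial i f x * partial i g x)) => i.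
by apply: (C1M oA); exact: C2_C1_partial.
Qed.

Lemma eulD f g x : C1 A f -> C1 A g -> A x ->
  eul (fun y => f y + g y) x = eul f x + eul g x.
Proof.
move=> hf hg Ax; rewrite /eul -big_split /=; apply: eq_bigr => i _.
by rewrite (partialD i hf hg Ax) mulrDr.
Qed.

Lemma eulM f g x : C1 A f -> C1 A g -> A x ->
  eul (fun y => f y * g y) x = eul f x * g x + f x * eul g x.
Proof.
move=> hf hg Ax; rewrite /eul mulr_sumr mulr_suml -big_split /=.
by apply: eq_bigr => i _; rewrite (partialM i hf hg Ax); ring.
Qed.

Lemma eulZ c f x : C1 A f -> A x -> eul (fun y => c * f y) x = c * eul f x.
Proof.
move=> hf Ax; rewrite /eul mulr_sumr; apply: eq_bigr => i _.
by rewrite (partialZ _ _ hf Ax); ring.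
Qed.

Lemma gamC f g x : gam f g x = gam g f x.
Proof. by rewrite /gam; congr (_ * _); apply: eq_bigr => i _; rewrite mulrC. Qed.

Lemma gamDr h f g x : C1 A f -> C1 A g -> A x ->
  gam h (fun y => f y + g y) x = gam h f x + gam h g x.
Proof.
move=> hf hg Ax; rewrite /gam -mulrDr -big_split /=; congr (_ * _).
by apply: eq_bigr => i _; rewrite (partialD i hf hg Ax) mulrDr.
Qed.

Lemma gamMr h f g x : C1 A f -> C1 A g -> A x ->
  gam h (fun y => f y * g y) x = gam h f x * g x + f x * gam h g x.
Proof.
move=> hf hg Ax; rewrite /gam.
have -> : \sum_i partial i h x * partial i (fun y => f y * g y) x =
   (\sum_i partial i h x * partial i f x) * g x +
   f x * \sum_i partial i h x * partial i g x.
  rewrite mulr_sumr mulr_suml -big_split /=.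
  by apply: eq_bigr => i _; rewrite (partialM i hf hg Ax); ring.
by ring.
Qed.

Lemma gamZr c h f x : C1 A f -> A x -> gam h (fun y => c * f y) x = c * gam h f x.
Proof.
move=> hf Ax; rewrite /gam mulrCA; congr (_ * _); rewrite mulr_sumr.
by apply: eq_bigr => i _; rewrite (partialZ _ _ hf Ax); ring.
Qed.

Lemma eul_sq x : eul sq x = 2 * sq x.
Proof.
rewrite /eul /sq mulr_sumr; apply: eq_bigr => i _.
by rewrite partial_sq; ring.
Qed.

Lemma gam_sq f x : gam f sq x = 2 * sq x * eul f x.
Proof.
rewrite /gam /eul [2 * _]mulrC -mulrA; congr (_ * _); rewrite mulr_sumr.
by apply: eq_bigr => i _; rewrite partial_sq; ring.
Qed.

Lemma gam_ge0 f x : 0 <= gam f f x.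
Proof.
apply: mulr_ge0; first exact: sq_ge0.
by apply: sumr_ge0 => i _; rewrite -expr2 sqr_ge0.
Qed.

Lemma eul_le_gam f x : eul f x ^+ 2 <= gam f f x.
Proof.
have := sum_CS (fun i => crd i x) (fun i => partial i f x).
rewrite /gam /eul /sq => /le_trans; apply; apply: ler_wpM2l => //.
by apply: sumr_ge0 => i _; exact: sqr_ge0.
Qed.

Lemma gam_CS f g x : gam f g x ^+ 2 <= gam f f x * gam g g x.
Proof.
have := sum_CS (fun i => partial i f x) (fun i => partial i g x).
rewrite /gam exprMn => CS.
have -> : sq x * (\sum_i partial i f x * partial i f x) *
   (sq x * \sum_i partial i g x * partial i g x) = sq x ^+ 2 *
   ((\sum_i partial i f x * partial i f x) * \sum_i partial i g x * partial i g x).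
  by ring.
by apply: ler_wpM2l => //; exact: sqr_ge0.
Qed.

(** On the cylinder [eul] is a translation-invariant field, hence commutes with
    the gradient form.  In Cartesian coordinates this is the symmetry of second
    derivatives, the factor [sq] of [gam] accounting for the rest. *)
Lemma eul_gam f x : C2 A f -> A x -> eul (gam f f) x = 2 * gam f (eul f) x.
Proof.
move=> hf Ax.
have hp i := C2_C1_partial i hf.
have hs : C1 A (fun x => \sum_i partial i f x * partial i f x).
  by apply: (C1_sum _ oA (F := fun i x => partial i f x * partial i f x)) => i;
    apply: (C1M oA).
rewrite (eulM (C1_sq oA) hs Ax) eul_sq.
have -> : eul (fun x => \sum_i partial i f x * partial i f x) x =
    2 * \sum_i \sum_j crd i x * (partial j f x * partial i (partial j f) x).
  rewrite /eul mulr_sumr; apply: eq_bigr => i _.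
  have hpp j : C1 A (fun x => partial j f x * partial j f x).
    exact: C1M oA (hp j) (hp j).
  rewrite (partial_sum _ (F := fun i x => partial i f x * partial i f x) i oA hpp Ax).
  rewrite !mulr_sumr; apply: eq_bigr => j _.
  by rewrite (partialM i (hp j) (hp j) Ax); ring.
have Ee j : partial j (eul f) x = partial j f x +
    \sum_i crd i x * partial i (partial j f) x.
  have hcp i : C1 A (fun x => crd i x * partial i f x).
    exact: C1M oA (C1_crd i oA) (hp i).
  rewrite (partial_sum _ (F := fun i x => crd i x * partial i f x) j oA hcp Ax).
  have -> : partial j f x = \sum_i (j == i)%:R * partial i f x.
    rewrite (bigD1 j)//= eqxx mul1r big1 ?addr0// => i /negbTE.
    by rewrite eq_sym => ->; rewrite mul0r.
  rewrite -big_split /=; apply: eq_bigr => i _.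
  rewrite (partialM j (C1_crd i oA) (hp i) Ax) partial_crd.
  by rewrite (partial_sym j i oA hf Ax).
rewrite /gam.
have -> : \sum_i partial i f x * partial i (eul f) x =
    \sum_i partial i f x * partial i f x +
    \sum_i \sum_j crd i x * (partial j f x * partial i (partial j f) x).
  rewrite [X in _ + X]exchange_big -big_split /=; apply: eq_bigr => j _.
  rewrite Ee mulrDr; congr (_ + _); rewrite mulr_sumr; apply: eq_bigr => i _.
  by ring.
by ring.
Qed.

Lemma lap0M f g x : C2 A f -> C2 A g -> A x ->
  lap0 (fun y => f y * g y) x = f x * lap0 g x + g x * lap0 f x + 2 * gam f g x.
Proof.
move=> hf hg Ax; have hf1 := C2_C1 hf; have hg1 := C2_C1 hg.
rewrite /lap0 (eulM hf1 hg1 Ax).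
have -> : laplacian (fun y => f y * g y) x = f x * laplacian g x +
   g x * laplacian f x + 2 * \sum_i partial i f x * partial i g x.
  rewrite /laplacian !mulr_sumr -!big_split /=; apply: eq_bigr => i _.
  have hfi := C2_C1_partial i hf; have hgi := C2_C1_partial i hg.
  have h1 := C1M oA hfi hg1; have h2 := C1M oA hf1 hgi.
  have E y : A y -> partial i f y * g y + f y * partial i g y =
      partial i (fun y => f y * g y) y.
    by move=> Ay; rewrite (partialM i hf1 hg1 Ay).
  rewrite (eq_partial i oA E Ax (C1D oA h1 h2)).
  rewrite (partialD i h1 h2 Ax) (partialM i hfi hg1 Ax) (partialM i hf1 hgi Ax).
  move: (partial i (partial i f) x) (partial i (partial i g) x) => a b.
  move: (partial i f x) (partial i g x) (f x) (g x) => c d u v.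
  by ring.
rewrite /gam; move: (laplacian f x) (laplacian g x) (eul f x) (eul g x).
by move: (\sum_i _) (sq x) (f x) (g x) => e s u v a b c d; ring.
Qed.

Lemma C2M f g : C2 A f -> C2 A g -> C2 A (fun y => f y * g y).
Proof.
move=> hf hg; have hf1 := C2_C1 hf; have hg1 := C2_C1 hg.
apply: C1_C2; first exact: C1M.
move=> i; have hfi := C2_C1_partial i hf; have hgi := C2_C1_partial i hg.
have E y : A y -> partial i f y * g y + f y * partial i g y =
    partial i (fun y => f y * g y) y.
  by move=> Ay; rewrite (partialM i hf1 hg1 Ay).
exact: (eq_C1 oA E (C1D oA (C1M oA hfi hg1) (C1M oA hf1 hgi))).
Qed.

(** Radial functions are expressed through the squared radius rather than the
    radius, so that no square root appears in their derivatives. *)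
Section RadialFun.
Variables (k k1 : R -> R).
Hypothesis sq_pos : forall x, A x -> 0 < sq x.
Hypothesis k'E : forall s : R, 0 < s -> is_derive s (1 : R) k (k1 s).
Hypothesis ck1 : forall s : R, 0 < s -> {for s, continuous k1}.

Lemma C1_radial : C1 A (fun x => k (sq x)).
Proof.
apply: (@C1_comp _ _ A k k1 sq) => //; first exact: C1_sq.
  by move=> x /sq_pos/k'E.
by move=> x /sq_pos/ck1.
Qed.

Lemma partial_radial i x : A x ->
  partial i (fun x => k (sq x)) x = k1 (sq x) * (2 * crd i x).
Proof.
move=> Ax; rewrite (partial_comp i (C1_sq oA) Ax (k'E (sq_pos Ax))).
by rewrite partial_sq.
Qed.

Lemma eul_radial x : A x -> eul (fun x => k (sq x)) x = 2 * sq x * k1 (sq x).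
Proof.
move=> Ax; rewrite -eul_sq /eul mulr_suml; apply: eq_bigr => i _.
by rewrite partial_radial// partial_sq; ring.
Qed.

Lemma gam_radial f x : A x ->
  gam f (fun x => k (sq x)) x = 2 * sq x * k1 (sq x) * eul f x.
Proof.
move=> Ax; rewrite mulrAC -gam_sq /gam -mulrA; congr (_ * _); rewrite mulr_suml.
by apply: eq_bigr => i _; rewrite partial_radial// partial_sq; ring.
Qed.

End RadialFun.

Section RadialFun2.
Variables (k k1 k2 : R -> R).
Hypothesis sq_pos : forall x, A x -> 0 < sq x.
Hypothesis k'E : forall s : R, 0 < s -> is_derive s (1 : R) k (k1 s).
Hypothesis k1'E : forall s : R, 0 < s -> is_derive s (1 : R) k1 (k2 s).
Hypothesis ck2 : forall s : R, 0 < s -> {for s, continuous k2}.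

Let ck1 s : 0 < s -> {for s, continuous k1}.
Proof.
move=> s0; apply: differentiable_continuous; apply/derivable1_diffP.
by have [] := k1'E s0.
Qed.

Lemma C2_radial : C2 A (fun x => k (sq x)).
Proof.
apply: C1_C2; first exact: (C1_radial sq_pos k'E ck1).
move=> i; apply: (@eq_C1 _ _ A (fun x => k1 (sq x) * (2 * crd i x))) => //.
  by move=> y Ay; rewrite (partial_radial sq_pos k'E).
apply: (C1M oA); first exact: (C1_radial sq_pos k1'E ck2).
by apply: (C1Z _ oA); exact: C1_crd.
Qed.

Lemma lap0_radial x : A x -> lap0 (fun x => k (sq x)) x =
  4 * sq x * k1 (sq x) + 4 * sq x ^+ 2 * k2 (sq x).
Proof.
move=> Ax; rewrite /lap0 (eul_radial sq_pos k'E)//.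
have h1 := C1_radial sq_pos k1'E ck2.
have -> : laplacian (fun x => k (sq x)) x =
    2 * n%:R * k1 (sq x) + 4 * k2 (sq x) * sq x.
  rewrite /laplacian.
  have -> : 2 * n%:R * k1 (sq x) + 4 * k2 (sq x) * sq x =
     \sum_(i < n) (2 * k1 (sq x) + 4 * k2 (sq x) * crd i x ^+ 2).
    rewrite big_split /= sumr_const card_ord -mulr_sumr -/(sq x).
    by congr (_ + _); rewrite -mulr_natl; ring.
  apply: eq_bigr => i _.
  have hc : C1 A (fun x => 2 * crd i x) by apply: (C1Z _ oA); exact: C1_crd.
  have E y : A y -> k1 (sq y) * (2 * crd i y) = partial i (fun x => k (sq x)) y.
    by move=> Ay; rewrite (partial_radial sq_pos k'E).
  rewrite (eq_partial i oA E Ax (C1M oA h1 hc)).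
  rewrite (partialM i h1 hc Ax) (partialZ _ _ (C1_crd i oA) Ax) partial_crd eqxx.
  rewrite (partial_radial sq_pos k1'E)// -/(crd i x) mulr1n.
  move: (k1 _) (k2 _) (crd i x) => u v w.
  by ring.
by ring.
Qed.

End RadialFun2.
End Rules.
End Radial.

(** * Integration by parts for the cylindrical measure *)

Section Power.
Context (R : realType).

Lemma is_derive_expRln (c s : R) : 0 < s ->
  is_derive s (1 : R) (fun t => expR (c * ln t)) (c / s * expR (c * ln s)).
Proof.
move=> s0.
have h := @is_derive1_ln R s s0.
have h2 : is_derive s (1 : R) (fun t : R => c * ln t) (c / s).
  exact: (@is_deriveZ _ _ _ (@ln R) c s 1 s^-1 h).
have h3 := @is_derive_expR R (c * ln s).
by apply: is_derive_eq (@is_derive_comp1 _ _ expR (fun t : R => c * ln t) s 1 _ _ h3 h2) _;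
  rewrite mulrC.
Qed.

Lemma cont_inv (s : R) : 0 < s -> {for s, continuous (fun t : R => t^-1)}.
Proof. by move=> s0; apply: cvgV => //; rewrite gt_eqF. Qed.

Lemma is_derive_cont (k : R -> R) s d : is_derive s (1 : R) k d -> {for s, continuous k}.
Proof.
by move=> [h _]; apply: differentiable_continuous; apply/derivable1_diffP.
Qed.

Lemma cont_dexpRln (c s : R) : 0 < s ->
  {for s, continuous (fun t : R => c / t * expR (c * ln t))}.
Proof.
move=> s0; apply: (@continuousM _ _ (fun t : R => c / t) (fun t : R => expR (c * ln t))).
  apply: (@continuousM _ _ (fun t : R => c) (fun t : R => t^-1)); first exact: cst_continuous.
  exact: cont_inv.
exact: is_derive_cont (is_derive_expRln c s0).
Qed.

End Power.

Section Weighted.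
Context (R : realType) (n : nat) (p : 'rV[R]_n).
Variables (A K : set 'rV[R]_n).
Hypotheses (oA : open A) (cK : closed K) (KA : K `<=` A).
Hypothesis sq_pos : forall x, A x -> 0 < sq p x.
Hypothesis bK : exists B : R, forall x, K x -> forall i, `|x ord0 i| <= B.
Implicit Types (F G f g w : 'rV[R]_n -> R) (x : 'rV[R]_n).

Notation mu := (lebesgue_rV R n).
Notation sq := (sq p). Notation eul := (eul p). Notation gam := (gam p).
Notation lap0 := (lap0 p). Notation crd := (crd p).

(** [|x - p|^(-n)], the density of the cylinder measure [dtau dtheta]. *)
Definition wt x : R := expR (- (n%:R / 2) * ln (sq x)).

Lemma wt_ge0 x : 0 <= wt x. Proof. exact: expR_ge0. Qed.

(** [K] is meant to be a closed annulus around [p] and [A] a punctured domain; outside [K] the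
    functions are 0, so that products with functions controlled only on [A],
    such as the weight, are continuous and integrable on the whole space. *)
Definition CK F := (forall x, A x -> {for x, continuous F}) /\
  (forall x, ~ K x -> F x = 0).

Definition cyl_int F : R := \int[mu]_x (wt x * F x).

Lemma C1_pow c : C1 A (fun x => expR (c * ln (sq x))).
Proof.
apply: (C1_radial oA (k := fun s => expR (c * ln s)) sq_pos).
  by move=> s s0; exact: is_derive_expRln.
by move=> s s0; exact: cont_dexpRln.
Qed.

Lemma partial_pow c i x : A x -> partial i (fun x => expR (c * ln (sq x))) x =
  c / sq x * expR (c * ln (sq x)) * (2 * crd i x).
Proof.
by move=> Ax; rewrite (partial_radial oA (k := fun s => expR (c * ln s)) sq_pos
  (fun s s0 => is_derive_expRln c s0)).
Qed.

Lemma C1_wt : C1 A wt. Proof. exact: C1_pow. Qed.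

Lemma CK_cont F : CK F -> continuous F.
Proof.
move=> [cF F0] x; have [Kx|Kx] := pselect (K x); first by apply: cF; exact: KA.
by apply: (C1_cont (C1_off cK F0)).
Qed.

Lemma CK_bsupp F : CK F -> bsupp F.
Proof.
move=> [cF F0]; have [B hB] := bK; exists B => x /eqP Fx.
by apply: hB; apply: contrapT => /F0.
Qed.

Lemma CKM f F : (forall x, A x -> {for x, continuous f}) -> CK F ->
  CK (fun x => f x * F x).
Proof.
move=> cf [cF F0]; split=> x; first by move=> Ax; apply: contM; [exact: cf|exact: cF].
by move=> /F0 ->; rewrite mulr0.
Qed.

Lemma CKMr f F : (forall x, A x -> {for x, continuous f}) -> CK F ->
  CK (fun x => F x * f x).
Proof.
move=> cf [cF F0]; split=> x; first by move=> Ax; apply: contM; [exact: cF|exact: cf].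
by move=> /F0 ->; rewrite mul0r.
Qed.

Lemma CKD F G : CK F -> CK G -> CK (fun x => F x + G x).
Proof.
move=> [cF F0] [cG G0]; split=> x; first by move=> Ax; apply: contD; [exact: cF|exact: cG].
by move=> Kx; rewrite F0// G0// addr0.
Qed.

Lemma CKZ c F : CK F -> CK (fun x => c * F x).
Proof. by apply: CKM => x _; exact: cont_cst. Qed.

Lemma CKN F : CK F -> CK (fun x => - F x).
Proof.
move=> [cF F0]; split=> x; first by move=> Ax; apply: contN; exact: cF.
by move=> Kx; rewrite F0// oppr0.
Qed.

Lemma CK_wt F : CK F -> CK (fun x => wt x * F x).
Proof. by apply: CKM => x Ax; exact: C1_cont C1_wt Ax. Qed.

Lemma CK_integrable F : CK F -> mu.-integrable setT (EFin \o F).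
Proof. by move=> h; apply: Cc_integrable; [exact: CK_cont|exact: CK_bsupp]. Qed.

Lemma cyl_intD F G : CK F -> CK G -> cyl_int (fun x => F x + G x) = cyl_int F + cyl_int G.
Proof.
move=> hF hG; rewrite /cyl_int -RintegralD//.
- by apply: eq_Rintegral => x _; rewrite mulrDr.
- exact: CK_integrable (CK_wt hF).
- exact: CK_integrable (CK_wt hG).
Qed.

Lemma cyl_intZ c F : CK F -> cyl_int (fun x => c * F x) = c * cyl_int F.
Proof.
move=> hF; rewrite /cyl_int -RintegralZl//; first by apply: eq_Rintegral => x _; rewrite mulrCA.
exact: CK_integrable (CK_wt hF).
Qed.

Lemma cyl_int_le F G : CK F -> CK G -> (forall x, K x -> F x <= G x) -> cyl_int F <= cyl_int G.
Proof.
move=> hF hG FG; apply: le_Rintegral => //.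
- exact: CK_integrable (CK_wt hF).
- exact: CK_integrable (CK_wt hG).
- move=> x _; apply: ler_wpM2l; first exact: wt_ge0.
  have [Kx|Kx] := pselect (K x); first exact: FG.
  by rewrite hF.2// hG.2.
Qed.

Lemma C1_global F : C1 A F -> (forall x, ~ K x -> F x = 0) -> C1 setT F.
Proof.
move=> h F0 x _; have [Kx|Kx] := pselect (K x); first exact: h x (KA Kx).
exact: C1_off cK F0 x Kx.
Qed.

Lemma Rintegral_div (X : 'I_n -> 'rV[R]_n -> R) :
  (forall i, C1 A (X i)) -> (forall i x, ~ K x -> X i x = 0) ->
  \int[mu]_x (\sum_i partial i (X i) x) = 0.
Proof.
move=> hX X0.
have hp i : CK (partial i (X i)).
  split=> x; first by move=> Ax; exact: C1_pcont (hX i) Ax.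
  by move=> Kx; rewrite (partial_off i cK (X0 i)).
have E : forall r : seq 'I_n, \int[mu]_x (\sum_(i <- r) partial i (X i) x) = 0 /\
    CK (fun x => \sum_(i <- r) partial i (X i) x).
  elim=> [|i r [IH1 IH2]].
    split; last first.
      rewrite (_ : (fun x => _) = (fun=> 0)); last by apply/funext => x; rewrite big_nil.
      by split=> // x _; exact: cont_cst.
    by under eq_Rintegral do rewrite big_nil; rewrite /Rintegral integral0.
  have -> : (fun x => \sum_(j <- i :: r) partial j (X j) x) =
            (fun x => partial i (X i) x + \sum_(j <- r) partial j (X j) x).
    by apply/funext => x; rewrite big_cons.
  split; last exact: CKD.
  rewrite RintegralD//; [|exact: CK_integrable|exact: CK_integrable].
  rewrite IH1 addr0 /Rintegral integral_partial//; first exact: (C1_global (hX i) (X0 i)).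
  by apply: CK_bsupp; split=> x; [move=> Ax; exact: C1_cont (hX i) Ax|exact: X0].
by have [] := E (index_enum 'I_n).
Qed.

(** The divergence of [|x - p|^(-n) (x - p)] vanishes, so [wt * eul F] is the
    divergence of [wt F (x - p)]. *)
Lemma cyl_int_eul F : C1 A F -> (forall x, ~ K x -> F x = 0) -> cyl_int (eul F) = 0.
Proof.
move=> hF F0; rewrite -[RHS](Rintegral_div (X := fun i x => wt x * (crd i x * F x))).
- apply: eq_Rintegral => x _.
  have [Kx|Kx] := pselect (K x); last first.
    rewrite /eul big1 ?mulr0 => [|i _]; last by rewrite (partial_off i cK F0 Kx) mulr0.
    rewrite big1// => i _; apply: (partial_off i cK _ Kx).
    by move=> y /F0 ->; rewrite !mulr0.
  have Ax := KA Kx; have sx := sq_pos Ax.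
  have E i : partial i (fun x => wt x * (crd i x * F x)) x =
     wt x * (crd i x * partial i F x) + (wt x * F x - n%:R / sq x * (wt x * F x) * crd i x ^+ 2).
    have h1 := C1M oA (C1_crd p i oA) hF.
    rewrite (partialM i C1_wt h1 Ax) (partialM i (C1_crd p i oA) hF Ax).
    rewrite partial_crd eqxx mulr1n /wt (partial_pow _ _ Ax).
    move: (expR _) (partial i F x) (F x) (crd i x) => a b c d.
    by field; rewrite gt_eqF.
  rewrite (eq_bigr _ (fun i _ => E i)) big_split /= -mulr_sumr -/(eul F x).
  rewrite sumrB sumr_const card_ord -mulr_sumr -/(sq x).
  move: (wt x) (F x) (eul F x) => a b c; rewrite -mulr_natl.
  by field; rewrite gt_eqF.
- by move=> i; apply: (C1M oA C1_wt); apply: (C1M oA) => //; exact: C1_crd.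
- by move=> i x /F0 ->; rewrite !mulr0.
Qed.

(** [wt * (g * lap0 w + gam w g)] is the divergence of
    [|x - p|^(2-n) g grad w]. *)
Lemma cyl_int_lap0 w g : C2 A w -> C1 A g -> (forall x, ~ K x -> g x = 0) ->
  cyl_int (fun x => g x * lap0 w x + gam w g x) = 0.
Proof.
move=> hw hg g0.
have hw1 := C2_C1 hw.
(* m = |x - p|^(2 - n), the density wt of the cylinder measure times sq. *)
pose m x := expR ((1 - n%:R / 2) * ln (sq x)).
have hm : C1 A m by exact: C1_pow.
have mE x : 0 < sq x -> m x = sq x * wt x.
  move=> sx; rewrite /m /wt mulrDl mul1r expRD lnK ?posrE//.
rewrite -[RHS](Rintegral_div (X := fun i x => m x * (g x * partial i w x))).
- apply: eq_Rintegral => x _.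
  have [Kx|Kx] := pselect (K x); last first.
    rewrite g0// mul0r add0r /gam big1 ?mulr0 => [|i _]; last first.
      by rewrite (partial_off i cK g0 Kx) mulr0.
    rewrite big1// => i _; apply: (partial_off i cK _ Kx).
    by move=> y /g0 ->; rewrite mul0r mulr0.
  have Ax := KA Kx; have sx := sq_pos Ax.
  have E i : partial i (fun x => m x * (g x * partial i w x)) x =
     (2 - n%:R) * wt x * g x * (crd i x * partial i w x) +
     sq x * wt x * g x * partial i (partial i w) x +
     sq x * wt x * (partial i w x * partial i g x).
    have hwi := C2_C1_partial i hw.
    have h1 := C1M oA hg hwi.
    rewrite (partialM i hm h1 Ax) (partialM i hg hwi Ax).
    rewrite /m (partial_pow _ _ Ax) -/(m x) (mE x sx).
    move: (wt x) (partial i (partial i w) x) (partial i w x) (partial i g x) (g x) (crd i x).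
    by move=> a b c d e f; field; rewrite gt_eqF.
  rewrite (eq_bigr _ (fun i _ => E i)) !big_split /= -!mulr_sumr -/(eul w x).
  rewrite /lap0 /gam -/(laplacian w x).
  move: (wt x) (eul w x) (laplacian w x) (\sum_i _) => a b c d.
  by ring.
- move=> i; apply: (C1M oA hm); apply: (C1M oA hg); exact: C2_C1_partial.
- by move=> i x /g0 ->; rewrite mul0r mulr0.
Qed.

End Weighted.

(** * Carleman inequality *)

Section Pointwise.
Context (R : realType).
Implicit Types (t s m a b d D : R).

Lemma young_cross (t k c b d D : R) : 0 < t * k -> 0 < c -> d ^+ 2 <= c ^+ 2 * D ->
  2 * `|b * d| <= t * k * D + c ^+ 2 / (t * k) * b ^+ 2.
Proof.
move=> tk c0 dD.
have D0 : 0 <= D.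
  by have := le_trans (sqr_ge0 d) dD; rewrite pmulr_rge0// exprn_gt0.
have h : 0 <= (t * k * `|d| / c - c * `|b|) ^+ 2 by exact: sqr_ge0.
have e : (t * k * `|d| / c - c * `|b|) ^+ 2 =
   (t * k) ^+ 2 * (d ^+ 2 / c ^+ 2) - 2 * (t * k) * `|b * d| + c ^+ 2 * b ^+ 2.
  rewrite -(real_normK (num_real d)) -(real_normK (num_real b)) normrM.
  by field; rewrite gt_eqF.
have dD' : d ^+ 2 / c ^+ 2 <= D by rewrite ler_pdivrMr ?exprn_gt0// mulrC.
have h2 : (t * k) ^+ 2 * (d ^+ 2 / c ^+ 2) <= (t * k) ^+ 2 * D.
  by rewrite ler_wpM2l ?sqr_ge0.
have h3 : t * k * (2 * `|b * d|) <= t * k * (t * k * D + c ^+ 2 / (t * k) * b ^+ 2).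
  have -> : t * k * (t * k * D + c ^+ 2 / (t * k) * b ^+ 2) =
     (t * k) ^+ 2 * D + c ^+ 2 * b ^+ 2.
    by field; apply/andP; split; apply: contraTneq tk => ->; rewrite ?mul0r ?mulr0 ltxx.
  by move: h; rewrite e; lra.
by rewrite ler_pM2l in h3.
Qed.

(** What remains of the Carleman inequality after the integrations by parts.
    Here [k = s/100] is the convexity of the weight.  The commutator contributes
    [4 t^3 z^2 k N], of which the gradient term [t k D] costs
    [t^3 z^2 k N]; the remaining 3 times [z^2 >= 0.35] exceeds 1, and each of the
    errors (from [Vr], from [e], from [da] and [db], from the lower order terms)
    is a fraction of [t^3 k N], and together they cost less than one half of it.  The
    gradient term is there only to absorb [da] and [db], which carry derivatives
    of [a] and [b] multiplied by the imaginary part of the potential. *)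
Lemma carleman_pointwise (t s m a b Sa Sb Aa Ab Ea Eb Da Db e da db Vr c0 : R) :
  20 <= t -> 0 < s -> s <= 81 -> m = t ^+ 2 / 100 / 100 -> 0 <= c0 ->
  `|Vr| <= m -> `|e| <= 11 * s * m ->
  da ^+ 2 <= (11 * s * m) ^+ 2 * Da -> db ^+ 2 <= (11 * s * m) ^+ 2 * Db ->
  t ^+ 3 / 200 * (s * (a ^+ 2 + b ^+ 2)) <=
  Sa ^+ 2 + Sb ^+ 2 + Aa ^+ 2 + Ab ^+ 2 + 4 * t * (s / 100) * (Ea ^+ 2 + Eb ^+ 2)
  + t * (s / 100) * (Da + Db) - 6 * t * (s / 100) * (a ^+ 2 + b ^+ 2)
  + 4 * t ^+ 3 * (1 - s / 200) ^+ 2 * (s / 100) * (a ^+ 2 + b ^+ 2)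
  + 2 * t * (1 - s / 200) * e * (a ^+ 2 + b ^+ 2)
  + t * (s / 100) * (a * Sa + b * Sb
      - (t ^+ 2 * (1 - s / 200) ^+ 2 - c0 - s * Vr) * (a ^+ 2 + b ^+ 2))
  - 2 * (b * da - a * db).
Proof.
move=> t20 s0 s81 mE c00 hV he hda hdb.
have t0 : 0 < t by lra.
have m0 : 0 < m by rewrite mE !divr_gt0// exprn_gt0.
set k := s / 100; set z := 1 - s / 200; set N := a ^+ 2 + b ^+ 2.
have k0 : 0 < k by rewrite /k; lra.
have k1 : k <= 1 by rewrite /k; lra.
have N0 : 0 <= N by rewrite addr_ge0 ?sqr_ge0.
have tk : 0 < t * k by rewrite mulr_gt0.
have c0' : 0 < 11 * s * m by rewrite !mulr_gt0.
have sE : s = 100 * k by rewrite /k; field.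
have cE : (11 * s * m) ^+ 2 / (t * k) = 121 / 100 / 100 * (t ^+ 3 * k).
  rewrite mE sE; field; rewrite ?gt_eqF//.
have := young_cross b tk c0' hda; have := young_cross a tk c0' hdb.
rewrite cE => Yb Ya.
have hb : b * da <= `|b * da| by exact: ler_norm.
have ha : - (a * db) <= `|a * db| by rewrite -normrN ler_norm.
have Y : 2 * (b * da - a * db) <= t * k * (Da + Db) + 121 / 100 / 100 * (t ^+ 3 * k) * N.
  by rewrite /N; lra.
(* Completing the square in S; the loss is of order t^2 k only. *)
have HS x S : - (t ^+ 2 * k / 4) * x ^+ 2 <= S ^+ 2 + t * k * (x * S).
  have h1 : 0 <= (S + t * k * x / 2) ^+ 2 by exact: sqr_ge0.
  have h2 : t ^+ 2 * k * x ^+ 2 * k <= t ^+ 2 * k * x ^+ 2 * 1.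
    apply: ler_wpM2l => //; apply: mulr_ge0; last exact: sqr_ge0.
    by apply: mulr_ge0; [exact: sqr_ge0|exact: ltW].
  have h3 : (S + t * k * x / 2) ^+ 2 =
     S ^+ 2 + t * k * (x * S) + t ^+ 2 * k * x ^+ 2 * k / 4 by field.
  by clear - h1 h2 h3; lra.
have Ha := HS a Sa; have Hb := HS b Sb.
have E0 : 0 <= 4 * t * k * (Ea ^+ 2 + Eb ^+ 2).
  by rewrite mulr_ge0 ?addr_ge0 ?sqr_ge0// -mulrA mulr_ge0// ltW.
have A0 : 0 <= Aa ^+ 2 + Ab ^+ 2 by rewrite addr_ge0 ?sqr_ge0.
have kN : 0 <= k * N by rewrite mulr_ge0// ltW.
have T3 : 0 <= t ^+ 3 * (k * N) by rewrite mulr_ge0// exprn_ge0// ltW.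
have z0 : 119 / 200 <= z by rewrite /z; lra.
have z1 : z <= 1 by rewrite /z; lra.
have z2 : 35 / 100 <= z ^+ 2.
  have h : (119 / 200) ^+ 2 <= z ^+ 2 by clear - z0; rewrite lerXn2r ?nnegrE//; lra.
  by clear - h; lra.
have He : - (22 / 100 * (t ^+ 3 * (k * N))) <= 2 * t * z * e * N.
  have h : `|z * e| <= 11 * s * m.
    rewrite normrM ger0_norm; last by lra.
    by rewrite -[leRHS]mul1r; apply: ler_pM => //; lra.
  have /lerNnormlW h2 := h.
  have tN : 0 <= 2 * t * N by rewrite !mulr_ge0// ltW.
  have h3 : 2 * t * N * - (11 * s * m) <= 2 * t * N * (z * e) by rewrite ler_wpM2l.
  apply: le_trans (_ : 2 * t * N * - (11 * s * m) <= _).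
    by rewrite mE sE le_eqVlt; apply/orP; left; apply/eqP; field.
  by rewrite [leRHS](_ : _ = 2 * t * N * (z * e)) //; ring.
have HV : - (81 / 100 / 100 * (t ^+ 3 * (k * N))) <= t * k * (s * Vr) * N.
  have h : - (81 * m) <= s * Vr.
    have h : `|s * Vr| <= 81 * m.
      by rewrite normrM (gtr0_norm s0); apply: ler_pM => //; exact: ltW.
    by exact: lerNnormlW h.
  have tN : 0 <= t * (k * N) by rewrite mulr_ge0// ltW.
  have h3 : t * (k * N) * - (81 * m) <= t * (k * N) * (s * Vr) by rewrite ler_wpM2l.
  apply: le_trans (_ : t * (k * N) * - (81 * m) <= _).
    by rewrite mE le_eqVlt; apply/orP; left; apply/eqP; field.
  by rewrite [leRHS](_ : _ = t * (k * N) * (s * Vr)) //; ring.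
have H1 : t ^+ 2 * (k * N) * 20 <= t ^+ 3 * (k * N).
  rewrite -subr_ge0 (_ : _ - _ = (t - 20) * (t ^+ 2 * (k * N))); last by ring.
  by apply: mulr_ge0; [rewrite subr_ge0|apply: mulr_ge0 => //; exact: sqr_ge0].
have H2 : t * (k * N) * 400 <= t ^+ 3 * (k * N).
  have h : t * (k * N) * 20 <= t ^+ 2 * (k * N).
    rewrite -subr_ge0 (_ : _ - _ = (t - 20) * (t * (k * N))); last by ring.
    by apply: mulr_ge0; [rewrite subr_ge0|rewrite mulr_ge0// ltW].
  by clear - H1 h; lra.
have Hz : 105 / 100 * (t ^+ 3 * (k * N)) <= 3 * (t ^+ 3 * (k * N)) * z ^+ 2.
  have : t ^+ 3 * (k * N) * (35 / 100) <= t ^+ 3 * (k * N) * z ^+ 2 by rewrite ler_wpM2l.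
  by lra.
have Hc : 0 <= t * k * c0 * N by rewrite !mulr_ge0// ltW.
rewrite [leLHS](_ : _ = 1 / 2 * (t ^+ 3 * (k * N))); last by rewrite sE; field.
rewrite [leRHS](_ : _ = (Sa ^+ 2 + t * k * (a * Sa)) + (Sb ^+ 2 + t * k * (b * Sb))
   + (Aa ^+ 2 + Ab ^+ 2) + 4 * t * k * (Ea ^+ 2 + Eb ^+ 2)
   + (t * k * (Da + Db) - 2 * (b * da - a * db)) - 6 * (t * (k * N))
   + 3 * (t ^+ 3 * (k * N)) * z ^+ 2 + 2 * t * z * e * N + t * k * c0 * N
   + t * k * (s * Vr) * N); last by ring.
have HSS : - (t ^+ 2 * (k * N) / 4) <= (Sa ^+ 2 + t * k * (a * Sa)) + (Sb ^+ 2 + t * k * (b * Sb)).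
  have -> : - (t ^+ 2 * (k * N) / 4) = - (t ^+ 2 * k / 4) * a ^+ 2 + - (t ^+ 2 * k / 4) * b ^+ 2.
    by rewrite /N; field.
  by apply: lerD.
have Y' : - (121 / 100 / 100 * (t ^+ 3 * (k * N))) <= t * k * (Da + Db) - 2 * (b * da - a * db).
  by move: Y; lra.
move: HSS Y' HV He Hz H1 H2 Hc T3 E0 A0.
move: (t ^+ 3 * (k * N)) (t ^+ 2 * (k * N)) (t * (k * N)) => T T2 T1.
by lra.
Qed.

End Pointwise.

Section Carleman.
Context (R : realType) (n : nat) (p : 'rV[R]_n).
Variables (A K : set 'rV[R]_n).
Hypotheses (oA : open A) (cK : closed K) (KA : K `<=` A).
Hypothesis sq_pos : forall x, A x -> 0 < sq p x.
Hypothesis bK : exists B : R, forall x, K x -> forall i, `|x ord0 i| <= B.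
Hypothesis K81 : forall x, K x -> sq p x <= 81.
Implicit Types (F G f g w : 'rV[R]_n -> R) (x : 'rV[R]_n).

Notation sq := (sq p). Notation eul := (eul p). Notation gam := (gam p).
Notation lap0 := (lap0 p). Notation cyl_int := (cyl_int p). Notation CK := (CK A K).

Lemma eul_off f x : (forall x, ~ K x -> f x = 0) -> ~ K x -> eul f x = 0.
Proof.
by move=> f0 Kx; rewrite /eul big1// => i _; rewrite (partial_off i cK f0 Kx) mulr0.
Qed.

Lemma laplacian_off f x : (forall x, ~ K x -> f x = 0) -> ~ K x -> laplacian f x = 0.
Proof.
move=> f0 Kx; rewrite /laplacian big1// => i _; apply: (partial_off i cK _ Kx).
by move=> y Ky; exact: partial_off i cK f0 Ky.
Qed.

Lemma lap0_off f x : (forall x, ~ K x -> f x = 0) -> ~ K x -> lap0 f x = 0.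
Proof.
by move=> f0 Kx; rewrite /lap0 (laplacian_off f0 Kx) (eul_off f0 Kx) !mulr0 subr0.
Qed.

Lemma gam_off f g x : (forall x, ~ K x -> g x = 0) -> ~ K x -> gam f g x = 0.
Proof.
move=> g0 Kx; rewrite /gam big1 ?mulr0// => i _.
by rewrite (partial_off i cK g0 Kx) mulr0.
Qed.

Lemma CK_eul f : C1 A f -> (forall x, ~ K x -> f x = 0) -> CK (eul f).
Proof.
by move=> hf f0; split=> x; [move=> Ax; exact: cont_eul hf Ax|exact: eul_off].
Qed.

Lemma CK_lap0 f : C2 A f -> (forall x, ~ K x -> f x = 0) -> CK (lap0 f).
Proof.
by move=> hf f0; split=> x; [move=> Ax; exact: cont_lap0 hf Ax|exact: lap0_off].
Qed.

Lemma CK_gam f g : C1 A f -> C1 A g -> (forall x, ~ K x -> g x = 0) -> CK (gam f g).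
Proof.
move=> hf hg g0; split=> x; last exact: gam_off.
by move=> Ax; exact: cont_gam hf hg Ax.
Qed.

Lemma CK_C1 f : C1 A f -> (forall x, ~ K x -> f x = 0) -> CK f.
Proof. by move=> hf f0; split=> // x Ax; exact: C1_cont hf Ax. Qed.

Variables (t : R) (a b Vr Vi : 'rV[R]_n -> R).
Hypothesis t20 : 20 <= t.
Hypotheses (ha : C2 A a) (hb : C2 A b).
Hypotheses (a0 : forall x, ~ K x -> a x = 0) (b0 : forall x, ~ K x -> b x = 0).
Hypotheses (hVr : C1 A Vr) (hVi : C1 A Vi).
Let m := t ^+ 2 / 100 / 100.
Hypotheses (Vrm : forall x, K x -> `|Vr x| <= m) (Vim : forall x, K x -> `|Vi x| <= m).
Hypotheses (gVr : forall x, K x -> gam Vr Vr x <= (9 * m) ^+ 2).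
Hypotheses (gVi : forall x, K x -> gam Vi Vi x <= (9 * m) ^+ 2).

Let c0 := ((n%:R - 2) / 2 : R) ^+ 2.

(** The exponent of the weight is [- t (tau - r^2/400)] with [r = exp tau];
    [zeta] is the derivative in [tau] of the bracket, and
    [- eul zeta = sq / 100 > 0] is the convexity that makes the commutator
    positive. *)
Definition zeta x : R := 1 + - (1 / 200) * sq x.

(** The operator [|x - p|^2 Laplacian] conjugated by the weight, as
    [conj_op_gk] confirms.  The first-order term [(n - 2) eul] of the Laplacian is
    removed by the factor [|x - p|^((n-2)/2)] contained in the weight, at the
    price of the constant [c0]. *)
Definition conj_op a' x : R :=
  lap0 a' x + 2 * t * zeta x * eul a' x - t * (sq x / 100) * a' x
  + (t ^+ 2 * zeta x ^+ 2 - c0) * a' x.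

Let Pa x := conj_op a x - sq x * (Vr x * a x - Vi x * b x).
Let Pb x := conj_op b x - sq x * (Vr x * b x + Vi x * a x).

Let hs : C1 A sq. Proof. exact: C1_sq. Qed.
Let ha1 : C1 A a. Proof. exact: C2_C1. Qed.
Let hb1 : C1 A b. Proof. exact: C2_C1. Qed.
Let hcst (c : R) : C1 A (fun=> c) := @C1_cst _ _ A c.
Let hz : C1 A zeta.
Proof. exact: (C1D oA (hcst 1) (C1Z (- (1 / 200)) oA hs)). Qed.

Let eul_cst c x : eul (fun=> c) x = 0.
Proof. by rewrite /eul big1// => i _; rewrite partial_cst mulr0. Qed.

Let Ez x : A x -> eul zeta x = - (sq x / 100).
Proof.
move=> Ax; rewrite (eulD p (hcst 1) (C1Z (- (1 / 200)) oA hs) Ax).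
rewrite (eulZ _ _ hs Ax) eul_sq eul_cst.
by move: (sq x) => s; field.
Qed.

Let hmul f g (hf : C1 A f) (hg : C1 A g) : C1 A (fun x => f x * g x) := C1M oA hf hg.
Let hscl c f (hf : C1 A f) : C1 A (fun x => c * f x) := C1Z c oA hf.
Let hadd f g (hf : C1 A f) (hg : C1 A g) : C1 A (fun x => f x + g x) := C1D oA hf hg.

(* Twice the antisymmetric part 2 t zeta eul f - t kappa f + sq Vi g, with
   kappa = sq / 100 (c = 2 for f = a and c = -2 for f = b), minus t kappa f.
   Testing lap0 f with this last term produces t kappa (gam f f). *)
Let mult f g c x : R := 4 * t * eul f x + (- (t / 50) * (sq x * eul f x) +
  (- (3 * t / 100) * (sq x * f x) + c * (sq x * (Vi x * g x)))).

Let C1_mult f g c : C2 A f -> C1 A g -> C1 A (mult f g c).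
Proof.
move=> hf hg; have hE := C1_eul p oA hf; have hf1 := C2_C1 hf.
exact: (hadd (hscl _ hE) (hadd (hscl _ (hmul hs hE)) (hadd (hscl _ (hmul hs hf1))
  (hscl _ (hmul hs (hmul hVi hg)))))).
Qed.

Let gam_mult f g c x : C2 A f -> C1 A g -> A x ->
  gam f (mult f g c) x = 4 * t * gam f (eul f) x
   - t / 50 * (sq x * gam f (eul f) x + 2 * sq x * eul f x * eul f x)
   - 3 * t / 100 * (sq x * gam f f x + 2 * sq x * eul f x * f x)
   + c * (2 * sq x * eul f x * (Vi x * g x) +
          sq x * (Vi x * gam f g x + g x * gam f Vi x)).
Proof.
move=> hf hg Ax; have hE := C1_eul p oA hf; have hf1 := C2_C1 hf.
have h1 := hscl (4 * t) hE.
have h2 := hmul hs hE. have h2' := hscl (- (t / 50)) h2.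
have h3 := hmul hs hf1. have h3' := hscl (- (3 * t / 100)) h3.
have hVg := hmul hVi hg.
have h4 := hmul hs hVg. have h4' := hscl c h4.
rewrite (gamDr p f h1 (hadd h2' (hadd h3' h4')) Ax).
rewrite (gamDr p f h2' (hadd h3' h4') Ax) (gamDr p f h3' h4' Ax).
rewrite (gamZr _ _ f hE Ax) (gamZr _ _ f h2 Ax) (gamZr _ _ f h3 Ax) (gamZr _ _ f h4 Ax).
rewrite (gamMr p f hs hE Ax) (gamMr p f hs hf1 Ax) (gamMr p f hs hVg Ax).
rewrite (gamMr p f hVi hg Ax) !gam_sq.
move: (gam f (eul f) x) (gam f f x) (gam f Vi x) (gam f g x) (eul f x) (Vi x) (g x) (f x).
by move=> x1 x2 x3 x4 x5 x6 x7 x8; ring.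
Qed.

(* The zeroth-order coefficient of the symmetric part. *)
Let W x : R := t ^+ 2 * (zeta x * zeta x) + (- c0 + - 1 * (sq x * Vr x)).
Let hW : C1 A W.
Proof.
exact: (hadd (hscl _ (hmul hz hz)) (hadd (hcst (- c0)) (hscl _ (hmul hs hVr)))).
Qed.

Let EW x : A x -> eul W x = t ^+ 2 * (- (sq x / 50) * zeta x)
   - (2 * sq x * Vr x + sq x * eul Vr x).
Proof.
move=> Ax.
have h1 := hmul hz hz. have h2 := hmul hs hVr. have h2' := hscl (-1) h2.
have hc := hcst (- c0).
rewrite (eulD p (hscl _ h1) (hadd hc h2') Ax) (eulD p hc h2' Ax).
rewrite (eulZ p _ h1 Ax) (eulZ p _ h2 Ax) (eulM p hz hz Ax) (eulM p hs hVr Ax).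
rewrite eul_cst eul_sq (Ez Ax).
by move: (zeta x) (Vr x) (eul Vr x) (sq x) => x1 x2 x3 x4; field.
Qed.

(* The quantity whose derivative in tau collects the terms 4 t zeta eul f
   (W f) and 4 t zeta gam f (eul f); the last summand handles the product
   f * eul f left by the other terms of mult. *)
Let flux f x : R := - (2 * t) * (zeta x * gam f f x)
   + (2 * t * (zeta x * (W x * (f x * f x))) + 3 * t / 100 * (sq x * (f x * f x))).

Let C1_flux f : C2 A f -> C1 A (flux f).
Proof.
move=> hf; have hf1 := C2_C1 hf; have hff := hmul hf1 hf1.
have hg := C1_gam p oA hf hf.
exact: (hadd (hscl _ (hmul hz hg)) (hadd (hscl _ (hmul hz (hmul hW hff)))
  (hscl _ (hmul hs hff)))).
Qed.

Let eul_flux f x : C2 A f -> A x -> eul (flux f) x =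
   - (2 * t) * (- (sq x / 100) * gam f f x + zeta x * (2 * gam f (eul f) x))
   + 2 * t * (- (sq x / 100) * (W x * (f x * f x)) +
       zeta x * ((t ^+ 2 * (- (sq x / 50) * zeta x)
         - (2 * sq x * Vr x + sq x * eul Vr x)) * (f x * f x)
         + W x * (2 * (f x * eul f x))))
   + 3 * t / 100 * (2 * sq x * (f x * f x) + sq x * (2 * (f x * eul f x))).
Proof.
move=> hf Ax; have hf1 := C2_C1 hf; have hff := hmul hf1 hf1.
have hg := C1_gam p oA hf hf.
have hWf := hmul hW hff.
have h1 := hmul hz hg. have h1' := hscl (- (2 * t)) h1.
have h2 := hmul hz hWf. have h2' := hscl (2 * t) h2.
have h3 := hmul hs hff. have h3' := hscl (3 * t / 100) h3.
rewrite (eulD p h1' (hadd h2' h3') Ax) (eulD p h2' h3' Ax).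
rewrite (eulZ p _ h1 Ax) (eulZ p _ h2 Ax) (eulZ p _ h3 Ax).
rewrite (eulM p hz hg Ax) (eulM p hz hWf Ax) (eulM p hs hff Ax) (eulM p hW hff Ax).
rewrite (eulM p hf1 hf1 Ax) (eul_gam p oA hf Ax) eul_sq (Ez Ax) (EW Ax).
move: (gam f (eul f) x) (gam f f x) (eul f x) (f x) (Vr x) (eul Vr x) (W x) (zeta x).
by move=> x1 x2 x3 x4 x5 x6 x7 x8; ring.
Qed.

Let cross f g c x : R := mult f g c x * lap0 f x + gam f (mult f g c) x.

Let I_cross f g c : C2 A f -> C1 A g -> (forall x, ~ K x -> f x = 0) ->
  (forall x, ~ K x -> g x = 0) -> CK (cross f g c) /\ cyl_int (cross f g c) = 0.
Proof.
move=> hf hg f0 g0.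
have m0 x : ~ K x -> mult f g c x = 0.
  by move=> Kx; rewrite /mult (eul_off f0 Kx) f0// g0// !mulr0 !addr0.
have hm := C1_mult c hf hg.
split; last exact: (cyl_int_lap0 oA cK KA sq_pos bK hf hm m0).
apply: CKD; last exact: CK_gam (C2_C1 hf) hm m0.
by apply: CKM; [move=> x Ax; exact: C1_cont hm Ax|exact: CK_lap0].
Qed.

Let I_flux f : C2 A f -> (forall x, ~ K x -> f x = 0) ->
  CK (eul (flux f)) /\ cyl_int (eul (flux f)) = 0.
Proof.
move=> hf f0.
have fl0 x : ~ K x -> flux f x = 0.
  by move=> Kx; rewrite /flux (gam_off _ f0 Kx) f0// !mulr0 !addr0.
split; first exact: CK_eul (C1_flux hf) fl0.
exact: (cyl_int_eul oA cK KA sq_pos bK (C1_flux hf) fl0).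
Qed.

Lemma CK_conj_op f : C2 A f -> (forall x, ~ K x -> f x = 0) -> CK (conj_op f).
Proof.
move=> hf f0; have hf1 := C2_C1 hf.
apply: CKD; last first.
  apply: CKM; last exact: CK_C1.
  move=> x Ax; apply: contD; last exact: cont_cst.
  apply: contM; first exact: cont_cst.
  exact: C1_cont (hmul hz hz) Ax.
apply: CKD; last first.
  apply: CKN; apply: CKM; last exact: CK_C1.
  move=> x Ax; apply: contM; first exact: cont_cst.
  by apply: contM; [exact: C1_cont hs Ax|exact: cont_cst].
apply: CKD; first exact: CK_lap0.
apply: CKM; last exact: CK_eul.
by move=> x Ax; apply: contM; [exact: cont_cst|exact: C1_cont hz Ax].
Qed.

Let CKa : CK a. Proof. exact: CK_C1. Qed.
Let CKb : CK b. Proof. exact: CK_C1. Qed.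
Let cVr x : A x -> {for x, continuous Vr}. Proof. exact: C1_cont. Qed.
Let cVi x : A x -> {for x, continuous Vi}. Proof. exact: C1_cont. Qed.
Let cs x : A x -> {for x, continuous sq}. Proof. exact: C1_cont. Qed.

Let CKPa : CK Pa.
Proof.
apply: CKD; first exact: CK_conj_op.
by apply: CKN; apply: CKM => //; apply: CKD; [exact: CKM|apply: CKN; exact: CKM].
Qed.

Let CKPb : CK Pb.
Proof.
apply: CKD; first exact: CK_conj_op.
by apply: CKN; apply: CKM => //; apply: CKD; exact: CKM.
Qed.

Lemma CK_sqr F : CK F -> CK (fun x => F x ^+ 2).
Proof. by move=> hF; apply: (CKM (f := F)) => //; case: hF. Qed.

(** The square of [S w + A w] is [|S w|^2 + |A w|^2] plus twice the product, and
    the product is rewritten by integration by parts: [cross] is a null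
    integral by the symmetry of [lap0], [eul (flux _)] by the invariance of the
    measure.  Adding these null terms turns the integrand into
    the form bounded below by [carleman_pointwise]. *)
Theorem carleman :
  t ^+ 3 / 200 * cyl_int (fun x => sq x * (a x ^+ 2 + b x ^+ 2)) <=
  cyl_int (fun x => (conj_op a x - sq x * (Vr x * a x - Vi x * b x)) ^+ 2 +
              (conj_op b x - sq x * (Vr x * b x + Vi x * a x)) ^+ 2).
Proof.
have [CKca Ica] := I_cross 2 ha hb1 a0 b0.
have [CKcb Icb] := I_cross (-2) hb ha1 b0 a0.
have [CKfa Ifa] := I_flux ha a0.
have [CKfb Ifb] := I_flux hb b0.
pose E x := (cross a b 2 x + cross b a (-2) x) + (eul (flux a) x + eul (flux b) x).
have CKE : CK E by apply: CKD; apply: CKD.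
have IE : cyl_int E = 0.
  have h1 := CKD CKca CKcb; have h2 := CKD CKfa CKfb.
  rewrite (cyl_intD oA cK KA sq_pos bK h1 h2).
  rewrite (cyl_intD oA cK KA sq_pos bK CKca CKcb) (cyl_intD oA cK KA sq_pos bK CKfa CKfb).
  by rewrite Ica Icb Ifa Ifb !addr0.
have CKP : CK (fun x => Pa x ^+ 2 + Pb x ^+ 2) by apply: CKD; exact: CK_sqr.
have CKN : CK (fun x => sq x * (a x ^+ 2 + b x ^+ 2)).
  by apply: CKM => //; apply: CKD; exact: CK_sqr.
rewrite -(cyl_intZ oA cK KA sq_pos bK _ CKN).
rewrite -[leLHS]addr0 -IE -(cyl_intD oA cK KA sq_pos bK (CKZ _ CKN) CKE).
apply: (cyl_int_le oA cK KA sq_pos bK) => //; first by apply: CKD => //; exact: CKZ.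
move=> x Kx; have Ax := KA Kx; have sx := sq_pos Ax.
rewrite -lerBrDr.
(* 11 = 2 + 9: the bounds on Vr and on its radial derivative. *)
have eVr : `|2 * sq x * Vr x + sq x * eul Vr x| <= 11 * sq x * m.
  have h : `|eul Vr x| <= 9 * m.
    rewrite -ler_sqr ?nnegrE ?normr_ge0//; last first.
      by rewrite mulr_ge0// (le_trans (normr_ge0 (Vr x)))// Vrm.
    by rewrite real_normK ?num_real// (le_trans (eul_le_gam _ _ _))// gVr.
  have hv := Vrm Kx.
  rewrite (_ : 2 * sq x * Vr x + sq x * eul Vr x = sq x * (2 * Vr x + eul Vr x)); last first.
    by move: (sq x) (Vr x) (eul Vr x) => u v w; ring.
  rewrite normrM (gtr0_norm sx) [11 * _]mulrC -mulrA ler_pM2l//.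
  apply: le_trans (ler_normD _ _) _; rewrite normrM ger0_norm//.
  apply: le_trans (lerD (ler_wpM2l (ler0n _ 2) hv) h) _.
  by rewrite -mulrDl -natrD.
have dVi f : C1 A f ->
    (2 * sq x * eul f x * Vi x + sq x * gam f Vi x) ^+ 2 <= (11 * sq x * m) ^+ 2 * gam f f x.
  move=> hf.
  have m0 : 0 <= m by rewrite (le_trans (normr_ge0 (Vr x)))// Vrm.
  have g0 := gam_ge0 p f x.
  pose q := Num.sqrt (gam f f x).
  have q0 : 0 <= q by exact: sqrtr_ge0.
  have qE : gam f f x = q ^+ 2 by rewrite sqr_sqrtr.
  have h1 : `|eul f x| <= q.
    by rewrite -ler_sqr ?nnegrE// real_normK ?num_real// -qE eul_le_gam.
  have h2 : `|gam f Vi x| <= 9 * m * q.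
    rewrite -ler_sqr ?nnegrE//; last by apply: mulr_ge0 => //; exact: mulr_ge0.
    rewrite real_normK ?num_real// (le_trans (gam_CS _ _ _ _))//.
    by rewrite qE [leRHS]exprMn mulrC; apply: ler_wpM2r; [exact: sqr_ge0|exact: gVi].
  have h3 := Vim Kx.
  have h4 : `|eul f x * Vi x| <= q * m by rewrite normrM; apply: ler_pM.
  rewrite qE -exprMn -(real_normK (num_real (_ + _))).
  have sm : 0 <= 11 * sq x * m * q.
    by apply: mulr_ge0 => //; apply: mulr_ge0 => //; apply: mulr_ge0 => //; exact: ltW.
  rewrite lerXn2r ?nnegrE ?normr_ge0//.
  rewrite (_ : 2 * sq x * eul f x * Vi x + sq x * gam f Vi x =
     sq x * (2 * (eul f x * Vi x) + gam f Vi x)); last first.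
    by move: (sq x) (Vi x) (eul f x) (gam f Vi x) => u v w u'; ring.
  rewrite normrM (gtr0_norm sx) [11 * _]mulrC -[sq x * 11 * m]mulrA -[sq x * _ * q]mulrA ler_pM2l//.
  apply: le_trans (ler_normD _ _) _; rewrite normrM ger0_norm//.
  apply: le_trans (lerD (ler_wpM2l (ler0n _ 2) h4) h2) _.
  have E11 (u v : R) : 2 * (v * u) + 9 * u * v = 11 * u * v by ring.
  by rewrite E11.
have c00 : 0 <= c0 by exact: sqr_ge0.
have := carleman_pointwise (a x) (b x) (lap0 a x + W x * a x) (lap0 b x + W x * b x)
  (2 * t * zeta x * eul a x - t * (sq x / 100) * a x + sq x * (Vi x * b x))
  (2 * t * zeta x * eul b x - t * (sq x / 100) * b x - sq x * (Vi x * a x))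
  (eul a x) (eul b x) t20 sx (K81 Kx) erefl c00 (Vrm Kx) eVr (dVi a ha1) (dVi b hb1).
move=> /le_trans; apply; rewrite le_eqVlt; apply/orP; left; apply/eqP.
rewrite /E /cross (gam_mult _ ha hb1 Ax) (gam_mult _ hb ha1 Ax).
rewrite (eul_flux ha Ax) (eul_flux hb Ax) /Pa /Pb /conj_op /mult /W /zeta.
rewrite (gamC p b a).
move: (gam a (eul a) x) (gam b (eul b) x) (gam a a x) (gam b b x) (gam a b x).
move: (gam a Vi x) (gam b Vi x) (eul a x) (eul b x) (eul Vr x) (lap0 a x) (lap0 b x).
move: (a x) (b x) (Vr x) (Vi x) (sq x) c0 => y1 y2 vr vi s c.
move=> x1 x2 x3 x4 x5 x6 x7 x8 x9 x10 x11 x12.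
by field.
Qed.

End Carleman.

(** * Conjugation by the singular weight *)

Section Exponent.
Context (R : realType) (c d : R).

(** A power times an exponential of the squared radius [s]. *)
Definition carl_weight (s : R) : R := expR (c * ln s + d * s).
Definition carl_weight1 (s : R) : R := (c / s + d) * carl_weight s.
Definition carl_weight2 (s : R) : R := ((c / s + d) ^+ 2 - c / s ^+ 2) * carl_weight s.

Lemma is_derive_lin (s e : R) : is_derive s (1 : R) (fun t : R => e * t) e.
Proof.
by apply: is_derive_eq (@is_deriveZ _ _ _ (@id R) e s 1 1 _) _; rewrite [LHS]mulr1.
Qed.

Lemma is_derive_carl_weight (s : R) : 0 < s -> is_derive s (1 : R) carl_weight (carl_weight1 s).
Proof.
move=> s0.
have h2 : is_derive s (1 : R) (fun t : R => c * ln t + d * t) (c / s + d).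
  apply: (@is_deriveD _ _ _ (fun t : R => c * ln t) (fun t : R => d * t)).
    exact: (@is_deriveZ _ _ _ (@ln R) c s 1 s^-1 (is_derive1_ln s0)).
  exact: is_derive_lin.
have h3 := @is_derive_expR R (c * ln s + d * s).
by apply: is_derive_eq (@is_derive_comp1 _ _ expR (fun t : R => c * ln t + d * t) s 1 _ _ h3 h2) _;
  rewrite mulrC.
Qed.

Lemma is_derive_inv (s : R) : 0 < s -> is_derive s (1 : R) (fun t : R => t^-1) (- (s ^+ 2)^-1).
Proof.
move=> s0; have sn : s != 0 by rewrite gt_eqF.
apply: DeriveDef; first exact: (@derivableV _ _ (@id R) s 1 sn (@derivable_id _ _ _ _)).
by rewrite (@deriveV _ _ (@id R) s 1 sn (@derivable_id _ _ _ _)) derive_id [LHS]mulr1.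
Qed.

Lemma is_derive_carl_weight1 (s : R) : 0 < s -> is_derive s (1 : R) carl_weight1 (carl_weight2 s).
Proof.
move=> s0.
have h1 : is_derive s (1 : R) (fun t : R => c / t + d) (- c / s ^+ 2).
  apply: is_derive_eq (@is_deriveD _ _ _ (fun t : R => c / t) (cst d) s 1 _ _
    (@is_deriveZ _ _ _ (fun t : R => t^-1) c s 1 _ (is_derive_inv s0)) _) _.
  by rewrite addr0 /GRing.scale /= mulrN mulNr.
apply: is_derive_eq (is_deriveM h1 (is_derive_carl_weight s0)) _.
rewrite /carl_weight2 /carl_weight1 /GRing.scale /=; move: (carl_weight s) => G.
by field; rewrite gt_eqF.
Qed.

Lemma cont_carl_weight2 (s : R) : 0 < s -> {for s, continuous carl_weight2}.
Proof.
move=> s0; have ci := cont_inv s0.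
apply: (@continuousM _ _ (fun s : R => (c / s + d) ^+ 2 - c / s ^+ 2) carl_weight); last first.
  exact: is_derive_cont (is_derive_carl_weight s0).
have h : {for s, continuous (fun t : R => c / t)}.
  apply: (@continuousM _ _ (fun=> c) (fun t : R => t^-1)) => //.
  exact: cst_continuous.
have h2 : {for s, continuous (fun t : R => c / t + d)}.
  apply: (@continuousD _ _ _ (fun t : R => c / t) (fun=> d)) => //.
  exact: cst_continuous.
apply: (@continuousB _ _ _ (fun s : R => (c / s + d) ^+ 2) (fun s : R => c / s ^+ 2)).
  exact: (@continuousM _ _ (fun s : R => c / s + d) (fun s : R => c / s + d)).
rewrite (_ : (fun s : R => c / s ^+ 2) = (fun s : R => c / s * s^-1)).
  exact: (@continuousM _ _ (fun s : R => c / s) (fun s : R => s^-1)).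
by apply/funext => u; rewrite expr2 invfM mulrA.
Qed.

End Exponent.

Section RadialProduct.
Context (R : realType).
Variables (g g1 g2 k k1 k2 : R -> R).
Hypothesis g'E : forall s : R, 0 < s -> is_derive s (1 : R) g (g1 s).
Hypothesis k'E : forall s : R, 0 < s -> is_derive s (1 : R) k (k1 s).

Lemma is_derive_prod (s : R) : 0 < s ->
  is_derive s (1 : R) (fun s => g s * k s) (g1 s * k s + g s * k1 s).
Proof.
move=> s0; apply: is_derive_eq (is_deriveM (g'E s0) (k'E s0)) _.
by rewrite /GRing.scale /= addrC mulrC.
Qed.

Hypothesis g1'E : forall s : R, 0 < s -> is_derive s (1 : R) g1 (g2 s).
Hypothesis k1'E : forall s : R, 0 < s -> is_derive s (1 : R) k1 (k2 s).

Lemma is_derive_prod1 (s : R) : 0 < s ->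
  is_derive s (1 : R) (fun s => g1 s * k s + g s * k1 s)
    (g2 s * k s + 2 * (g1 s * k1 s) + g s * k2 s).
Proof.
move=> s0.
have h1 := is_deriveM (g1'E s0) (k'E s0).
have h2 := is_deriveM (g'E s0) (k1'E s0).
apply: is_derive_eq (is_deriveD h1 h2) _; rewrite /GRing.scale /=.
by move: (g s) (g1 s) (g2 s) (k s) (k1 s) (k2 s) => x1 x2 x3 x4 x5 x6; ring.
Qed.

Hypothesis cg2 : forall s : R, 0 < s -> {for s, continuous g2}.
Hypothesis ck2 : forall s : R, 0 < s -> {for s, continuous k2}.

Lemma cont_prod2 (s : R) : 0 < s ->
  {for s, continuous (fun s => g2 s * k s + 2 * (g1 s * k1 s) + g s * k2 s)}.
Proof.
move=> s0.
have cg := is_derive_cont (g'E s0); have ck := is_derive_cont (k'E s0).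
have cg1 := is_derive_cont (g1'E s0); have ck1 := is_derive_cont (k1'E s0).
apply: (@continuousD _ _ _ (fun s => g2 s * k s + 2 * (g1 s * k1 s)) (fun s => g s * k2 s)).
  apply: (@continuousD _ _ _ (fun s => g2 s * k s) (fun s => 2 * (g1 s * k1 s))).
    by apply: continuousM => //; exact: cg2.
  apply: (@continuousM _ _ (fun=> 2) (fun s => g1 s * k1 s)); first exact: cst_continuous.
  exact: continuousM.
by apply: continuousM => //; exact: ck2.
Qed.

End RadialProduct.

Section Conjugation.
Context (R : realType) (n : nat) (p : 'rV[R]_n).
Variables (A : set 'rV[R]_n).
Hypotheses (oA : open A).
Hypothesis sq_pos : forall x, A x -> 0 < sq p x.
Variable t : R.
Variables (k k1 k2 : R -> R).
Hypothesis k'E : forall s : R, 0 < s -> is_derive s (1 : R) k (k1 s).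
Hypothesis k1'E : forall s : R, 0 < s -> is_derive s (1 : R) k1 (k2 s).
Hypothesis ck2 : forall s : R, 0 < s -> {for s, continuous k2}.
Notation sq := (sq p). Notation eul := (eul p). Notation gam := (gam p).
Notation lap0 := (lap0 p).

(** With these coefficients the weight at distance [r] is
    [r^((n-2)/2) exp (- t (ln r - r^2/400))]. *)
Definition log_coef : R := - (t / 2) + (n%:R - 2) / 4.
Definition lin_coef : R := t / 400.
Notation g := (carl_weight log_coef lin_coef).

Lemma C2_gk : C2 A (fun x => g (sq x) * k (sq x)).
Proof.
exact: (C2_radial oA (k := fun s => g s * k s) sq_pos
  (is_derive_prod (@is_derive_carl_weight R log_coef lin_coef) k'E)
  (is_derive_prod1 (@is_derive_carl_weight R log_coef lin_coef) k'E (@is_derive_carl_weight1 R log_coef lin_coef) k1'E)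
  (cont_prod2 (@is_derive_carl_weight R log_coef lin_coef) k'E (@is_derive_carl_weight1 R log_coef lin_coef) k1'E
     (@cont_carl_weight2 R log_coef lin_coef) ck2)).
Qed.

(** The weight is chosen so that its own derivatives cancel the lower order terms
    of [conj_op]: besides the Laplacian of [f] only terms with a derivative of
    the cutoff [k] remain. *)
Lemma conj_op_gk f x : C2 A f -> A x ->
  conj_op p t (fun x => g (sq x) * k (sq x) * f x) x =
  g (sq x) * k (sq x) * (sq x * laplacian f x)
  + g (sq x) * (4 * (sq x * k1 (sq x)) * eul f x
     + (4 * (sq x ^+ 2 * k2 (sq x)) + 2 * n%:R * (sq x * k1 (sq x))) * f x).
Proof.
move=> hf Ax; have sx := sq_pos Ax.
have d1 := is_derive_prod (@is_derive_carl_weight R log_coef lin_coef) k'E.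
have d2 := is_derive_prod1 (@is_derive_carl_weight R log_coef lin_coef) k'E (@is_derive_carl_weight1 R log_coef lin_coef) k1'E.
have cd2 := cont_prod2 (@is_derive_carl_weight R log_coef lin_coef) k'E (@is_derive_carl_weight1 R log_coef lin_coef) k1'E
     (@cont_carl_weight2 R log_coef lin_coef) ck2.
rewrite /conj_op (lap0M p oA C2_gk hf Ax).
rewrite (lap0_radial oA (k := fun s => g s * k s) sq_pos d1 d2 cd2 Ax).
rewrite (gamC p _ f) (gam_radial oA (k := fun s => g s * k s) sq_pos d1 f Ax).
rewrite (eulM p (C2_C1 C2_gk) (C2_C1 hf) Ax).
rewrite (eul_radial oA (k := fun s => g s * k s) sq_pos d1 Ax).
rewrite /lap0 /carl_weight1 /carl_weight2 /zeta /log_coef /lin_coef.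
move: (carl_weight _ _ _) (k (sq x)) (k1 (sq x)) (k2 (sq x)) (laplacian f x) (eul f x) (f x).
move: (sq x) sx => s sx x1 x2 x3 x4 x5 x6 x7.
by field; rewrite gt_eqF.
Qed.

End Conjugation.

(** * The cutoff estimate *)

Section CutoffPointwise.
Context (R : realType).
Implicit Types (t s : R).

Lemma sqrD_le (x y : R) : (x + y) ^+ 2 <= 2 * (x ^+ 2 + y ^+ 2).
Proof. by rewrite -subr_ge0 (_ : _ - _ = (x - y) ^+ 2) ?sqr_ge0//; ring. Qed.

(** [X] and [Y] stand for [s k'] and [s^2 k'']; [dr + i di] is the difference
    between the potential and its smooth part.  That difference takes one half of
    the Carleman gain.  The gradient terms live where [k' <> 0] and are removed
    as in the Caccioppoli inequality: testing the equation for [a] with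
    [(G X)^2 a] gives the expressions multiplied by 128, which integrate to
    zero, and leaves only [a^2 + b^2] on the support of [X] and [Y]. *)
Lemma cutoff_pointwise (t s G kk X Y a b Ea Eb Da Db La Lb VR VI dr di nu e M : R) :
  20 <= t -> 0 < s -> s <= 81 -> 0 <= nu -> nu <= t -> `|nu - 2| <= t ->
  `|e| <= t -> `|VR| <= M -> M <= t ^+ 2 ->
  dr ^+ 2 + di ^+ 2 <= t ^+ 3 / 81 / 800 ->
  Ea ^+ 2 <= Da -> Eb ^+ 2 <= Db ->
  La = s * (VR * a - VI * b) - (nu - 2) * Ea ->
  Lb = s * (VR * b + VI * a) - (nu - 2) * Eb ->
  (G * kk * (s * (dr * a - di * b)) + G * (4 * X * Ea + (4 * Y + 2 * nu * X) * a)) ^+ 2 +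
  (G * kk * (s * (dr * b + di * a)) + G * (4 * X * Eb + (4 * Y + 2 * nu * X) * b)) ^+ 2
  <= t ^+ 3 / 400 * (s * (G * kk) ^+ 2 * (a ^+ 2 + b ^+ 2)) +
     (128 * (((G * X) ^+ 2 * a * La + ((G * X) ^+ 2 * Da +
              4 * (G * X) * a * Ea * (G * ((e + 1) * X + Y))))
      + ((G * X) ^+ 2 * b * Lb + ((G * X) ^+ 2 * Db +
              4 * (G * X) * b * Eb * (G * ((e + 1) * X + Y)))))
     + 200 * 100 * t ^+ 2 * (G ^+ 2 * (X ^+ 2 + Y ^+ 2) * (a ^+ 2 + b ^+ 2))).
Proof.
move=> t20 s0 s81 nu0 nut nu2 et VM Mt dd EDa EDb LaE LbE.
set N := a ^+ 2 + b ^+ 2; set X2 := X ^+ 2; set Psi := X ^+ 2 + Y ^+ 2.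
have N0 : 0 <= N by rewrite addr_ge0 ?sqr_ge0.
have G0 : 0 <= G ^+ 2 by exact: sqr_ge0.
have X0 : 0 <= X2 by exact: sqr_ge0.
have Psi0 : 0 <= Psi by rewrite addr_ge0 ?sqr_ge0.
have XPsi : X2 <= Psi by rewrite lerDl sqr_ge0.
have t0 : 0 < t by apply: lt_le_trans t20.
have tt : 400 <= t ^+ 2.
  rewrite -subr_ge0 (_ : _ - _ = (t - 20) * (t + 20)); last by ring.
  by rewrite mulr_ge0// ?subr_ge0// addr_ge0// ltW.
have nn : nu ^+ 2 <= t ^+ 2 by rewrite lerXn2r ?nnegrE// ltW.
have nn2 : (nu - 2) ^+ 2 <= t ^+ 2.
  by rewrite -(real_normK (num_real (nu - 2))) lerXn2r ?nnegrE// ltW.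
have ee : (e + 1) ^+ 2 <= 2 * t ^+ 2.
  have h1 : `|e + 1| <= t + 1 by rewrite (le_trans (ler_normD _ _))// normr1 lerD2r.
  rewrite -(real_normK (num_real (e + 1))).
  apply: (@le_trans _ _ ((t + 1) ^+ 2)); first by rewrite lerXn2r ?nnegrE// addr_ge0// ltW.
  rewrite -subr_ge0 (_ : _ - _ = t * (t - 20) + (18 * t - 1)); last by ring.
  apply: addr_ge0; first by apply: mulr_ge0; [exact: ltW|rewrite subr_ge0].
  by clear - t20; lra.
(* The error made by replacing the potential by its smooth part. *)
pose Pot := (G * kk * s) ^+ 2 * (dr ^+ 2 + di ^+ 2) * N.
have HPot : 2 * Pot <= t ^+ 3 / 400 * (s * (G * kk) ^+ 2 * N).
  rewrite /Pot (_ : 2 * _ = (s * (G * kk) ^+ 2 * N) * (2 * (s * (dr ^+ 2 + di ^+ 2))));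
    last by ring.
  rewrite [leRHS]mulrC; apply: ler_wpM2l.
    by apply: mulr_ge0 => //; apply: mulr_ge0; [exact: ltW|exact: sqr_ge0].
  have h : s * (dr ^+ 2 + di ^+ 2) <= 81 * (t ^+ 3 / 81 / 800).
    by apply: ler_pM => //; [exact: ltW|rewrite addr_ge0 ?sqr_ge0].
  by clear - h; lra.
pose Q1 := 16 * X2 * (Ea ^+ 2 + Eb ^+ 2) + (4 * Y + 2 * nu * X) ^+ 2 * N.
have HP : (G * kk * (s * (dr * a - di * b)) + G * (4 * X * Ea + (4 * Y + 2 * nu * X) * a)) ^+ 2 +
  (G * kk * (s * (dr * b + di * a)) + G * (4 * X * Eb + (4 * Y + 2 * nu * X) * b)) ^+ 2
  <= 2 * Pot + 4 * (G ^+ 2 * Q1).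
  set pa := G * kk * (s * (dr * a - di * b)); set pb := G * kk * (s * (dr * b + di * a)).
  set qa := 4 * X * Ea + _; set qb := 4 * X * Eb + _.
  have e1 : pa ^+ 2 + pb ^+ 2 = Pot by rewrite /pa /pb /Pot /N; ring.
  have h1 := sqrD_le pa (G * qa). have h2 := sqrD_le pb (G * qb).
  have h3 : G ^+ 2 * (qa ^+ 2 + qb ^+ 2) <= 2 * (G ^+ 2 * Q1).
    rewrite mulrCA ler_wpM2l//.
    have h4 := sqrD_le (4 * X * Ea) ((4 * Y + 2 * nu * X) * a).
    have h5 := sqrD_le (4 * X * Eb) ((4 * Y + 2 * nu * X) * b).
    apply: le_trans (lerD h4 h5) _; rewrite le_eqVlt; apply/orP; left; apply/eqP.
    by rewrite /Q1 /N /X2; ring.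
  apply: le_trans (lerD h1 h2) _; rewrite -e1.
  have -> : 2 * (pa ^+ 2 + (G * qa) ^+ 2) + 2 * (pb ^+ 2 + (G * qb) ^+ 2) =
    2 * (pa ^+ 2 + pb ^+ 2) + 2 * (G ^+ 2 * (qa ^+ 2 + qb ^+ 2)) by ring.
  by rewrite lerD2l; clear - h3; lra.
have HQ2 : (4 * Y + 2 * nu * X) ^+ 2 <= 8 * t ^+ 2 * Psi.
  apply: le_trans (sqrD_le _ _) _.
  have h1 : nu ^+ 2 * X2 <= t ^+ 2 * X2 by rewrite ler_wpM2r.
  have h2 : 400 * Y ^+ 2 <= t ^+ 2 * Y ^+ 2 by rewrite ler_wpM2r ?sqr_ge0.
  have h3 : 0 <= Y ^+ 2 by exact: sqr_ge0.
  rewrite (_ : 2 * _ = 32 * Y ^+ 2 + 8 * (nu ^+ 2 * X2)); last by rewrite /X2; ring.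
  rewrite (_ : 8 * _ * _ = 8 * (t ^+ 2 * X2) + 8 * (t ^+ 2 * Y ^+ 2));
    last by rewrite /Psi /X2; ring.
  by clear - h1 h2 h3; lra.
pose T1 := (e + 1) * X + Y.
have HT1 : T1 ^+ 2 <= 4 * t ^+ 2 * Psi.
  apply: le_trans (sqrD_le _ _) _; rewrite exprMn.
  have h1 : (e + 1) ^+ 2 * X2 <= 2 * t ^+ 2 * X2 by rewrite ler_wpM2r.
  have h2 : 400 * Y ^+ 2 <= t ^+ 2 * Y ^+ 2 by rewrite ler_wpM2r ?sqr_ge0.
  have h3 : 0 <= Y ^+ 2 by exact: sqr_ge0.
  rewrite (_ : 4 * _ * _ = 2 * (2 * t ^+ 2 * X2) + 4 * (t ^+ 2 * Y ^+ 2));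
    last by rewrite /Psi /X2; ring.
  by move: h1; rewrite /X2 => h1; clear - h1 h2 h3; lra.
have young (u v : R) : u * v <= u ^+ 2 / 4 + v ^+ 2.
  rewrite -subr_ge0 (_ : _ - _ = (u / 2 - v) ^+ 2) ?sqr_ge0//.
  by field.
(* F is the Caccioppoli identity without the common factor G ^+ 2. *)
pose F := (X2 * a * La + (X2 * Da + 4 * X * a * Ea * T1))
      + (X2 * b * Lb + (X2 * Db + 4 * X * b * Eb * T1)).
have HF : X2 * (Ea ^+ 2 + Eb ^+ 2) <=
    2 * F + 2 * (X2 * (82 * t ^+ 2) + 16 * T1 ^+ 2) * N.
  have y1 := young (X * Ea) (- (4 * T1 * a)). have y2 := young (X * Eb) (- (4 * T1 * b)).
  have y3 := young (X * Ea) (X * ((nu - 2) * a)).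
  have y4 := young (X * Eb) (X * ((nu - 2) * b)).
  have d1 : X2 * Ea ^+ 2 <= X2 * Da by rewrite ler_wpM2l.
  have d2 : X2 * Eb ^+ 2 <= X2 * Db by rewrite ler_wpM2l.
  have v1 : - (81 * (t ^+ 2 * (X2 * N))) <= s * VR * (X2 * N).
    rewrite mulrA -mulNr ler_wpM2r//; first exact: mulr_ge0.
    apply: lerNnormlW; rewrite normrM gtr0_norm//.
    by apply: ler_pM => //; [exact: ltW|exact: le_trans Mt].
  have n1 : (nu - 2) ^+ 2 * (X2 * N) <= t ^+ 2 * (X2 * N).
    by rewrite ler_wpM2r//; exact: mulr_ge0.
  have FE : F = s * VR * (X2 * N) + X2 * Da + X2 * Db
    - (X * Ea * (X * ((nu - 2) * a)) + X * Eb * (X * ((nu - 2) * b)))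
    - (X * Ea * (- (4 * T1 * a)) + X * Eb * (- (4 * T1 * b))).
    by rewrite /F LaE LbE /N /X2; ring.
  have y34 : (X * ((nu - 2) * a)) ^+ 2 + (X * ((nu - 2) * b)) ^+ 2 = (nu - 2) ^+ 2 * (X2 * N).
    by rewrite /N /X2; ring.
  have y12 : (- (4 * T1 * a)) ^+ 2 + (- (4 * T1 * b)) ^+ 2 = 16 * T1 ^+ 2 * N.
    by rewrite /N; ring.
  have e1 : (X * Ea) ^+ 2 = X2 * Ea ^+ 2 by rewrite exprMn.
  have e2 : (X * Eb) ^+ 2 = X2 * Eb ^+ 2 by rewrite exprMn.
  rewrite FE.
  rewrite (_ : 2 * (X2 * (82 * t ^+ 2) + 16 * T1 ^+ 2) * N =
     164 * (t ^+ 2 * (X2 * N)) + 2 * (16 * T1 ^+ 2 * N)); last by ring.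
  rewrite -y12 mulrDr.
  move: y1 y2 y3 y4 d1 d2 v1 n1 y34; rewrite e1 e2.
  clear.
  move: (X2 * Ea ^+ 2) (X2 * Eb ^+ 2) (t ^+ 2 * (X2 * N)) ((nu - 2) ^+ 2 * _).
  move: (X * Ea * _) (X * Eb * _) (X * Ea * _) (X * Eb * _) (_ ^+ 2) (_ ^+ 2) (_ ^+ 2) (_ ^+ 2).
  move: (s * VR * _) (X2 * Da) (X2 * Db) => *.
  lra.
have HT : 2 * (X2 * (82 * t ^+ 2) + 16 * T1 ^+ 2) * N <= 292 * (t ^+ 2 * Psi * N).
  have h1 : X2 * (t ^+ 2 * N) <= Psi * (t ^+ 2 * N).
    by rewrite ler_wpM2r// mulr_ge0// ?sqr_ge0.
  have h2 : T1 ^+ 2 * N <= 4 * t ^+ 2 * Psi * N by rewrite ler_wpM2r.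
  rewrite (_ : 2 * _ * N = 164 * (X2 * (t ^+ 2 * N)) + 32 * (T1 ^+ 2 * N)); last by ring.
  rewrite (_ : 292 * _ = 164 * (Psi * (t ^+ 2 * N)) + 32 * (4 * t ^+ 2 * Psi * N)); last by ring.
  by clear - h1 h2; lra.
apply: le_trans HP _; rewrite -addrA; apply: lerD HPot _.
rewrite (_ : 128 * _ + _ = G ^+ 2 * (128 * F + 200 * 100 * (t ^+ 2 * Psi * N))); last first.
  by rewrite /F /T1 /X2; ring.
rewrite mulrCA; apply: ler_wpM2l => //.
have HQ2N : (4 * Y + 2 * nu * X) ^+ 2 * N <= 8 * t ^+ 2 * Psi * N by rewrite ler_wpM2r.
have P3 : 0 <= t ^+ 2 * Psi * N.
  by apply: mulr_ge0 => //; apply: mulr_ge0 => //; exact: sqr_ge0.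
rewrite /Q1 -mulrA.
have HQ2N' : (4 * Y + 2 * nu * X) ^+ 2 * N <= 8 * (t ^+ 2 * Psi * N).
  by apply: le_trans HQ2N _; rewrite le_eqVlt; apply/orP; left; apply/eqP; ring.
move: HF HT HQ2N' P3; clear.
move: (X2 * (Ea ^+ 2 + _)) (_ ^+ 2 * N) (t ^+ 2 * Psi * N) (2 * _ * N) F => x1 x2 x3 x4 x5.
lra.
Qed.

End CutoffPointwise.

Lemma dim_bound (R : realType) (t nu : R) : 20 <= t -> 1 <= nu -> nu <= t ->
  `|nu - 2| <= t.
Proof. by move=> *; rewrite ler_norml; lra. Qed.

Lemma exponent_bound (R : realType) (t nu u : R) : 20 <= t -> 1 <= nu -> nu <= t ->
  0 <= u -> u <= t * 81 -> `|- (t / 2) + (nu - 2) / 4 + u / 400| <= t.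
Proof. by move=> *; rewrite ler_norml; lra. Qed.

Section CutoffEstimate.
Context (R : realType) (n : nat) (p : 'rV[R]_n).
Variables (A K : set 'rV[R]_n).
Hypotheses (oA : open A) (cK : closed K) (KA : K `<=` A).
Hypothesis sq_pos : forall x, A x -> 0 < sq p x.
Hypothesis bK : exists B : R, forall x, K x -> forall i, `|x ord0 i| <= B.
Hypothesis K81 : forall x, K x -> sq p x <= 81.
Implicit Types (F G f : 'rV[R]_n -> R) (x : 'rV[R]_n).
Notation sq := (sq p). Notation eul := (eul p). Notation gam := (gam p).
Notation lap0 := (lap0 p). Notation cyl_int := (cyl_int p). Notation CK := (CK A K).

Variable t : R.
Hypotheses (t20 : 20 <= t) (nt : n%:R <= t) (n_gt0 : (0 < n)%N).
Variables (k k1 k2 : R -> R).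
Hypothesis k'E : forall s : R, 0 < s -> is_derive s (1 : R) k (k1 s).
Hypothesis k1'E : forall s : R, 0 < s -> is_derive s (1 : R) k1 (k2 s).
Hypothesis ck2 : forall s : R, 0 < s -> {for s, continuous k2}.
Hypothesis k_off : forall x, ~ K x -> [/\ k (sq x) = 0, k1 (sq x) = 0 & k2 (sq x) = 0].

Variables (a b VR VI Wr Wi : 'rV[R]_n -> R) (M : R).
Hypotheses (ha : C2 A a) (hb : C2 A b) (hWr : C1 A Wr) (hWi : C1 A Wi).
Hypothesis eqa : forall x, A x -> laplacian a x = VR x * a x - VI x * b x.
Hypothesis eqb : forall x, A x -> laplacian b x = VR x * b x + VI x * a x.
Hypotheses (Mt : M <= t ^+ 2) (VRM : forall x, K x -> `|VR x| <= M).
Let m := t ^+ 2 / 100 / 100.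
Hypotheses (Wrm : forall x, K x -> `|Wr x| <= m) (Wim : forall x, K x -> `|Wi x| <= m).
Hypotheses (gWr : forall x, K x -> gam Wr Wr x <= (9 * m) ^+ 2).
Hypotheses (gWi : forall x, K x -> gam Wi Wi x <= (9 * m) ^+ 2).
Hypothesis VW : forall x, K x ->
  (VR x - Wr x) ^+ 2 + (VI x - Wi x) ^+ 2 <= t ^+ 3 / 81 / 800.

Notation g := (carl_weight (log_coef n t) (lin_coef t)).
Let gd := @is_derive_carl_weight R (log_coef n t) (lin_coef t).

Let ck1 (s : R) : 0 < s -> {for s, continuous k1}.
Proof. by move=> s0; exact: is_derive_cont (k1'E s0). Qed.

(* T = g (s k') is the square root of the weight in the Caccioppoli inequality:
   up to the factor 4 it is the coefficient of eul f in conj_op_gk. *)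
Let kt (s : R) : R := s * k1 s.
Let kt1 (s : R) : R := k1 s + s * k2 s.
Let kt'E (s : R) : 0 < s -> is_derive s (1 : R) kt (kt1 s).
Proof.
move=> s0; apply: is_derive_eq (@is_deriveM _ _ (@id R) k1 s 1 1 _ _ (k1'E s0)) _.
by rewrite /GRing.scale /= addrC mulr1.
Qed.
Let T'E := is_derive_prod gd kt'E.
Let cT1 (s : R) : 0 < s ->
  {for s, continuous (fun s => carl_weight1 (log_coef n t) (lin_coef t) s * kt s + g s * kt1 s)}.
Proof.
move=> s0.
apply: (@continuousD _ _ _ (fun s => carl_weight1 (log_coef n t) (lin_coef t) s * kt s) (fun s => g s * kt1 s)).
  by apply: continuousM; [exact: is_derive_cont (is_derive_carl_weight1 _ _ s0)
    |exact: is_derive_cont (kt'E s0)].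
apply: continuousM; first exact: is_derive_cont (gd s0).
apply: (@continuousD _ _ _ k1 (fun s => s * k2 s)); first exact: ck1.
by apply: continuousM; [exact: cvg_id|exact: ck2].
Qed.

Let T x : R := g (sq x) * kt (sq x).
Let T1 x : R := carl_weight1 (log_coef n t) (lin_coef t) (sq x) * kt (sq x) + g (sq x) * kt1 (sq x).
Let C1_T : C1 A T.
Proof. exact: (C1_radial oA (k := fun s => g s * kt s) sq_pos T'E cT1). Qed.
Let T_off x : ~ K x -> T x = 0.
Proof. by move=> /k_off[_ h _]; rewrite /T /kt h !mulr0. Qed.

Let F f x : R := T x * (T x * f x) * lap0 f x + gam f (fun x => T x * (T x * f x)) x.

Let I_F f : C2 A f -> CK (F f) /\ cyl_int (F f) = 0.
Proof.
move=> hf; have hTf := C1M oA C1_T (C1M oA C1_T (C2_C1 hf)).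
have T0 x : ~ K x -> T x * (T x * f x) = 0 by move=> Kx; rewrite T_off// mul0r.
split; last exact: (cyl_int_lap0 oA cK KA sq_pos bK hf hTf T0).
apply: CKD; last exact: (CK_gam p oA cK (C2_C1 hf) hTf T0).
apply: CKMr; first by move=> x Ax; exact: cont_lap0 hf Ax.
exact: (CK_C1 (n := n) hTf T0).
Qed.

Let FE f x : C2 A f -> A x -> F f x = T x ^+ 2 * f x * lap0 f x +
   (T x ^+ 2 * gam f f x + 4 * T x * f x * eul f x * (sq x * T1 x)).
Proof.
move=> hf Ax; have hf1 := C2_C1 hf; have hTf := C1M oA C1_T hf1.
rewrite /F (gamMr p f C1_T hTf Ax) (gamMr p f C1_T hf1 Ax).
rewrite (gam_radial oA (k := fun s => g s * kt s) sq_pos T'E f Ax) -/(T1 x).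
move: (gam f f x) (lap0 f x) (eul f x) (T x) (T1 x) (f x) (sq x).
by move=> x1 x2 x3 x4 x5 x6 x7; ring.
Qed.

Let h f x : R := g (sq x) * k (sq x) * f x.
Let N x : R := a x ^+ 2 + b x ^+ 2.

Let C2_h f : C2 A f -> C2 A (h f).
Proof.
by move=> hf; apply: (C2M oA _ hf); exact: (C2_gk oA sq_pos t k'E k1'E ck2).
Qed.
Let h_off f x : ~ K x -> h f x = 0.
Proof. by move=> /k_off[hk _ _]; rewrite /h hk mulr0 mul0r. Qed.

Let hs : C1 A sq. Proof. exact: C1_sq. Qed.
Let cs x : A x -> {for x, continuous sq}. Proof. exact: C1_cont. Qed.
Let crad (q : R -> R) x : (forall s : R, 0 < s -> {for s, continuous q}) -> A x ->
  {for x, continuous (fun x => q (sq x))}.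
Proof.
move=> cq Ax; apply: continuous_comp; first exact: cs.
by apply: cq; exact: sq_pos.
Qed.
Let cg x : A x -> {for x, continuous (fun x => g (sq x))}.
Proof. by apply: crad => s s0; exact: is_derive_cont (gd s0). Qed.
Let cN x : A x -> {for x, continuous N}.
Proof.
move=> Ax; have ca := C1_cont (C2_C1 ha) Ax; have cb := C1_cont (C2_C1 hb) Ax.
by apply: contD; [exact: (contM ca ca)|exact: (contM cb cb)].
Qed.

(** Invariant under dilation of the cutoff, hence bounded independently of the
    inner radius. *)
Definition cutoff_energy x : R := (sq x * k1 (sq x)) ^+ 2 + (sq x ^+ 2 * k2 (sq x)) ^+ 2.

Let CK_lhs : CK (fun x => sq x * (g (sq x) * k (sq x)) ^+ 2 * N x).
Proof.
have c : CK (fun x => g (sq x) * k (sq x)).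
  apply: CKM => //; split; last by move=> x /k_off[].
  by move=> x Ax; apply: (crad (q := k)) => // s s0; exact: is_derive_cont (k'E s0).
by apply: CKMr => //; apply: CKM => //; exact: CK_sqr.
Qed.

Let CK_rhs : CK (fun x => g (sq x) ^+ 2 * cutoff_energy x * N x).
Proof.
apply: CKMr => //; apply: CKM.
  by move=> x Ax; exact: (contM (cg Ax) (cg Ax)).
apply: CKD; apply: CK_sqr; apply: CKM => //.
- by split; [move=> x Ax; exact: (crad (q := k1))|move=> x /k_off[]].
- by move=> x Ax; exact: (contM (cs Ax) (cs Ax)).
- by split; [move=> x Ax; exact: (crad (q := k2))|move=> x /k_off[]].
Qed.

(** The solution times [g k] is inserted in [carleman]; its right-hand side is
    estimated by [cutoff_pointwise] and one half of the left-hand side is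
    absorbed. *)
Theorem cutoff_estimate :
  t * cyl_int (fun x => sq x * (g (sq x) * k (sq x)) ^+ 2 * N x) <=
  400 * (200 * 100) * cyl_int (fun x => g (sq x) ^+ 2 * cutoff_energy x * N x).
Proof.
have t0 : 0 < t by apply: lt_le_trans t20.
have := carleman oA cK KA sq_pos bK K81 t20 (C2_h ha) (C2_h hb) (@h_off a) (@h_off b)
  hWr hWi Wrm Wim gWr gWi.
set Ps := (X in _ <= cyl_int X).
have CKP : CK Ps.
  have cW V : C1 A V -> forall x, A x -> {for x, continuous V}.
    by move=> hV x Ax; exact: C1_cont hV Ax.
  have CKa := CK_C1 (n := n) (C2_C1 (C2_h ha)) (@h_off a).
  have CKb := CK_C1 (n := n) (C2_C1 (C2_h hb)) (@h_off b).
  rewrite /Ps; apply: CKD; apply: CK_sqr; apply: CKD.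
  - exact: (CK_conj_op p oA cK t (C2_h ha) (@h_off a)).
  - apply: CKN; apply: CKM => //.
    by apply: CKD; [exact: CKM (cW _ hWr) CKa|apply: CKN; exact: CKM (cW _ hWi) CKb].
  - exact: (CK_conj_op p oA cK t (C2_h hb) (@h_off b)).
  - apply: CKN; apply: CKM => //.
    by apply: CKD; [exact: CKM (cW _ hWr) CKb|exact: CKM (cW _ hWi) CKa].
have [CKFa IFa] := I_F ha. have [CKFb IFb] := I_F hb.
have CKFab := CKD CKFa CKFb.
have EL : cyl_int (fun x => sq x * (h a x ^+ 2 + h b x ^+ 2)) =
    cyl_int (fun x => sq x * (g (sq x) * k (sq x)) ^+ 2 * N x).
  congr (cyl_int _); apply/funext => x; rewrite /h /N.
  by move: (sq x) (g _) (k _) (a x) (b x) => x1 x2 x3 x4 x5; ring.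
rewrite EL => H.
have HP : cyl_int Ps <= t ^+ 3 / 400 * cyl_int (fun x => sq x * (g (sq x) * k (sq x)) ^+ 2 * N x) +
    (128 * cyl_int (fun x => F a x + F b x) +
     200 * 100 * t ^+ 2 * cyl_int (fun x => g (sq x) ^+ 2 * cutoff_energy x * N x)).
  rewrite -!(cyl_intZ oA cK KA sq_pos bK)//.
  rewrite -!(cyl_intD oA cK KA sq_pos bK); try by [exact: CKZ|apply: CKD; exact: CKZ].
  apply: (cyl_int_le oA cK KA sq_pos bK) => //.
    by apply: CKD; [exact: CKZ|apply: CKD; exact: CKZ].
  move=> x Kx; have Ax := KA Kx; have sx := sq_pos Ax.
  rewrite (FE ha Ax) (FE hb Ax) /Ps.
  rewrite (conj_op_gk oA sq_pos t k'E k1'E ck2 ha Ax).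
  rewrite (conj_op_gk oA sq_pos t k'E k1'E ck2 hb Ax) (eqa Ax) (eqb Ax).
  have sT1 : sq x * T1 x = g (sq x) *
     ((log_coef n t + lin_coef t * sq x + 1) * (sq x * k1 (sq x)) + sq x ^+ 2 * k2 (sq x)).
    rewrite /T1 /kt /kt1 /carl_weight1; move: (g _) (k1 _) (k2 _) => x1 x2 x3.
    by field; rewrite gt_eqF.
  rewrite sT1 /T /kt /cutoff_energy /N.
  have La : lap0 a x = sq x * (VR x * a x - VI x * b x) - (n%:R - 2) * eul a x.
    by rewrite /lap0 (eqa Ax).
  have Lb : lap0 b x = sq x * (VR x * b x + VI x * a x) - (n%:R - 2) * eul b x.
    by rewrite /lap0 (eqb Ax).
  have n1 : 1 <= n%:R :> R by rewrite ler1n.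
  have n2t : `|n%:R - 2 : R| <= t by exact: dim_bound.
  have et : `|log_coef n t + lin_coef t * sq x| <= t.
    have s81 := K81 Kx.
    have u1 : 0 <= t * sq x by rewrite mulr_ge0// ltW.
    have u2 : t * sq x <= t * 81 by rewrite ler_wpM2l// ltW.
    rewrite /log_coef /lin_coef (_ : t / 400 * sq x = t * sq x / 400); last by rewrite mulrAC.
    exact: exponent_bound.
  have := cutoff_pointwise (g (sq x)) (k (sq x)) (sq x * k1 (sq x)) (sq x ^+ 2 * k2 (sq x))
    t20 sx (K81 Kx) (ler0n _ n) nt n2t et (VRM Kx) Mt (VW Kx)
    (eul_le_gam p a x) (eul_le_gam p b x) La Lb.
  apply: le_trans; rewrite le_eqVlt; apply/orP; left; apply/eqP.
  rewrite /h; move: (g _) (k _) (k1 _) (k2 _) (eul a x) (eul b x) (a x) (b x).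
  move: (VR x) (VI x) (Wr x) (Wi x) (sq x) => v1 v2 v3 v4 v5 x1 x2 x3 x4 x5 x6 x7 x8.
  by ring.
rewrite (cyl_intD oA cK KA sq_pos bK CKFa CKFb) IFa IFb addr0 mulr0 add0r in HP.
move: (le_trans H HP).
move: (cyl_int _) (cyl_int _) => Y X XY.
have t2 : 0 < t ^+ 2 by rewrite exprn_gt0.
rewrite -(ler_pM2l t2).
have -> : t ^+ 2 * (t * X) = 400 * (t ^+ 3 / 200 * X - t ^+ 3 / 400 * X) by field.
have -> : t ^+ 2 * (400 * (200 * 100) * Y) = 400 * (200 * 100 * t ^+ 2 * Y) by ring.
apply: ler_wpM2l; first exact: ler0n.
by rewrite lerBlDl.
Qed.

End CutoffEstimate.

(** * Annular cutoff functions *)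

Section Splines.
Context (R : realType).
Implicit Types (u v s : R).

Definition pos_part u : R := (u + `|u|) / 2.

Lemma pos_part_ge0E u : 0 <= u -> pos_part u = u.
Proof. by move=> u0; rewrite /pos_part ger0_norm//; field. Qed.

Lemma pos_part_le0E u : u <= 0 -> pos_part u = 0.
Proof. by move=> u0; rewrite /pos_part ler0_norm// subrr mul0r. Qed.

Lemma pos_part_cont : continuous pos_part.
Proof.
move=> u; apply: (@continuousM _ _ (fun u : R => u + `|u|) (fun=> 2^-1)); last first.
  exact: cst_continuous.
by apply: (@continuousD _ _ _ (fun u : R => u) (fun u : R => `|u|)); [exact: cvg_id|exact: norm_continuous].
Qed.

(** A quadratic bound on the remainder makes sense also at a point where two
    formulas for [f] meet, as 0 does for the truncated powers. *)
Lemma is_derive_quad (f : R -> R) u (d : R) :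
  (forall h, `|f (u + h) - f u - d * h| <= h ^+ 2) -> is_derive u (1 : R) f d.
Proof.
move=> H.
have c : (fun h : R => h^-1 *: ((f \o shift u) (h *: 1) - f u)) @ 0^' --> d.
  apply/cvgrPdist_le => e e0; near=> h.
  have h0 : h != 0 by near: h; exact: nbhs_dnbhs_neq.
  rewrite /= [_%:A]mulr1 [h + u]addrC /GRing.scale /=.
  have -> : d - h^-1 * (f (u + h) - f u) = - (h^-1 * (f (u + h) - f u - d * h)).
    by field.
  rewrite normrN normrM normfV ler_pdivrMl ?normr_gt0//.
  apply: le_trans (H h) _; rewrite -real_normK ?num_real// expr2 ler_wpM2l//.
  by near: h; exact: dnbhs0_le.
apply: DeriveDef; first by apply/cvg_ex; exists d.
exact: cvg_lim c.
Unshelve. all: by end_near. Qed.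

Lemma is_derive_pos_part2 u : is_derive u (1 : R) (fun u => pos_part u ^+ 2) (2 * pos_part u).
Proof.
apply: is_derive_quad => h.
have [u0|/ltW u0] := leP 0 u; have [v0|/ltW v0] := leP 0 (u + h);
  rewrite ?(pos_part_ge0E u0) ?(pos_part_le0E u0) ?(pos_part_ge0E v0) ?(pos_part_le0E v0).
- by rewrite (_ : _ - _ = h ^+ 2); [rewrite ger0_norm// sqr_ge0|ring].
- rewrite (_ : _ - _ = - (u * (u + 2 * h))); last by ring.
  rewrite normrN; have h1 : u + 2 * h <= 0 by lra.
  rewrite normrM (ger0_norm u0) (ler0_norm h1).
  rewrite -subr_ge0 (_ : _ - _ = (u + h) ^+ 2); first exact: sqr_ge0.
  by ring.
- rewrite (_ : _ - _ = (u + h) ^+ 2); last by ring.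
  rewrite ger0_norm ?sqr_ge0//; have h0 : 0 <= h by lra.
  by rewrite lerXn2r ?nnegrE//; lra.
- by rewrite (_ : _ - _ = 0); [rewrite normr0 sqr_ge0|ring].
Qed.

Lemma is_derive_pos_part3 u : is_derive u (1 : R) (fun u => pos_part u ^+ 3) (3 * pos_part u ^+ 2).
Proof.
rewrite (_ : (fun u => pos_part u ^+ 3) = (fun u => pos_part u ^+ 2 * u)); last first.
  apply/funext => v; rewrite exprSr.
  by have [v0|/ltW v0] := leP 0 v; rewrite ?(pos_part_ge0E v0) ?(pos_part_le0E v0)// expr0n /= !mul0r.
have h := is_deriveM (is_derive_pos_part2 u) (@is_derive_id R _ u (1 : R)).
apply: is_derive_eq h _.
rewrite /GRing.scale /= mulr1.
have [u0|/ltW u0] := leP 0 u; rewrite ?(pos_part_ge0E u0) ?(pos_part_le0E u0); ring.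
Qed.

Lemma is_derive_affine (f : R -> R) (al be u d : R) : is_derive (al * u + be) (1 : R) f d ->
  is_derive u (1 : R) (fun u => f (al * u + be)) (d * al).
Proof.
move=> hf.
have h2 : is_derive u (1 : R) (fun u : R => al * u + be) al.
  have h := is_deriveD (is_derive_lin u al) (@is_derive_cst R _ _ be u (1 : R)).
  by apply: is_derive_eq h _; rewrite addr0.
exact: (@is_derive_comp1 _ _ f (fun u : R => al * u + be) u 1 _ _ hf h2).
Qed.

Definition diff3 (f : R -> R) u : R := f u - 3 * f (u - 1) + 3 * f (u - 2) - f (u - 3).

Lemma is_derive_diff3 (f f1 : R -> R) u : (forall v, is_derive v (1 : R) f (f1 v)) ->
  is_derive u (1 : R) (diff3 f) (diff3 f1 u).
Proof.
move=> hf.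
have sh (c : R) : is_derive u (1 : R) (fun u => f (u - c)) (f1 (u - c)).
  rewrite -[X in is_derive _ _ _ X]mulr1.
  have := @is_derive_affine f 1 (- c) u (f1 (1 * u - c)) (hf _).
  rewrite mul1r; under [X in is_derive _ _ X _]eq_fun do rewrite mul1r.
  by [].
have h1 := @is_deriveZ _ _ _ _ 3 _ _ _ (sh 1).
have h2 := @is_deriveZ _ _ _ _ 3 _ _ _ (sh 2).
exact: is_deriveB (is_deriveD (is_deriveB (hf u) h1) h2) (sh 3).
Qed.

Lemma diff3_cont (f : R -> R) : continuous f -> continuous (diff3 f).
Proof.
move=> cf u.
have sh (c : R) : {for u, continuous (fun u => f (u - c))}.
  apply: (@continuous_comp _ _ _ (fun u : R => u - c) f); last exact: cf.
  by apply: (@continuousB _ _ _ (fun u : R => u) (fun=> c)); [exact: cvg_id|exact: cst_continuous].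
have sh3 (c : R) : {for u, continuous (fun u => 3 * f (u - c))}.
  by apply: (@continuousM _ _ (fun=> 3) (fun u : R => f (u - c))); [exact: cst_continuous|exact: sh].
apply: (@continuousB _ _ _ (fun u : R => f u - 3 * f (u - 1) + 3 * f (u - 2)) (fun u => f (u - 3))) => //.
apply: (@continuousD _ _ _ (fun u : R => f u - 3 * f (u - 1)) (fun u => 3 * f (u - 2))) => //.
by apply: (@continuousB _ _ _ (fun u : R => f u) (fun u => 3 * f (u - 1))) => //; exact: cf.
Qed.

(** The antiderivative of the quadratic B-spline: a C^2 transition from 0 (for
    [u <= 0]) to 1 (for [u >= 3]), with explicit derivatives. *)
Definition step u : R := diff3 (fun v => pos_part v ^+ 3) u / 6.
Definition step1 u : R := diff3 (fun v => pos_part v ^+ 2) u / 2.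
Definition step2 u : R := diff3 pos_part u.

Lemma is_derive_step u : is_derive u (1 : R) step (step1 u).
Proof.
have h := @is_derive_diff3 (fun v => pos_part v ^+ 3) (fun v => 3 * pos_part v ^+ 2) u is_derive_pos_part3.
rewrite (_ : step = (fun u => 6^-1 * diff3 (fun v => pos_part v ^+ 3) u)); last first.
  by apply/funext => v; rewrite /step mulrC.
apply: is_derive_eq (@is_deriveZ _ _ _ _ (6^-1) _ _ _ h) _.
by rewrite /GRing.scale /= /step1 /diff3; field.
Qed.

Lemma is_derive_step1 u : is_derive u (1 : R) step1 (step2 u).
Proof.
have h := @is_derive_diff3 (fun v => pos_part v ^+ 2) (fun v => 2 * pos_part v) u is_derive_pos_part2.
rewrite (_ : step1 = (fun u => 2^-1 * diff3 (fun v => pos_part v ^+ 2) u)); last first.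
  by apply/funext => v; rewrite /step1 mulrC.
apply: is_derive_eq (@is_deriveZ _ _ _ _ (2^-1) _ _ _ h) _.
by rewrite /GRing.scale /= /step2 /diff3; field.
Qed.

Lemma step2_cont : continuous step2. Proof. exact: diff3_cont pos_part_cont. Qed.

Lemma step_le0 u : u <= 0 -> [/\ step u = 0, step1 u = 0 & step2 u = 0].
Proof.
move=> u0; rewrite /step /step1 /step2 /diff3 !pos_part_le0E; try lra.
by rewrite !expr0n /= !mulr0 !subr0 !add0r !mul0r.
Qed.

Lemma step_ge3 u : 3 <= u -> [/\ step u = 1, step1 u = 0 & step2 u = 0].
Proof.
move=> u3; rewrite /step /step1 /step2 /diff3 !pos_part_ge0E; try lra.
by split; field.
Qed.

Lemma pos_part_bound u : 0 <= u <= 3 -> 0 <= pos_part u <= 3.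
Proof. by move=> /andP[u0 u3]; rewrite pos_part_ge0E// u0. Qed.

Lemma pos_part_shift_bound u c : 0 <= c -> 0 <= u <= 3 -> 0 <= pos_part (u - c) <= 3.
Proof.
move=> c0 /andP[u0 u3]; have [h|/ltW h] := leP 0 (u - c).
  by rewrite pos_part_ge0E//; lra.
by rewrite pos_part_le0E//; lra.
Qed.

Lemma step_bounds u : `|step1 u| <= 36 /\ `|step2 u| <= 12.
Proof.
have [u0|/ltW u0] := leP u 0.
  by have [_ -> ->] := step_le0 u0; rewrite normr0 !ler0n.
have [u3|/ltW u3] := leP 3 u.
  by have [_ -> ->] := step_ge3 u3; rewrite normr0 !ler0n.
have u03 : 0 <= u <= 3 by rewrite u0.
have b0 := pos_part_bound u03.
have b1 := @pos_part_shift_bound u 1 ler01 u03.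
have b2 := @pos_part_shift_bound u 2 (ler0n _ 2) u03.
have b3 := @pos_part_shift_bound u 3 (ler0n _ 3) u03.
rewrite /step1 /step2 /diff3; move: b0 b1 b2 b3.
move: (pos_part u) (pos_part (u - 1)) (pos_part (u - 2)) (pos_part (u - 3)) => a b c d.
clear; move=> b0 b1 b2 b3.
have sq9 v : 0 <= v <= 3 -> 0 <= v ^+ 2 <= 9.
  move=> /andP[v0 v3]; rewrite sqr_ge0 /=.
  have : v ^+ 2 <= 3 ^+ 2 by rewrite lerXn2r ?nnegrE.
  by clear; lra.
have := sq9 _ b0; have := sq9 _ b1; have := sq9 _ b2; have := sq9 _ b3.
move: (a ^+ 2) (b ^+ 2) (c ^+ 2) (d ^+ 2) => a2 b2' c2 d2.
by move=> *; rewrite !ler_norml; split; lra.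
Qed.

End Splines.

Section Cutoff.
Context (R : realType) (dl : R).
Hypotheses (dl0 : 0 < dl) (dl1 : dl <= 1).

(** In terms of the squared radius [s]: a transition from 0 to 1 on
    [[dl, 4 dl]], then from 1 to 0 on [[64, 79]]. *)
Definition annular_cut (s : R) : R := step (dl^-1 * s + -1) - step (5^-1 * s + - (64 / 5)).
Definition annular_cut1 (s : R) : R := step1 (dl^-1 * s + -1) * dl^-1 - step1 (5^-1 * s + - (64 / 5)) * 5^-1.
Definition annular_cut2 (s : R) : R :=
  step2 (dl^-1 * s + -1) * dl^-1 * dl^-1 - step2 (5^-1 * s + - (64 / 5)) * 5^-1 * 5^-1.

Lemma is_derive_annular_cut (s : R) : is_derive s (1 : R) annular_cut (annular_cut1 s).
Proof.
have h1 := @is_derive_affine R (@step R) dl^-1 (-1) s _ (is_derive_step _).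
have h2 := @is_derive_affine R (@step R) 5^-1 (- (64 / 5)) s _ (is_derive_step _).
exact: is_deriveB h1 h2.
Qed.

Lemma is_derive_annular_cut1 (s : R) : is_derive s (1 : R) annular_cut1 (annular_cut2 s).
Proof.
have h (al be : R) : is_derive s (1 : R) (fun s => step1 (al * s + be) * al) (step2 (al * s + be) * al * al).
  have h1 := @is_derive_affine R (@step1 R) al be s _ (is_derive_step1 _).
  rewrite (_ : (fun s => _) = (fun s => al * step1 (al * s + be))); last first.
    by apply/funext => v; rewrite mulrC.
  by apply: is_derive_eq (@is_deriveZ _ _ _ _ al _ _ _ h1) _; rewrite /GRing.scale /= mulrC.
exact: is_deriveB (h dl^-1 (-1)) (h 5^-1 (- (64 / 5))).
Qed.

Lemma annular_cut2_cont : continuous annular_cut2.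
Proof.
move=> s.
have h (al be : R) : {for s, continuous (fun s => step2 (al * s + be) * al * al)}.
  apply: (@continuousM _ _ (fun s => step2 (al * s + be) * al) (fun=> al)); last exact: cst_continuous.
  apply: (@continuousM _ _ (fun s => step2 (al * s + be)) (fun=> al)); last exact: cst_continuous.
  apply: (@continuous_comp _ _ _ (fun s : R => al * s + be) (@step2 R)); last exact: step2_cont.
  apply: (@continuousD _ _ _ (fun s : R => al * s) (fun=> be)); last exact: cst_continuous.
  by apply: (@continuousM _ _ (fun=> al) (fun s : R => s)); [exact: cst_continuous|exact: cvg_id].
exact: (@continuousB _ _ _ (fun s => step2 (dl^-1 * s + -1) * dl^-1 * dl^-1)
  (fun s => step2 (5^-1 * s + - (64 / 5)) * 5^-1 * 5^-1)).
Qed.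

Let inner_le0 (s : R) : s <= dl -> dl^-1 * s + -1 <= 0.
Proof. by move=> h; rewrite subr_le0 mulrC ler_pdivrMr// mul1r. Qed.
Let inner_ge3 (s : R) : 4 * dl <= s -> 3 <= dl^-1 * s + -1.
Proof.
move=> h; have : 4 <= dl^-1 * s by rewrite mulrC ler_pdivlMr.
by lra.
Qed.

Lemma annular_cut_off (s : R) : ~ (dl <= s <= 79) -> [/\ annular_cut s = 0, annular_cut1 s = 0 & annular_cut2 s = 0].
Proof.
move=> /negP; rewrite negb_and -!ltNge => /orP[/ltW sd|/ltW s79].
  have h2 : 5^-1 * s + - (64 / 5) <= 0 by have d1 := dl1; lra.
  have [a1 a2 a3] := step_le0 (inner_le0 sd); have [b1 b2 b3] := step_le0 h2.
  by rewrite /annular_cut /annular_cut1 /annular_cut2 a1 a2 a3 b1 b2 b3 !mul0r subrr.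
have h1 : 4 * dl <= s by have d1 := dl1; lra.
have h2 : 3 <= 5^-1 * s + - (64 / 5) by have d1 := dl1; lra.
have [a1 a2 a3] := step_ge3 (inner_ge3 h1); have [b1 b2 b3] := step_ge3 h2.
by rewrite /annular_cut /annular_cut1 /annular_cut2 a1 a2 a3 b1 b2 b3 !mul0r !subrr.
Qed.

Lemma annular_cut_mid (s : R) : 4 * dl <= s <= 64 -> [/\ annular_cut s = 1, annular_cut1 s = 0 & annular_cut2 s = 0].
Proof.
move=> /andP[h1 s64].
have h2 : 5^-1 * s + - (64 / 5) <= 0 by lra.
have [a1 a2 a3] := step_ge3 (inner_ge3 h1); have [b1 b2 b3] := step_le0 h2.
by rewrite /annular_cut /annular_cut1 /annular_cut2 a1 a2 a3 b1 b2 b3 !mul0r !subr0.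
Qed.

(** Dilation invariance: in the inner transition both products are functions
    of [v = s / dl], which is at most 4 there, so the bound does not
    depend on [dl]. *)
Lemma annular_cut_bounds (s : R) : 0 < s -> (s * annular_cut1 s) ^+ 2 + (s ^+ 2 * annular_cut2 s) ^+ 2 <= 2 * (40 * 100) ^+ 2.
Proof.
move=> s0.
have [|/negP/annular_cut_off[_ -> ->]] := boolP (dl <= s <= 79); last first.
  by rewrite !mulr0 expr0n addr0 mulr_ge0// sqr_ge0.
move=> /andP[sd s79].
pose v := dl^-1 * s.
have v0 : 0 <= v by rewrite mulr_ge0// ?invr_ge0 ltW.
have vE : dl^-1 * s = v by [].
move: v v0 vE => v v0 vE.
have [B1 B2] := step_bounds (5^-1 * s + - (64 / 5)).
have [I1 I2] : `|v * step1 (v + -1)| <= 144 /\ `|v ^+ 2 * step2 (v + -1)| <= 192.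
  have [v4|/ltW v4] := leP 4 v.
    have h : 3 <= v + -1 by lra.
    by have [_ -> ->] := step_ge3 h; rewrite !mulr0 normr0 !ler0n.
  have [b1 b2] := step_bounds (v + -1).
  have v16 : v ^+ 2 <= 16.
    have : v ^+ 2 <= 4 ^+ 2 by rewrite lerXn2r ?nnegrE.
    by lra.
  split; rewrite normrM ?(ger0_norm v0) ?(ger0_norm (sqr_ge0 v)).
    by apply: le_trans (ler_pM v0 (normr_ge0 _) v4 b1) _; rewrite -natrM.
  by apply: le_trans (ler_pM (sqr_ge0 v) (normr_ge0 _) v16 b2) _; rewrite -natrM.
have O1 : `|s / 5 * step1 (5^-1 * s + - (64 / 5))| <= 16 * 36.
  rewrite normrM ger0_norm; last by lra.
  by apply: ler_pM => //; lra.
have O2 : `|(s / 5) ^+ 2 * step2 (5^-1 * s + - (64 / 5))| <= 16 ^+ 2 * 12.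
  rewrite normrM (ger0_norm (sqr_ge0 _)).
  by apply: ler_pM => //; [exact: sqr_ge0|rewrite lerXn2r ?nnegrE//; lra].
have H1 : `|s * annular_cut1 s| <= 40 * 100.
  rewrite (_ : s * annular_cut1 s = v * step1 (v + -1) - s / 5 * step1 (5^-1 * s + - (64 / 5))); last first.
    by rewrite /annular_cut1 vE -vE; ring.
  apply: le_trans (ler_normB _ _) _; apply: le_trans (lerD I1 O1) _.
  by lra.
have H2 : `|s ^+ 2 * annular_cut2 s| <= 40 * 100.
  rewrite (_ : s ^+ 2 * annular_cut2 s = v ^+ 2 * step2 (v + -1)
      - (s / 5) ^+ 2 * step2 (5^-1 * s + - (64 / 5))); last first.
    by rewrite /annular_cut2 vE -vE; ring.
  apply: le_trans (ler_normB _ _) _; apply: le_trans (lerD I2 O2) _.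
  by lra.
have sqb (x : R) : `|x| <= 40 * 100 -> x ^+ 2 <= (40 * 100) ^+ 2.
  by move=> h; rewrite -real_normK ?num_real// lerXn2r// nnegrE mulr_ge0.
by rewrite mulr_natl mulr2n; apply: lerD; exact: sqb.
Qed.

End Cutoff.

(** * Mollification on a lattice *)

Section Bump.
Context (R : realType).
Implicit Types (u t : R).

(** The cubic B-spline, supported in [[0, 4]]; as a difference of two steps its
    integer translates telescope to a partition of unity. *)
Definition bump u : R := step u - step (u - 1).
Definition bump1 u : R := step1 u - step1 (u - 1).

Lemma step_bound u : `|step u| <= 36.
Proof.
have [u0|/ltW u0] := leP u 0; first by have [-> _ _] := step_le0 u0; rewrite normr0.
have [u3|/ltW u3] := leP 3 u.
  by have [-> _ _] := step_ge3 u3; rewrite normr1 ler1n.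
have u03 : 0 <= u <= 3 by rewrite u0.
have b0 := pos_part_bound u03.
have b1 := @pos_part_shift_bound _ u 1 ler01 u03.
have b2 := @pos_part_shift_bound _ u 2 (ler0n _ 2) u03.
have b3 := @pos_part_shift_bound _ u 3 (ler0n _ 3) u03.
rewrite /step /diff3; move: b0 b1 b2 b3.
move: (pos_part u) (pos_part (u - 1)) (pos_part (u - 2)) (pos_part (u - 3)) => a b c d.
clear; move=> b0 b1 b2 b3.
have c27 (v : R) : 0 <= v <= 3 -> 0 <= v ^+ 3 <= 27.
  move=> /andP[v0 v3]; rewrite exprn_ge0//=.
  have : v ^+ 3 <= 3 ^+ 3 by rewrite lerXn2r ?nnegrE.
  by clear; lra.
have := c27 _ b0; have := c27 _ b1; have := c27 _ b2; have := c27 _ b3.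
move: (a ^+ 3) (b ^+ 3) (c ^+ 3) (d ^+ 3) => a2 b2' c2 d2.
by move=> *; rewrite ler_norml; lra.
Qed.

Lemma bump_bound u : `|bump u| <= 72 /\ `|bump1 u| <= 72.
Proof.
split; apply: le_trans (ler_normB _ _) _.
  by apply: le_trans (lerD (step_bound _) (step_bound _)) _; rewrite -natrD.
have [h _] := step_bounds u; have [h' _] := step_bounds (u - 1).
by apply: le_trans (lerD h h') _; rewrite -natrD.
Qed.

Lemma bump_off u : ~~ (0 <= u <= 4) -> bump u = 0 /\ bump1 u = 0.
Proof.
rewrite negb_and -!ltNge => /orP[u0|u4]; rewrite /bump /bump1.
  have h : u - 1 <= 0 by lra.
  by have [-> -> _] := step_le0 (ltW u0); have [-> -> _] := step_le0 h; rewrite subrr.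
have h : 3 <= u - 1 by lra.
have h' : 3 <= u by lra.
by have [-> -> _] := step_ge3 h; have [-> -> _] := step_ge3 h'; rewrite !subrr.
Qed.

Lemma is_derive_bump u : is_derive u (1 : R) bump (bump1 u).
Proof.
have h := @is_derive_affine R (@step R) 1 (-1) u _ (is_derive_step _).
have e : (fun u : R => step (1 * u + -1)) = (fun u => step (u - 1)).
  by apply/funext => v; rewrite mul1r.
rewrite e mul1r mulr1 in h.
exact: is_deriveB (is_derive_step u) h.
Qed.

Lemma bump1_cont : continuous bump1.
Proof.
have c1 : continuous (@step1 R) by move=> u; exact: is_derive_cont (is_derive_step1 u).
move=> u; apply: (@continuousB _ _ _ (@step1 R) (fun u => step1 (u - 1))); first exact: c1.
apply: (@continuous_comp _ _ _ (fun u : R => u - 1) (@step1 R)); last exact: c1.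
by apply: (@continuousB _ _ _ (fun u : R => u) (fun=> 1)); [exact: cvg_id|exact: cst_continuous].
Qed.

Lemma sum_shift (f : R -> R) t (m : nat) :
  \sum_(j < m) (f (t - j%:R) - f (t - j%:R - 1)) = f t - f (t - m%:R).
Proof.
elim: m => [|m IH]; first by rewrite big_ord0 subr0 subrr.
rewrite big_ord_recr /= IH (_ : t - m.+1%:R = t - m%:R - 1); last first.
  by rewrite -natr1 opprD addrA.
by ring.
Qed.

Lemma sum_bump t (m : nat) : 3 <= t -> t <= m%:R ->
  \sum_(j < m) bump (t - j%:R) = 1 /\ \sum_(j < m) bump1 (t - j%:R) = 0.
Proof.
move=> t3 tm; rewrite !sum_shift.
have [-> -> _] := step_ge3 t3.
have h : t - m%:R <= 0 by rewrite subr_le0.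
by have [-> -> _] := step_le0 h; rewrite !subr0.
Qed.

(** A point lies in the support of at most five translates.  Instead of counting
    them, [|F|] is dominated by the difference of a nondecreasing function [H] and its
    translate by 5, and the sum telescopes. *)
Lemma sum_support (F : R -> R) (c t : R) (m : nat) : 0 <= c ->
  (forall u, `|F u| <= c) -> (forall u, ~~ (0 <= u <= 4) -> F u = 0) ->
  \sum_(j < m) `|F (t - j%:R)| <= 5 * c.
Proof.
move=> c0 Fc F0.
pose H (u : R) : R := if 0 <= u then c else 0.
have H0 u : 0 <= H u <= c by rewrite /H; case: ifP; rewrite ?lexx c0.
pose G u := H u + H (u - 1) + H (u - 2) + H (u - 3) + H (u - 4).
have FG u : `|F u| <= G u - G (u - 1).
  have -> : G u - G (u - 1) = H u - H (u - 5).
    rewrite /G.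
    have -> : u - 1 - 1 = u - 2 by ring.
    have -> : u - 1 - 2 = u - 3 by ring.
    have -> : u - 1 - 3 = u - 4 by ring.
    have -> : u - 1 - 4 = u - 5 by ring.
    by ring.
  have [/andP[u0 u4]|h] := boolP (0 <= u <= 4).
    rewrite /H u0; have -> : 0 <= u - 5 = false by apply/negbTE; rewrite -ltNge; lra.
    by rewrite subr0.
  rewrite (F0 _ h) normr0 subr_ge0 /H.
  case: (leP 0 (u - 5)) => [u5|_].
    by have -> : 0 <= u by lra.
  by case: ifP.
apply: le_trans (ler_sum _ (fun j _ => FG _)) _.
rewrite sum_shift /G.
have := H0 t; have := H0 (t - 1); have := H0 (t - 2); have := H0 (t - 3); have := H0 (t - 4).
move: (t - m%:R) => v.
have := H0 v; have := H0 (v - 1); have := H0 (v - 2); have := H0 (v - 3); have := H0 (v - 4).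
move: (H v) (H (v - 1)) (H (v - 2)) (H (v - 3)) (H (v - 4)) => v0 v1 v2 v3 v4.
move: (H t) (H (t - 1)) (H (t - 2)) (H (t - 3)) (H (t - 4)) => t0 t1 t2 t3 t4.
clear; move=> *; lra.
Qed.

End Bump.

Section ProductFun.
Context (R : realType) (n : nat).
Variables (f f1 : 'I_n -> R -> R).
Hypothesis f'E : forall k u, is_derive u (1 : R) (f k) (f1 k u).
Hypothesis cf1 : forall k, continuous (f1 k).

Lemma cont_prod (I : Type) (r : seq I) (F : I -> 'rV[R]_n -> R) x :
  (forall i, {for x, continuous (F i)}) ->
  {for x, continuous (fun x => \prod_(i <- r) F i x)}.
Proof.
move=> h; elim: r => [|k r IH].
  rewrite (_ : (fun x => _) = cst 1); first exact: cst_continuous.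
  by apply/funext => y; rewrite big_nil.
rewrite (_ : (fun x => _) = fun x => F k x * \prod_(i <- r) F i x).
  exact: contM.
by apply/funext => y; rewrite big_cons.
Qed.

Definition prod_fun (x : 'rV[R]_n) : R := \prod_k f k (x ord0 k).
Definition dprod_fun i (x : 'rV[R]_n) : R :=
  \prod_k (if k == i then f1 k (x ord0 k) else f k (x ord0 k)).

Lemma is_derive_prod_fun i x :
  is_derive x (delta_mx ord0 i) prod_fun (dprod_fun i x).
Proof.
apply: is_derive_of_slice.
rewrite (_ : (fun t => _) =
   (fun t => (\prod_(k | k != i) f k (x ord0 k)) * f i (1 * t + x ord0 i))); last first.
  apply/funext => t; rewrite /prod_fun (bigD1 i)//= mulrC; congr (_ * f i _); last first.
    by rewrite !mxE !eqxx mulr1 mul1r addrC.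
  by apply: eq_bigr => k /negbTE ki; rewrite !mxE ki andbF mulr0 addr0.
have h := @is_derive_affine R (f i) 1 (x ord0 i) 0 _ (f'E _ _).
apply: is_derive_eq (@is_deriveZ _ _ _ _ (\prod_(k | k != i) f k (x ord0 k)) _ _ _ h) _.
rewrite /GRing.scale /= mulr1 mulr0 add0r /dprod_fun [RHS](bigD1 i)//= eqxx mulrC.
by congr (_ * _); apply: eq_bigr => k /negbTE ->.
Qed.

Lemma cont_coord_comp (q : R -> R) (x : 'rV[R]_n) k : continuous q ->
  {for x, continuous (fun x : 'rV[R]_n => q (x ord0 k))}.
Proof.
move=> cq; apply: (@continuous_comp _ _ _ (fun x : 'rV[R]_n => x ord0 k) q).
  exact: coord_continuous.
exact: cq.
Qed.

Let cf k : continuous (f k).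
Proof. by move=> u; exact: is_derive_cont (f'E k u). Qed.

Lemma C1_prod_fun : C1 setT prod_fun.
Proof.
apply: (C1_of (df := dprod_fun)).
- exact: openT.
- move=> x _; apply: (cont_prod _ (F := fun k x => f k (x ord0 k))) => k.
  exact: cont_coord_comp.
- by move=> x i _; exact: is_derive_prod_fun.
- move=> x i _; apply: (cont_prod _ (F := fun k x => if k == i then f1 k (x ord0 k) else f k (x ord0 k))) => k.
  by case: (k == i); exact: cont_coord_comp.
Qed.

Lemma partial_prod_fun i x : partial i prod_fun x = dprod_fun i x.
Proof. exact: is_derive_partial (is_derive_prod_fun i x). Qed.

End ProductFun.

Section Mollifier.
Context (R : realType) (n : nat).

(** [W] is the average of the values of [V] on the lattice of mesh [eps], with
    weights given by a partition of unity made of products of B-splines.  Since the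
    weights add up to 1 and their derivatives to 0, both [W - V x] and the
    derivatives of [W] at [x] are sums of terms containing [V y - V x] with
    lattice points [y] close to [x].  In each coordinate at most five weights are
    nonzero, each at most 72, which gives [360 = 5 * 72].  The same sum yields the
    closeness and, at the cost of a factor [1 / eps], the gradient bound. *)
Theorem mollifier (V : 'rV[R]_n -> R) (eps : R) : 0 < eps -> eps <= 1 / 3 ->
  exists2 W : 'rV[R]_n -> R, C1 setT W &
    forall (x : 'rV[R]_n) (om : R), (forall i, `|x ord0 i| <= 10) ->
    (forall y : 'rV[R]_n, (forall i, `|y ord0 i - x ord0 i| <= 4 * eps) ->
       `|V y - V x| <= om) ->
    `|W x - V x| <= om * 360 ^+ n /\
    (forall i, `|partial i W x| <= om * 360 ^+ n / eps).
Proof.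
move=> e0 e3.
have [m hm] : exists m : nat, 21 / eps <= m%:R.
  by exists (Num.truncn (21 / eps)).+1; apply: ltW; exact: truncnS_gt.
pose tt (u : R) : R := eps^-1 * u + 11 / eps.
(* The lattice starts at -11, one unit outside the cube [-10, 10]^n, so that
   tt u >= 1 / eps >= 3 there and sum_bump applies. *)
pose gr (phi : {ffun 'I_n -> 'I_m}) : 'rV[R]_n := \row_i (eps * (phi i)%:R - 11).
pose f (phi : {ffun 'I_n -> 'I_m}) (k : 'I_n) (u : R) : R := bump (tt u - (phi k)%:R).
pose f1 (phi : {ffun 'I_n -> 'I_m}) (k : 'I_n) (u : R) : R := bump1 (tt u - (phi k)%:R) / eps.
have aff (c u : R) : eps^-1 * u + (11 / eps - c) = tt u - c by rewrite /tt addrA.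
have f'E phi k u : is_derive u (1 : R) (f phi k) (f1 phi k u).
  have h := @is_derive_affine R (@bump R) eps^-1 (11 / eps - (phi k)%:R) u _ (is_derive_bump _).
  have E : f phi k = (fun u => bump (eps^-1 * u + (11 / eps - (phi k)%:R))).
    by apply/funext => v; rewrite aff.
  by rewrite E; apply: (is_derive_eq h); rewrite aff.
have cf1 phi k : continuous (f1 phi k).
  move=> u; apply: (@continuousM _ _ (fun u => bump1 (tt u - (phi k)%:R)) (fun=> eps^-1)); last first.
    exact: cst_continuous.
  apply: (@continuous_comp _ _ _ (fun u : R => tt u - (phi k)%:R) (@bump1 R)); last exact: bump1_cont.
  apply: (@continuousB _ _ _ (fun u : R => tt u) (fun=> (phi k)%:R)); last exact: cst_continuous.
  apply: (@continuousD _ _ _ (fun u : R => eps^-1 * u) (fun=> 11 / eps)); last exact: cst_continuous.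
  by apply: (@continuousM _ _ (fun=> eps^-1) (fun u : R => u)); [exact: cst_continuous|exact: cvg_id].
pose W x := \sum_(phi : {ffun 'I_n -> 'I_m}) V (gr phi) * prod_fun (f phi) x.
have oT := @openT 'rV[R]_n.
have hP phi : C1 setT (prod_fun (f phi)) by exact: C1_prod_fun (f'E phi) (cf1 phi).
have hVP phi : C1 setT (fun x => V (gr phi) * prod_fun (f phi) x) by exact: (C1Z _ oT (hP phi)).
exists W; first exact: (C1_sum _ oT hVP).
move=> x om x10 Vom.
have om0 : 0 <= om.
  have h : `|V x - V x| <= om.
    by apply: Vom => i; rewrite subrr normr0 mulr_ge0// ltW.
  exact: le_trans (normr_ge0 _) h.
pose tx k := tt (x ord0 k).
have tx3 k : 3 <= tx k <= m%:R.
  have := x10 k; rewrite ler_norml => /andP[h1 h2].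
  have E : tx k = (x ord0 k + 11) / eps by rewrite /tx /tt; field; rewrite gt_eqF.
  apply/andP; split.
    rewrite E ler_pdivlMr//; lra.
  apply: (@le_trans _ _ (21 / eps)); last exact: hm.
  by rewrite E ler_pM2r ?invr_gt0//; lra.
have near_gr (phi : {ffun 'I_n -> 'I_m}) : (forall k, 0 <= tx k - (phi k)%:R <= 4) ->
    `|V (gr phi) - V x| <= om.
  move=> h; apply: Vom => i; rewrite mxE.
  have -> : eps * (phi i)%:R - 11 - x ord0 i = - (eps * (tx i - (phi i)%:R)).
    by rewrite /tx /tt; field; rewrite gt_eqF.
  have /andP[h1 h2] := h i.
  rewrite normrN normrM (gtr0_norm e0) (ger0_norm h1) mulrC.
  by rewrite ler_wpM2r// ltW.
(* Sums over the lattice of products factor into products of one-dimensional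
   sums (bigA_distr_bigA), each estimated by sum_support. *)
have key (F : 'I_n -> R -> R) (c : 'I_n -> R) : (forall k, 0 <= c k) ->
   (forall k u, `|F k u| <= c k) -> (forall k u, ~~ (0 <= u <= 4) -> F k u = 0) ->
   `|\sum_(phi : {ffun 'I_n -> 'I_m}) (V (gr phi) - V x) * \prod_k F k (tx k - (phi k)%:R)|
   <= om * \prod_k (5 * c k).
  move=> c0 Fc F0.
  apply: le_trans (ler_norm_sum _ _ _) _.
  apply: (@le_trans _ _ (\sum_(phi : {ffun 'I_n -> 'I_m})
      om * \prod_k `|F k (tx k - (phi k)%:R)|)).
    apply: ler_sum => phi _; rewrite normrM normr_prod.
    have [/forallP h|/forallPn[k hk]] := boolP [forall k, 0 <= tx k - (phi k)%:R <= 4].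
      by apply: ler_wpM2r; [apply: prodr_ge0 => k _; exact: normr_ge0|exact: near_gr].
    have -> : \prod_k `|F k (tx k - (phi k)%:R)| = 0.
      by rewrite (bigD1 k)//= F0// normr0 mul0r.
    by rewrite !mulr0.
  rewrite -mulr_sumr; apply: ler_wpM2l => //.
  rewrite -(bigA_distr_bigA (fun k (j : 'I_m) => `|F k (tx k - j%:R)|)).
  apply: ler_prod => k _; apply/andP; split.
    by apply: sumr_ge0 => j _; exact: normr_ge0.
  exact: (sum_support _ _ (c0 k) (Fc k) (F0 k)).
have one : \sum_(phi : {ffun 'I_n -> 'I_m}) prod_fun (f phi) x = 1.
  rewrite /prod_fun -(bigA_distr_bigA (fun k (j : 'I_m) => bump (tx k - j%:R))).
  apply: big1 => k _; have /andP[h1 h2] := tx3 k.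
  by have [] := sum_bump h1 h2.
have zero i : \sum_(phi : {ffun 'I_n -> 'I_m}) dprod_fun (f phi) (f1 phi) i x = 0.
  rewrite /dprod_fun -(bigA_distr_bigA (fun k (j : 'I_m) =>
    if k == i then bump1 (tx k - j%:R) / eps else bump (tx k - j%:R))).
  rewrite (bigD1 i)//= eqxx -mulr_suml.
  have /andP[h1 h2] := tx3 i.
  by have [_ ->] := sum_bump h1 h2; rewrite !mul0r.
have p360 : \prod_(k < n) (5 * 72) = 360 ^+ n :> R.
  by rewrite prodr_const card_ord -natrM.
split.
  have -> : W x - V x = \sum_(phi : {ffun 'I_n -> 'I_m}) (V (gr phi) - V x) * \prod_k bump (tx k - (phi k)%:R).
    under eq_bigr do rewrite mulrBl; rewrite sumrB -mulr_sumr.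
    by rewrite -[X in V x * X]/(\sum_(phi : {ffun 'I_n -> 'I_m}) prod_fun (f phi) x) one mulr1.
  rewrite -p360; apply: (key (fun _ => @bump R) (fun=> 72)) => //.
    by move=> _ u; have [] := bump_bound u.
  by move=> _ u /bump_off[].
move=> i.
have -> : partial i W x = \sum_(phi : {ffun 'I_n -> 'I_m}) (V (gr phi) - V x) *
    \prod_k (if k == i then bump1 (tx k - (phi k)%:R) / eps else bump (tx k - (phi k)%:R)).
  have z := zero i.
  rewrite (partial_sum _ i oT hVP)//.
  under eq_bigr do rewrite (partialZ _ _ (hP _))// (partial_prod_fun (f'E _)).
  under [RHS]eq_bigr do rewrite mulrBl; rewrite sumrB -mulr_sumr.
  rewrite -[X in _ - V x * X]/(\sum_(phi : {ffun 'I_n -> 'I_m}) dprod_fun (f phi) (f1 phi) i x).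
  by rewrite z mulr0 subr0.
pose c k := if k == i then 72 / eps else 72.
have c0 k : 0 <= c k by rewrite /c; case: ifP => _ //; rewrite divr_ge0// ltW.
have := key (fun k u => if k == i then bump1 u / eps else bump u) c c0.
move=> /(_ _ _)/le_trans; apply.
- move=> k u; rewrite /c; case: ifP => _; last by have [] := bump_bound u.
  rewrite normrM [`|eps^-1|]gtr0_norm ?invr_gt0// ler_pM2r ?invr_gt0//.
  by have [] := bump_bound u.
- by move=> k u /bump_off[h1 h2]; rewrite h1 h2 mul0r; case: ifP.
rewrite -mulrA; apply: ler_wpM2l => //.
rewrite -p360 (bigD1 i)//= /c eqxx [in leRHS](bigD1 i)//=.
rewrite le_eqVlt; apply/orP; left; apply/eqP.
rewrite (eq_bigr (fun=> 5 * 72)) => [|k /negbTE -> //].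
by move: (\prod_(_ | _) _) => q; field; rewrite gt_eqF.
Qed.

End Mollifier.

(** * Euclidean balls, L^p norms and L^2 mass *)

Section Geometry.
Context (R : realType) (n : nat).
Implicit Types (x y p : 'rV[R]_n).
Notation mu := (lebesgue_rV R n).

Definition cube p (r : R) : set 'rV[R]_n :=
  [set x : 'rV[R]_n | forall i, x ord0 i \in `]p ord0 i - r, p ord0 i + r[].

Lemma cubeE p r : 0 <= r -> mu (cube p r) = ((2 * r) ^+ n)%:E.
Proof.
move=> r0; rewrite (@lebesgue_rV_box R n (fun i => p ord0 i - r) (fun i => p ord0 i + r)).
  rewrite (eq_bigr (fun=> 2 * r)) => [|i _]; last by ring.
  by rewrite prodr_const card_ord.
by move=> i; rewrite lerD2l ge0_cp.
Qed.

Lemma cube_ball p r : 0 < r -> cube p r = ball p r.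
Proof.
move=> r0; apply/seteqP; split=> x /= h.
  split=> // i j; rewrite ord1 /ball /=; have := h j; rewrite in_itv /= => /andP[h1 h2].
  by rewrite distrC ltr_distl h1 h2.
move=> i; case: h => _ /(_ ord0 i); rewrite /ball /= distrC ltr_distl in_itv /=.
by [].
Qed.

Lemma enorm_sq x p : enorm (x - p) = Num.sqrt (sq p x).
Proof. by rewrite /enorm /sq /crd; congr Num.sqrt; apply: eq_bigr => i _; rewrite !mxE. Qed.

Lemma eballE p r : 0 < r -> eball p r = [set x | sq p x < r ^+ 2].
Proof.
move=> r0; apply/seteqP; split=> x /=; rewrite /eball /= enorm_sq => h.
  rewrite -(sqr_sqrtr (sq_ge0 p x)) ltr_sqr ?nnegrE ?sqrtr_ge0//.
  exact: ltW.
by rewrite -(ger0_norm (ltW r0)) -sqrtr_sqr ltr_sqrt// exprn_gt0.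
Qed.

Lemma sq_continuous p : continuous (sq p).
Proof. by move=> x; exact: (C1_cont (C1_sq p (@openT _))). Qed.

Lemma eball_open p r : 0 < r -> open (eball p r).
Proof.
move=> r0; rewrite eballE//.
have -> : [set x | sq p x < r ^+ 2] = sq p @^-1` [set s | s < r ^+ 2] by [].
by apply: open_comp; [move=> x _; exact: sq_continuous|exact: open_lt].
Qed.

Lemma eball_measurable p r : 0 < r -> measurable (eball p r).
Proof. by move=> r0; apply: open_measurable_rV; exact: eball_open. Qed.

Lemma crd_le_sq p x i : crd p i x ^+ 2 <= sq p x.
Proof.
rewrite /sq (bigD1 i)//= lerDl; apply: sumr_ge0 => j _; exact: sqr_ge0.
Qed.

Lemma crd_sq_bound p x r i : 0 <= r -> sq p x <= r ^+ 2 -> `|x ord0 i - p ord0 i| <= r.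
Proof.
move=> r0 h; rewrite -(ler_sqr (x := `|_|)) ?nnegrE//.
rewrite real_normK ?num_real//; exact: le_trans (crd_le_sq p x i) h.
Qed.

Lemma eball_cube p r : 0 < r -> eball p r `<=` cube p r.
Proof.
move=> r0; rewrite eballE// => x /= h i; rewrite in_itv /= -ltr_distl distrC.
rewrite -(ltr_sqr (x := `|_|)) ?nnegrE//; last exact: ltW.
rewrite real_normK ?num_real// -opprB sqrrN; apply: le_lt_trans h; exact: crd_le_sq.
Qed.

Lemma eball_lty p r : 0 < r -> (mu (eball p r) <= ((2 * r) ^+ n)%:E)%E.
Proof.
move=> r0; rewrite -(cubeE p (ltW r0)); apply: le_measure; rewrite ?inE.
- exact: eball_measurable.
- by rewrite cube_ball//; apply: open_measurable_rV; exact: ball_open.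
- exact: eball_cube.
Qed.

Lemma open_gt0 (D : set 'rV[R]_n) x : open D -> D x -> (0 < mu D)%E.
Proof.
move=> oD Dx; have /nbhs_ballP[e /= e0 eD] := open_nbhs_nbhs (conj oD Dx).
apply: (@lt_le_trans _ _ (mu (ball x e))).
  by rewrite -cube_ball// cubeE ?ltW// lte_fin exprn_gt0// mulr_gt0.
apply: le_measure; rewrite ?inE.
- by apply: open_measurable_rV; exact: ball_open.
- exact: open_measurable_rV.
- exact: eD.
Qed.

(** Nonempty open sets have positive measure; this turns essential bounds on
    continuous functions into pointwise ones ([ae_le_open]) and an essential
    bound on the potential into a bound at one point. *)
Lemma ae_open (D : set 'rV[R]_n) (P : 'rV[R]_n -> Prop) : open D -> D !=set0 ->
  {ae mu, forall x, P x} -> exists2 x, D x & P x.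
Proof.
move=> oD [x Dx] aeP; apply: contrapT => h.
have := open_gt0 oD Dx.
have -> : mu D = 0%E.
  apply: measure_negligible; first exact: open_measurable_rV.
  apply: negligibleS aeP => y Dy /= Py; apply: h; exists y => //.
by rewrite ltxx.
Qed.

Lemma ae_le_open (D : set 'rV[R]_n) (f : 'rV[R]_n -> R) (c : R) : open D ->
  (forall x, D x -> {for x, continuous f}) ->
  {ae mu, forall x, D x -> f x <= c} -> forall x, D x -> f x <= c.
Proof.
move=> oD cf aef x Dx; rewrite leNgt; apply/negP => fc.
have oE : open [set y | D y /\ c < f y].
  rewrite openE => y [Dy fy]; apply: filterI; first exact: open_nbhs_nbhs.
  by have := cf y Dy; move/cvgr_gt; apply.
have [y [Dy fy] /(_ Dy)] := ae_open oE (ex_intro _ x (conj Dx fc)) aef.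
by rewrite leNgt fy.
Qed.

End Geometry.

Section LpBridge.
Context (R : realType) (n : nat).
Notation mu := (lebesgue_rV R n).
Implicit Types (u : 'rV[R]_n -> R[i]) (D : set 'rV[R]_n).

Definition abs2 u (x : 'rV[R]_n) : R :=
  complex.Re (u x) ^+ 2 + complex.Im (u x) ^+ 2.

Lemma normcE u x : Normc.normc (u x) = Num.sqrt (abs2 u x).
Proof. by rewrite /abs2; case: (u x). Qed.

Lemma abs2_ge0 u x : 0 <= abs2 u x.
Proof. by rewrite addr_ge0 ?sqr_ge0. Qed.

Lemma normc_ge0 u x : 0 <= Normc.normc (u x).
Proof. by rewrite normcE sqrtr_ge0. Qed.

Lemma LpC_oo_ae D u (c : R) : (LpC +oo D u <= c%:E)%E ->
  {ae mu, forall x, D x -> Normc.normc (u x) <= c}.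
Proof.
rewrite /LpC unlock (open_gt0 (x := 0) (@openT _)) // => /ess_supP.
apply: filterS => x /= h Dx; move: h; rewrite patchE mem_set// lee_fin.
by rewrite /= ger0_norm// normc_ge0.
Qed.

Lemma cont_abs2 u x : {for x, continuous (@complex.Re R \o u)} ->
  {for x, continuous (@complex.Im R \o u)} -> {for x, continuous (abs2 u)}.
Proof. by move=> c1 c2; apply: contD; [exact: (contM c1 c1)|exact: (contM c2 c2)]. Qed.

Lemma LpC_oo_abs2 D u (c : R) : open D ->
  (forall x, D x -> {for x, continuous (abs2 u)}) ->
  (LpC +oo D u <= c%:E)%E -> forall x, D x -> abs2 u x <= c ^+ 2.
Proof.
move=> oD cu /LpC_oo_ae ae; apply: ae_le_open => //.
apply: filterS ae => x h Dx; have := h Dx; rewrite normcE => hc.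
rewrite -(sqr_sqrtr (abs2_ge0 u x)) lerXn2r ?nnegrE ?sqrtr_ge0//.
exact: le_trans (sqrtr_ge0 _) hc.
Qed.

(** The square of the L^2 norm over [D]. *)
Definition mass u D : R := \int[mu]_(x in D) abs2 u x.

Section Bounded.
Variables (B : set 'rV[R]_n) (u : 'rV[R]_n -> R[i]) (c : R).
Hypotheses (oB : open B) (fB : (mu B < +oo)%E).
Hypothesis cu : forall x, B x -> {for x, continuous (abs2 u)}.
Hypothesis bu : forall x, B x -> abs2 u x <= c.

Lemma abs2_integrable D : measurable D -> D `<=` B ->
  mu.-integrable D (EFin \o abs2 u).
Proof.
move=> mD DB.
have iB : mu.-integrable B (EFin \o abs2 u).
  apply: measurable_bounded_integrable => //.
  - exact: open_measurable_rV.
  - exact: measurable_cont.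
  - exists c; split; first exact: num_real.
    move=> y cy x Bx; apply: (@le_trans _ _ c); last exact: ltW.
    have -> : `|abs2 u x| = abs2 u x by rewrite ger0_norm ?abs2_ge0.
    exact: bu.
by apply: integrableS iB => //; exact: open_measurable_rV.
Qed.

Lemma mass_EFin D : measurable D -> D `<=` B ->
  (\int[mu]_(x in D) (abs2 u x)%:E = (mass u D)%:E)%E.
Proof.
move=> mD DB; rewrite /mass /Rintegral fineK//.
by apply: integrable_fin_num => //; exact: abs2_integrable.
Qed.

Lemma LpC2_mass D : measurable D -> D `<=` B ->
  (LpC 2%:E D u `^ 2 = (mass u D)%:E)%E.
Proof.
move=> mD DB; rewrite /LpC poweR_Lnorm// -mass_EFin// [RHS]integral_mkcond.
apply: eq_integral => x _ /=; rewrite !patchE; case: ifPn => _ /=.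
  congr EFin; rewrite ger0_norm ?normc_ge0// powR_mulrn ?normc_ge0// normcE sqr_sqrtr//.
  exact: abs2_ge0.
by rewrite normr0 powR0.
Qed.

Lemma mass_ge0 D : 0 <= mass u D.
Proof. by apply: Rintegral_ge0 => x _; exact: abs2_ge0. Qed.

Lemma LpC2_fin D : measurable D -> D `<=` B ->
  LpC 2%:E D u = (Num.sqrt (mass u D))%:E.
Proof.
move=> mD DB; have h := LpC2_mass mD DB.
have L0 : (0 <= LpC 2%:E D u)%E by exact: Lnorm_ge0.
have : (LpC 2%:E D u `^ 2 `^ 2^-1 = (mass u D)%:E `^ 2^-1)%E by rewrite h.
rewrite -poweRrM mulfV// poweRe1// => ->.
by rewrite poweR_EFin powR12_sqrt// mass_ge0.
Qed.

Lemma mass_le D (m : R) : measurable D -> D `<=` B -> 0 <= c -> (mu D <= m%:E)%E -> mass u D <= c * m.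
Proof.
move=> mD DB c0 Dm; rewrite -lee_fin -mass_EFin//.
apply: (@le_trans _ _ (\int[mu]_(x in D) (c%:E))%E).
  apply: ge0_le_integral => //.
  - by move=> x _; rewrite lee_fin abs2_ge0.
  - by have /integrableP[] := abs2_integrable mD DB.
  - by move=> x Dx; rewrite lee_fin bu//; exact: DB.
by rewrite integral_cst// EFinM lee_wpmul2l.
Qed.

Lemma mass_sub D E F : measurable D -> measurable E -> measurable F ->
  D `<=` B -> E `<=` B -> F `<=` B -> D `<=` E `|` F -> mass u D <= mass u E + mass u F.
Proof.
move=> mD mE mF DB EB FB DEF; rewrite -lee_fin EFinD -!mass_EFin//.
have N0 x : (0 <= (abs2 u x)%:E)%E by rewrite lee_fin abs2_ge0.
have mEF : measurable (E `|` F) by exact: measurableU.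
have EFB : E `|` F `<=` B by move=> x [/EB|/FB].
have mN D' : measurable D' -> D' `<=` B -> measurable_fun D' (fun x => (abs2 u x)%:E).
  by move=> h1 h2; have /integrableP[] := abs2_integrable h1 h2.
apply: (@le_trans _ _ (\int[mu]_(x in E `|` F) (abs2 u x)%:E)%E).
  by apply: ge0_subset_integral => //; exact: mN.
have -> : E `|` F = E `|` (F `\` E).
  apply/seteqP; split=> x; last by move=> [|[]]; [left|right].
  by have [Ex|Ex] := pselect (E x); [left|move=> [//|Fx]; right].
have mFE : measurable (F `\` E) by exact: measurableD.
rewrite ge0_integral_setU//.
- rewrite leeD2l//; apply: ge0_subset_integral => //; first exact: mN.
- apply: mN; first exact: measurableU.
  by move=> x [Ex|[Fx _]]; [exact: EB|exact: FB].
- by apply/disj_setPS => x [Ex [_]].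
Qed.

End Bounded.
End LpBridge.

Section MassBounds.
Context (R : realType) (n : nat).
Notation mu := (lebesgue_rV R n).
Variables (B : set 'rV[R]_n) (u : 'rV[R]_n -> R[i]) (c : R).
Hypotheses (oB : open B) (fB : (mu B < +oo)%E).
Hypothesis cu : forall x, B x -> {for x, continuous (abs2 u)}.
Hypothesis bu : forall x, B x -> abs2 u x <= c.

Lemma Rintegral_lower (F : 'rV[R]_n -> R) (E : set 'rV[R]_n) (e : R) :
  mu.-integrable setT (EFin \o F) -> (forall x, 0 <= F x) ->
  measurable E -> E `<=` B -> (forall x, E x -> e * abs2 u x <= F x) ->
  e * mass u E <= \int[mu]_x F x.
Proof.
move=> iF F0 mE EB EF.
have iE := abs2_integrable oB fB cu bu mE EB.
have iFE : mu.-integrable E (EFin \o F) by apply: integrableS iF.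
apply: (@le_trans _ _ (\int[mu]_(x in E) F x)).
  rewrite /mass -RintegralZl//; apply: le_Rintegral => //.
  by have := integrableZl mE e iE; apply: eq_integrable => // x _ /=; rewrite EFinM.
rewrite Rintegral_mkcond; apply: le_Rintegral => //.
  by rewrite -restrict_EFin; apply/(integrable_mkcond _ mE).
by move=> x _; rewrite patchE; case: ifP.
Qed.

Lemma Rintegral_upper (F : 'rV[R]_n -> R) (D1 D2 : set 'rV[R]_n) (c1 c2 : R) :
  mu.-integrable setT (EFin \o F) -> 0 <= c1 -> 0 <= c2 ->
  measurable D1 -> measurable D2 -> D1 `<=` B -> D2 `<=` B ->
  (forall x, D1 x -> F x <= c1 * abs2 u x) ->
  (forall x, D2 x -> F x <= c2 * abs2 u x) ->
  (forall x, ~ D1 x -> ~ D2 x -> F x = 0) ->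
  \int[mu]_x F x <= c1 * mass u D1 + c2 * mass u D2.
Proof.
move=> iF c10 c20 mD1 mD2 D1B D2B F1 F2 F0.
have iD D e : measurable D -> D `<=` B ->
    mu.-integrable setT (EFin \o (fun x => e * (abs2 u \_ D) x)).
  move=> mD DB; have iD := abs2_integrable oB fB cu bu mD DB.
  have : mu.-integrable setT ((EFin \o abs2 u) \_ D) by apply/(integrable_mkcond _ mD).
  rewrite restrict_EFin => /(integrableZl measurableT e).
  by apply: eq_integrable => // x _ /=; rewrite EFinM.
have iD0 D : measurable D -> D `<=` B -> mu.-integrable setT (EFin \o (abs2 u \_ D)).
  move=> mD DB; have := iD D 1 mD DB; apply: eq_integrable => // x _ /=.
  by rewrite mul1r.
rewrite /mass [X in c1 * X]Rintegral_mkcond [X in c2 * X]Rintegral_mkcond.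
rewrite -RintegralZl//; last exact: iD0.
rewrite -RintegralZl//; last exact: iD0.
rewrite -RintegralD//; [|exact: iD|exact: iD].
apply: le_Rintegral => //.
  have := integrableD measurableT (iD D1 c1 mD1 D1B) (iD D2 c2 mD2 D2B).
  by apply: eq_integrable.
move=> x _; rewrite !patchE.
have a0 := abs2_ge0 u x.
have [D1x|D1x] := pselect (D1 x).
  rewrite (mem_set D1x) (le_trans (F1 x D1x))// lerDl mulr_ge0//.
  by case: ifP.
rewrite (memNset D1x) mulr0 add0r.
have [D2x|D2x] := pselect (D2 x); first by rewrite (mem_set D2x) F2.
by rewrite (memNset D2x) mulr0 F0.
Qed.

End MassBounds.

Section Ball10.
Context (R : realType) (n : nat).
Implicit Types (x y p : 'rV[R]_n).

(** Young's inequality with weights [al] and [be]. *)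
Lemma sq_ineq (al be : R) x y : 0 <= al -> 0 <= be -> 1 <= al * be ->
  sq 0 x <= (1 + al) * sq y x + (1 + be) * sq 0 y.
Proof.
move=> al0 be0 ab; rewrite /sq !mulr_sumr -big_split /=; apply: ler_sum => i _.
rewrite /crd !mxE !subr0; move: (x ord0 i) (y ord0 i) => u v.
have [al00|aln] := eqVneq al 0; first by move: ab; rewrite al00 mul0r; lra.
have alp : 0 < al by rewrite lt_def aln.
have h : 0 <= al * (u - v - v / al) ^+ 2 by rewrite mulr_ge0// sqr_ge0.
have e : al * (u - v - v / al) ^+ 2 = al * (u - v) ^+ 2 - 2 * (u - v) * v + al^-1 * v ^+ 2.
  by field.
have h2 : al^-1 * v ^+ 2 <= be * v ^+ 2.
  by rewrite ler_wpM2r ?sqr_ge0// -[al^-1]mul1r ler_pdivrMr// mulrC.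
by move: h; rewrite e; nra.
Qed.

Lemma ball10E : eball 0 10 = [set x | sq 0 x < 100] :> set 'rV[R]_n.
Proof. by rewrite eballE// expr2 -natrM. Qed.

Variable p : 'rV[R]_n.
Hypothesis ph : eball 0 2^-1 p.

Let sqp : sq 0 p < 4^-1.
Proof.
move: ph; rewrite eballE ?invr_gt0//= => h.
by apply: lt_le_trans h _; rewrite exprVn expr2 -natrM.
Qed.

Lemma near_center_in_ball x : sq p x <= 81 -> sq 0 x <= 92.
Proof.
move=> h; have a0 : 0 <= 1 / 10 :> R by lra.
have b0 : 0 <= 10 :> R by lra.
have ab : 1 <= (1 / 10) * 10 :> R by lra.
by have := sq_ineq x p a0 b0 ab; move: sqp; lra.
Qed.

Lemma unit_ball_near_center x : sq 0 x < 1 -> sq p x < (3 / 2) ^+ 2.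
Proof.
move=> h.
have : sq p x <= (1 + 1 / 2) * sq 0 x + (1 + 2) * sq 0 p.
  rewrite /sq !mulr_sumr -big_split /=; apply: ler_sum => i _.
  rewrite /crd !mxE !subr0; move: (x ord0 i) (p ord0 i) => v w.
  rewrite -subr_ge0 (_ : _ - _ = 2^-1 * (v + 2 * w) ^+ 2); last by field.
  by rewrite mulr_ge0// ?invr_ge0// sqr_ge0.
by move: sqp; lra.
Qed.

Lemma perturb_in_ball x y (h : R) : sq p x <= 81 -> (0 < n)%N -> 0 <= h ->
  h * n%:R <= 1 / 10 -> (forall i, `|y ord0 i - x ord0 i| <= h) ->
  sq 0 y < 100 /\ enorm (y - x) <= h * n%:R.
Proof.
move=> hx n0 h0 hn yx.
have n1 : 1 <= n%:R :> R by rewrite ler1n.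
have d : sq x y <= n%:R * h ^+ 2.
  apply: (@le_trans _ _ (\sum_(i < n) h ^+ 2)).
    apply: ler_sum => i _; rewrite /crd -real_normK ?num_real//.
    by rewrite lerXn2r// ?nnegrE//; exact: yx.
  by rewrite sumr_const card_ord mulr_natl.
have d2 : n%:R * h ^+ 2 <= (h * n%:R) ^+ 2.
  rewrite exprMn mulrC ler_wpM2l ?sqr_ge0// expr2.
  by rewrite -[leLHS]mulr1 ler_wpM2l.
have dd := le_trans d d2.
split; last first.
  rewrite enorm_sq -[leRHS]ger0_norm ?mulr_ge0// -sqrtr_sqr.
  by rewrite ler_sqrt// sqr_ge0.
have hn2 : (h * n%:R) ^+ 2 <= (1 / 10) ^+ 2.
  by rewrite lerXn2r ?nnegrE ?mulr_ge0//; lra.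
have a0 : 0 <= 100 :> R by lra.
have b0 : 0 <= 1 / 50 :> R by lra.
have ab : 1 <= 100 * (1 / 50) :> R by lra.
have := sq_ineq y x a0 b0 ab; have := near_center_in_ball hx.
by move: dd hn2; move: (sq x y) (sq 0 x) (sq 0 y) ((h * _) ^+ 2) => *; lra.
Qed.

End Ball10.

(** * The mass inequality *)

Section WeightIdentities.
Context (R : realType) (n : nat) (p : 'rV[R]_n) (t : R).
Notation sq := (sq p).
Notation g := (carl_weight (log_coef n t) (lin_coef t)).

(** The total weight in front of [|u|^2] on the right-hand side of
    [cutoff_estimate]; at distance [r] it is [r^(-2(t+1)) exp (t r^2/200)],
    independently of the dimension. *)
Lemma weight_outer x : wt p x * g (sq x) ^+ 2 =
  expR (- (t + 1) * ln (sq x) + t / 200 * sq x).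
Proof.
rewrite /wt /carl_weight expr2 -!expRD; congr expR; rewrite /log_coef /lin_coef.
by move: (sq x) (ln (sq x)) => s l; field.
Qed.

Lemma weight_inner x : 0 < sq x -> wt p x * (sq x * g (sq x) ^+ 2) =
  expR (- t * ln (sq x) + t / 200 * sq x).
Proof.
move=> sx; rewrite mulrCA weight_outer -[X in X * _](lnK (x := sq x)) ?posrE//.
by rewrite -expRD; congr expR; ring.
Qed.

End WeightIdentities.

(** The constant of [cutoff_estimate] times the bound of
    [annular_cut_bounds]. *)
Definition cutoff_const (R : realType) : R := 400 * (200 * 100) * (2 * (40 * 100) ^+ 2).

Section MassInequality.
Context (R : realType) (n : nat) (n_gt0 : (0 < n)%N).
Variables (p : 'rV[R]_n) (t M : R) (VR VI Wr Wi : 'rV[R]_n -> R) (u : 'rV[R]_n -> R[i]).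
Hypothesis ph : eball 0 2^-1 p.
Hypotheses (t20 : 20 <= t) (nt : n%:R <= t).
Let B : set 'rV[R]_n := eball 0 10.
Let a : 'rV[R]_n -> R := @complex.Re R \o u.
Let b : 'rV[R]_n -> R := @complex.Im R \o u.
Hypotheses (ha : C2 B a) (hb : C2 B b).
Hypotheses (hWr : C1 setT Wr) (hWi : C1 setT Wi).
Hypothesis eqa : forall x, B x -> laplacian a x = VR x * a x - VI x * b x.
Hypothesis eqb : forall x, B x -> laplacian b x = VR x * b x + VI x * a x.
Hypotheses (Mt : M <= t ^+ 2) (VRM : forall x, B x -> `|VR x| <= M).
Let m := t ^+ 2 / 100 / 100.
Hypotheses (Wrm : forall x, sq p x <= 81 -> `|Wr x| <= m)
  (Wim : forall x, sq p x <= 81 -> `|Wi x| <= m).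
Hypotheses (gWr : forall x, sq p x <= 81 -> gam p Wr Wr x <= (9 * m) ^+ 2).
Hypotheses (gWi : forall x, sq p x <= 81 -> gam p Wi Wi x <= (9 * m) ^+ 2).
Hypothesis VW : forall x, sq p x <= 81 ->
  (VR x - Wr x) ^+ 2 + (VI x - Wi x) ^+ 2 <= t ^+ 3 / 81 / 800.
Variable c : R.
Hypothesis bu : forall x, B x -> abs2 u x <= c.

Let oB : open B. Proof. by apply: eball_open. Qed.
Let fB : (lebesgue_rV R n B < +oo)%E.
Proof. by apply: le_lt_trans (eball_lty _ _) _; rewrite ?ltry. Qed.
Let cu x : B x -> {for x, continuous (abs2 u)}.
Proof.
move=> Bx; apply: cont_abs2.
  exact: (C1_cont (C2_C1 ha) Bx).
exact: (C1_cont (C2_C1 hb) Bx).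
Qed.

Let B81 x : sq p x <= 81 -> B x.
Proof.
by move=> h; rewrite /B ball10E /=; have := near_center_in_ball ph h; lra.
Qed.

Variable r : R.
Hypotheses (r0 : 0 < r) (r1 : r <= 1).
(* The inner transition of the cutoff, on dl <= sq p x <= 4 dl, then takes place
   inside the ball of radius r. *)
Let dl := r ^+ 2 / 5.

Let dl0 : 0 < dl. Proof. by rewrite divr_gt0// exprn_gt0. Qed.
Let r2 : r ^+ 2 <= 1. Proof. by rewrite expr_le1// ltW. Qed.
Let dlr : r ^+ 2 = 5 * dl. Proof. by rewrite /dl; field. Qed.
Let dl5 : 5 * dl <= 1. Proof. by rewrite -dlr. Qed.
Let dl1 : dl <= 1. Proof. by have h := dl5; have h' := dl0; lra. Qed.

Let A : set 'rV[R]_n := [set x | 0 < sq p x] `&` B.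
Let K : set 'rV[R]_n := [set x | dl <= sq p x] `&` [set x | sq p x <= 80].

Let oA : open A.
Proof.
apply: openI => //.
have -> : [set x | 0 < sq p x] = sq p @^-1` [set s : R | 0 < s] by [].
by apply: open_comp; [move=> x _; exact: sq_continuous|exact: open_gt].
Qed.

Let cK : closed K.
Proof.
have e : K = sq p @^-1` ([set s : R | dl <= s] `&` [set s : R | s <= 80]) by [].
rewrite e; apply: closed_comp; first by move=> x _; exact: sq_continuous.
by apply: closedI; [exact: closed_ge|exact: closed_le].
Qed.

Let KA : K `<=` A.
Proof.
move=> x [/= h1 h2]; split => /=; first exact: lt_le_trans dl0 h1.
by apply: B81; lra.
Qed.

Let sq_pos x : A x -> 0 < sq p x. Proof. by case. Qed.

Let bK : exists C : R, forall x, K x -> forall i, `|x ord0 i| <= C.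
Proof.
exists 10 => x [_ /= h] i.
have h1 : sq p x <= 81 by lra.
have h2 := near_center_in_ball ph h1.
have := @crd_sq_bound _ _ 0 x 10 i (ler0n _ 10).
by rewrite mxE subr0; apply; rewrite expr2; lra.
Qed.

Let K81 x : K x -> sq p x <= 81. Proof. by move=> [_ /=]; lra. Qed.

Let C1sub f : C1 setT f -> C1 A f.
Proof. by move=> h x _; exact: h. Qed.
Let C2sub f : C2 B f -> C2 A f.
Proof. by move=> h x [_ Bx]; exact: h. Qed.

Let annular_cut_offK x : ~ K x -> [/\ annular_cut dl (sq p x) = 0, annular_cut1 dl (sq p x) = 0 & annular_cut2 dl (sq p x) = 0].
Proof.
move=> h; apply: annular_cut_off => // /andP[h1 h2]; apply: h; split => //=.
by lra.
Qed.

Let g := carl_weight (log_coef n t) (lin_coef t).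
Notation Ca := (cutoff_const R).

Let CKabs : CK A K (fun x => sq p x * (g (sq p x) * annular_cut dl (sq p x)) ^+ 2 * abs2 u x) /\
  CK A K (fun x => g (sq p x) ^+ 2 * cutoff_energy p (annular_cut1 dl) (annular_cut2 dl) x * abs2 u x).
Proof.
have cs x : {for x, continuous (sq p)} by exact: sq_continuous.
have crad (q : R -> R) x : (forall s : R, 0 < s -> {for s, continuous q}) -> A x ->
    {for x, continuous (fun x => q (sq p x))}.
  by move=> cq Ax; apply: continuous_comp; [exact: cs|apply: cq; exact: sq_pos].
have cg x : A x -> {for x, continuous (fun x => g (sq p x))}.
  by apply: crad => s s0; exact: is_derive_cont (is_derive_carl_weight _ _ s0).
have cN x : A x -> {for x, continuous (abs2 u)} by move=> [_ /cu].
have cc0 x : A x -> {for x, continuous (fun x => annular_cut dl (sq p x))}.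
  by apply: (crad (annular_cut dl)) => s _; exact: is_derive_cont (is_derive_annular_cut dl s).
have cc1 x : A x -> {for x, continuous (fun x => annular_cut1 dl (sq p x))}.
  by apply: (crad (annular_cut1 dl)) => s _; exact: is_derive_cont (is_derive_annular_cut1 dl s).
have cc2 x : A x -> {for x, continuous (fun x => annular_cut2 dl (sq p x))}.
  by apply: (crad (annular_cut2 dl)) => s _; exact: annular_cut2_cont.
split.
  have h : CK A K (fun x => g (sq p x) * annular_cut dl (sq p x)).
    by apply: CKM => //; split => // x /annular_cut_offK[].
  by apply: CKMr => //; apply: CKM => //; exact: CK_sqr.
apply: CKMr => //; apply: CKM; first by move=> x Ax; exact: (contM (cg x Ax) (cg x Ax)).
apply: CKD; apply: CK_sqr; apply: CKM => //.
- by split => // x /annular_cut_offK[].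
- by move=> x Ax; exact: (contM (cs x) (cs x)).
- by split => // x /annular_cut_offK[].
Qed.

Let E : set 'rV[R]_n := eball p (3 / 2) `\` eball p r.
Let D2 : set 'rV[R]_n := eball p 9 `\` eball p 8.

Let mE : measurable E. Proof. by apply: measurableD; apply: eball_measurable. Qed.
Let mD2 : measurable D2. Proof. by apply: measurableD; apply: eball_measurable. Qed.
Let mr : measurable (eball p r). Proof. exact: eball_measurable. Qed.

Let sub81 q : 0 < q -> q <= 9 -> eball p q `<=` B.
Proof.
move=> q0 q9 x; rewrite eballE//= => h; apply: B81; apply: ltW; apply: lt_le_trans h _.
have : q ^+ 2 <= 9 ^+ 2 by rewrite lerXn2r ?nnegrE// ltW.
by move=> /le_trans; apply; rewrite expr2 -natrM.
Qed.

Let EB : E `<=` B.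
Proof. by move=> x [h _]; apply: (@sub81 (3 / 2)) h; lra. Qed.
Let D2B : D2 `<=` B.
Proof. by move=> x [h _]; apply: (@sub81 9) h. Qed.
Let rB : eball p r `<=` B.
Proof. by apply: sub81 => //; apply: le_trans r1 _; rewrite ler1n. Qed.

(** [cutoff_estimate] for [annular_cut], with the weights replaced by their
    extreme values: the left-hand side is restricted to distances between [r] and
    3/2, where the cutoff is 1 and the weight is at least its value at
    3/2 without the convexifying factor; the right-hand side lives on the two
    transition zones, where each factor of the weight is replaced by an upper
    bound. *)
Lemma mass_inequality :
  t * expR (- t * ln (9 / 4)) * mass u E <=
  Ca * (expR (- (t + 1) * ln dl + t / 200) * mass u (eball p r)
        + expR (- (t + 1) * ln 64 + t / 200 * 81) * mass u D2).
Proof.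
have t0 : 0 < t by apply: lt_le_trans t20.
have [CK1 CK2] := CKabs.
have := cutoff_estimate oA cK KA sq_pos bK K81 t20 nt n_gt0
  (fun s _ => is_derive_annular_cut dl s) (fun s _ => is_derive_annular_cut1 dl s)
  (fun s _ => @annular_cut2_cont R dl s) annular_cut_offK (C2sub ha) (C2sub hb) (C1sub hWr) (C1sub hWi)
  (fun x Ax => eqa (Ax.2)) (fun x Ax => eqb (Ax.2)) Mt (fun x Kx => VRM (KA Kx).2)
  (fun x Kx => Wrm (K81 Kx)) (fun x Kx => Wim (K81 Kx))
  (fun x Kx => gWr (K81 Kx)) (fun x Kx => gWi (K81 Kx)) (fun x Kx => VW (K81 Kx)).
rewrite -/g -[fun x => _ * (a x ^+ 2 + b x ^+ 2)]/(fun x => sq p x * (g (sq p x) * annular_cut dl (sq p x)) ^+ 2 * abs2 u x).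
rewrite -[X in _ <= _ * cyl_int p X]/(fun x => g (sq p x) ^+ 2 * cutoff_energy p (annular_cut1 dl) (annular_cut2 dl) x * abs2 u x).
set F1 := fun x => sq p x * _ * _; set F2 := fun x => _ * cutoff_energy _ _ _ _ * _ => H.
have i1 := CK_integrable cK KA bK (CK_wt oA sq_pos CK1).
have i2 := CK_integrable cK KA bK (CK_wt oA sq_pos CK2).
have ann0 x : 0 <= cutoff_energy p (annular_cut1 dl) (annular_cut2 dl) x by rewrite addr_ge0 ?sqr_ge0.
have low : expR (- t * ln (9 / 4)) * mass u E <= cyl_int p F1.
  apply: (Rintegral_lower oB fB cu bu i1 _ mE EB).
    move=> x; apply: mulr_ge0; first exact: wt_ge0.
    by apply: mulr_ge0; [apply: mulr_ge0; [exact: sq_ge0|exact: sqr_ge0]|exact: abs2_ge0].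
  move=> x [Ex]; rewrite eballE//= => /negP; rewrite -leNgt dlr => rx.
  move: Ex; rewrite eballE; last by lra.
  move=> /= Ex; have d0 := dl0.
  have sx : 0 < sq p x by lra.
  have s94 : sq p x <= 9 / 4 by move: Ex; rewrite expr_div_n; lra.
  have mid : 4 * dl <= sq p x <= 64 by lra.
  have [c1 _ _] := annular_cut_mid dl0 mid.
  have -> : wt p x * F1 x = (wt p x * (sq p x * g (sq p x) ^+ 2)) * abs2 u x.
    by rewrite /F1 c1 [_ * 1]mulr1 -!mulrA.
  rewrite /g (weight_inner t sx).
  apply: ler_wpM2r; first exact: abs2_ge0.
  rewrite ler_expR -[leLHS]addr0; apply: lerD; last first.
    by apply: mulr_ge0; [apply: divr_ge0; [exact: ltW|exact: ler0n]|exact: ltW].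
  rewrite !mulNr lerN2; apply: ler_wpM2l; first exact: ltW.
  by rewrite ler_ln ?posrE//; lra.
have up : cyl_int p F2 <= (2 * (40 * 100) ^+ 2) * expR (- (t + 1) * ln dl + t / 200) * mass u (eball p r)
   + (2 * (40 * 100) ^+ 2) * expR (- (t + 1) * ln 64 + t / 200 * 81) * mass u D2.
  have Ca0 : 0 <= 2 * (40 * 100) ^+ 2 :> R by rewrite mulr_ge0// sqr_ge0.
  have bnd x (e : R) : 0 < sq p x -> - (t + 1) * ln (sq p x) + t / 200 * sq p x <= e ->
      wt p x * F2 x <= 2 * (40 * 100) ^+ 2 * expR e * abs2 u x.
    move=> sx he.
    have -> : wt p x * F2 x = (wt p x * g (sq p x) ^+ 2) * cutoff_energy p (annular_cut1 dl) (annular_cut2 dl) x * abs2 u x.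
      by rewrite /F2 !mulrA.
    apply: ler_wpM2r; first exact: abs2_ge0.
    rewrite /g weight_outer [expR _ * _]mulrC.
    apply: ler_pM; [exact: ann0|exact: expR_ge0|exact: annular_cut_bounds|].
    by rewrite ler_expR.
  have zero x : annular_cut1 dl (sq p x) = 0 -> annular_cut2 dl (sq p x) = 0 -> F2 x = 0.
    by move=> h1 h2; rewrite /F2 /cutoff_energy h1 h2 !mulr0 expr0n addr0 mulr0 mul0r.
  have nonneg x e : 0 <= 2 * (40 * 100) ^+ 2 * expR e * abs2 u x.
    by rewrite mulr_ge0 ?abs2_ge0// mulr_ge0// expR_ge0.
  have d0 := dl0. have t1 : 0 <= t + 1 by lra.
  apply: (Rintegral_upper oB fB cu bu i2 (mulr_ge0 Ca0 (expR_ge0 _))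
    (mulr_ge0 Ca0 (expR_ge0 _)) mr mD2 rB D2B).
  - move=> x; rewrite eballE//= dlr => xr.
    have [xd|dx] := ltP (sq p x) dl.
      have [_ h1 h2] : [/\ annular_cut dl (sq p x) = 0, annular_cut1 dl (sq p x) = 0 & annular_cut2 dl (sq p x) = 0].
        by apply: annular_cut_off => //; move=> /andP[h _]; move: xd; rewrite ltNge h.
      have z : wt p x * F2 x = 0 by rewrite (zero x h1 h2) mulr0.
      rewrite [leLHS](_ : _ = wt p x * F2 x)// z; exact: nonneg.
    have sx : 0 < sq p x by lra.
    apply: bnd => //; apply: lerD.
      by rewrite !mulNr lerN2; apply: ler_wpM2l => //; rewrite ler_ln ?posrE.
    rewrite -[leRHS]mulr1; apply: ler_wpM2l.
      by apply: divr_ge0; [exact: ltW|exact: ler0n].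
    by have h := dl5; lra.
  - move=> x [x9]; rewrite eballE// => /= /negP; rewrite -leNgt => x8.
    move: x9; rewrite eballE//= => x9.
    have x64 : 64 <= sq p x by move: x8; rewrite expr2; lra.
    have x81 : sq p x <= 81 by move: x9; rewrite [9 ^+ 2]expr2; lra.
    have sx : 0 < sq p x by lra.
    apply: bnd => //; apply: lerD.
      by rewrite !mulNr lerN2; apply: ler_wpM2l => //; rewrite ler_ln ?posrE.
    apply: ler_wpM2l => //; by apply: divr_ge0; [exact: ltW|exact: ler0n].
  - move=> x; rewrite eballE//= dlr => /negP; rewrite -leNgt => xr xD2.
    have [x64|x64] := leP (sq p x) 64.
      have mid : 4 * dl <= sq p x <= 64 by lra.
      have [_ h1 h2] := annular_cut_mid dl0 mid.
      have z : wt p x * F2 x = 0 by rewrite (zero x h1 h2) mulr0.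
      exact: z.
    have [_ h1 h2] : [/\ annular_cut dl (sq p x) = 0, annular_cut1 dl (sq p x) = 0 & annular_cut2 dl (sq p x) = 0].
      apply: annular_cut_off => //; move=> /andP[h1 h2]; apply: xD2; split.
        by rewrite eballE//= expr2; lra.
      by rewrite eballE//= expr2 => h3; lra.
    have z : wt p x * F2 x = 0 by rewrite (zero x h1 h2) mulr0.
    exact: z.
rewrite -mulrA; apply: le_trans (ler_wpM2l (ltW t0) low) _.
apply: le_trans H _.
have c0 : 0 <= 400 * (200 * 100) :> R.
  by apply: mulr_ge0; [exact: ler0n|apply: mulr_ge0; exact: ler0n].
apply: le_trans (ler_wpM2l c0 up) _; rewrite /cutoff_const.
move: (expR _) (expR _) (mass _ _) (mass _ _) => e1 e2 m1 m2.
by rewrite le_eqVlt; apply/orP; left; apply/eqP; ring.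
Qed.

End MassInequality.

(** * Vanishing order *)

Section Vanishing.
Context (R : realType) (n : nat).
Notation mu := (lebesgue_rV R n).

Lemma powR_expR (x N : R) : 0 < x -> x `^ N = expR (N * ln x).
Proof. by move=> x0; rewrite /powR gt_eqF. Qed.

(** The mean square of [u] on the ball is at most [k^2 r^(2 N)] and the volume at
    most [2^n], as [r <= 1]. *)
Lemma vanishing_mass (u : 'rV[R]_n -> R[i]) (p : 'rV[R]_n) (B : set 'rV[R]_n)
    (c N k r : R) :
  open B -> (mu B < +oo)%E -> (forall x, B x -> {for x, continuous (abs2 u)}) ->
  (forall x, B x -> abs2 u x <= c) -> 0 < r -> r <= 1 -> eball p r `<=` B ->
  (mu (eball p r) `^ (- 2^-1) * LpC 2%:E (eball p r) u <= (k * r `^ N)%:E)%E ->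
  mass u (eball p r) <= k ^+ 2 * 2 ^+ n * expR (2 * N * ln r).
Proof.
move=> oB fB cu bu r0 r1 rB.
rewrite (LpC2_fin oB fB cu bu (eball_measurable p r0) rB).
have v2 := eball_lty p r0.
have px : eball p r p by rewrite eballE//= /sq big1 ?exprn_gt0// => i _; rewrite /crd subrr expr0n.
have v1 := open_gt0 (eball_open r0) px.
have vf : mu (eball p r) \is a fin_num.
  by rewrite ge0_fin_numE ?ltW//; apply: le_lt_trans v2 _; rewrite ltry.
move: v1 v2; rewrite -(fineK vf); set v := fine _; rewrite lte_fin lee_fin => v1 v2.
rewrite poweR_EFin -EFinM lee_fin powRN (powR12_sqrt (ltW v1)) powR_expR//.
set L := Num.sqrt (mass _ _) => h.
have sv : 0 < Num.sqrt v by rewrite sqrtr_gt0.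
have L0 : 0 <= L by exact: sqrtr_ge0.
have h2 : L <= k * expR (N * ln r) * Num.sqrt v.
  by rewrite -ler_pdivrMr// mulrC.
have mE : mass u (eball p r) = L ^+ 2 by rewrite sqr_sqrtr// mass_ge0.
rewrite mE; apply: (@le_trans _ _ ((k * expR (N * ln r) * Num.sqrt v) ^+ 2)).
  by rewrite lerXn2r ?nnegrE//; exact: le_trans L0 h2.
rewrite !exprMn (sqr_sqrtr (ltW v1)) -mulrA -[leRHS]mulrA; apply: ler_wpM2l; first exact: sqr_ge0.
rewrite mulrC; apply: ler_pM; [exact: ltW|exact: sqr_ge0| |].
  have h2r : 2 * r <= 2 by rewrite -[leRHS]mulr1 ler_wpM2l.
  have p2r : 0 <= 2 * r by rewrite mulr_ge0// ltW.
  by apply: le_trans v2 _; rewrite lerXn2r ?nnegrE.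
by rewrite expr2 -expRD ler_expR le_eqVlt; apply/orP; left; apply/eqP; ring.
Qed.

(** [r^a] tends to 0 with [r]; the witness [r = exp (- x)] is obtained from
    [1 + a x <= exp (a x)]. *)
Lemma small_radius_limit (L Q J a rho : R) : 0 < a -> 0 < rho ->
  (forall r, 0 < r -> r < rho -> L <= Q + J * expR (a * ln r)) -> L <= Q.
Proof.
move=> a0 rho0 H; rewrite leNgt; apply/negP => LQ.
have d0 : 0 < L - Q by rewrite subr_gt0.
pose x : R := 1 + `|ln rho| + `|J| / ((L - Q) * a).
have c0 : 0 <= `|J| / ((L - Q) * a) by rewrite divr_ge0// mulr_ge0// ltW.
have r0 : 0 < expR (- x) by exact: expR_gt0.
have rr : expR (- x) < rho.
  rewrite -[ltRHS]lnK ?posrE// ltr_expR /x.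
  have h : - ln rho <= `|ln rho| by rewrite -normrN ler_norm.
  by move: h c0; move: (_ / _) (ln rho) `|ln rho| => y1 y2 y3 h1 h2; lra.
have := H _ r0 rr; apply/negP; rewrite -ltNge expRK.
have e1 : 1 + a * x <= expR (a * x) by exact: expR_ge1Dx.
have ax : `|J| < (L - Q) * (1 + a * x).
  have -> : (L - Q) * (1 + a * x) = (L - Q) * (1 + a * (1 + `|ln rho|)) + `|J|.
    by rewrite /x; field; rewrite !gt_eqF.
  rewrite ltrDr mulr_gt0// ltr_pwDl// mulr_ge0 ?addr_ge0// ltW//.
have h3 : `|J| < (L - Q) * expR (a * x).
  by apply: lt_le_trans ax _; rewrite ler_wpM2l// ltW.
have h4 : `|J| * expR (a * - x) < L - Q.
  by rewrite mulrN expRN ltr_pdivrMr// expR_gt0.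
have h5 : J * expR (a * - x) <= `|J| * expR (a * - x).
  by apply: ler_wpM2r; [exact: expR_ge0|exact: ler_norm].
by rewrite addrC -ltrBrDr; apply: le_lt_trans h5 h4.
Qed.

End Vanishing.

Section VanishingBound.
Context (R : realType) (n : nat) (n_gt0 : (0 < n)%N).
Variables (p : 'rV[R]_n) (t M : R) (VR VI Wr Wi : 'rV[R]_n -> R) (u : 'rV[R]_n -> R[i]).
Hypothesis ph : eball 0 2^-1 p.
Hypotheses (t20 : 20 <= t) (nt : n%:R <= t).
Let B : set 'rV[R]_n := eball 0 10.
Let a : 'rV[R]_n -> R := @complex.Re R \o u.
Let b : 'rV[R]_n -> R := @complex.Im R \o u.
Hypotheses (ha : C2 B a) (hb : C2 B b).
Hypotheses (hWr : C1 setT Wr) (hWi : C1 setT Wi).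
Hypothesis eqa : forall x, B x -> laplacian a x = VR x * a x - VI x * b x.
Hypothesis eqb : forall x, B x -> laplacian b x = VR x * b x + VI x * a x.
Hypotheses (Mt : M <= t ^+ 2) (VRM : forall x, B x -> `|VR x| <= M).
Let m := t ^+ 2 / 100 / 100.
Hypotheses (Wrm : forall x, sq p x <= 81 -> `|Wr x| <= m)
  (Wim : forall x, sq p x <= 81 -> `|Wi x| <= m).
Hypotheses (gWr : forall x, sq p x <= 81 -> gam p Wr Wr x <= (9 * m) ^+ 2).
Hypotheses (gWi : forall x, sq p x <= 81 -> gam p Wi Wi x <= (9 * m) ^+ 2).
Hypothesis VW : forall x, sq p x <= 81 ->
  (VR x - Wr x) ^+ 2 + (VI x - Wi x) ^+ 2 <= t ^+ 3 / 81 / 800.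
Variable c : R.
Hypothesis bu : forall x, B x -> abs2 u x <= c.
Hypothesis norm1 : (1 <= LpC 2%:E (eball 0 1) u)%E.
Hypothesis tc : cutoff_const R * (c * 18 ^+ n) < t.

Let oB : open B. Proof. by apply: eball_open. Qed.
Let fB : (lebesgue_rV R n B < +oo)%E.
Proof. by apply: le_lt_trans (eball_lty _ _) _; rewrite ?ltry. Qed.
Let cu x : B x -> {for x, continuous (abs2 u)}.
Proof.
move=> Bx; apply: cont_abs2.
  exact: (C1_cont (C2_C1 ha) Bx).
exact: (C1_cont (C2_C1 hb) Bx).
Qed.

Let B81 x : sq p x <= 81 -> B x.
Proof.
by move=> h; rewrite /B ball10E /=; have := near_center_in_ball ph h; lra.
Qed.

Let sub81 q : 0 < q -> q <= 9 -> eball p q `<=` B.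
Proof.
move=> q0 q9 x; rewrite eballE//= => h; apply: B81; apply: ltW; apply: lt_le_trans h _.
have : q ^+ 2 <= 9 ^+ 2 by rewrite lerXn2r ?nnegrE// ltW.
by move=> /le_trans; apply; rewrite expr2 -natrM.
Qed.

Let unitB : eball 0 1 `<=` B.
Proof.
move=> x; rewrite eballE// expr1n /= => h; rewrite /B ball10E /=.
by apply: lt_trans h _; rewrite ltr1n.
Qed.

Let unit_mass : 1 <= mass u (eball 0 1).
Proof.
have := norm1; rewrite (LpC2_fin oB fB cu bu (eball_measurable _ ltr01) unitB) lee_fin => h.
have m0 := mass_ge0 u (eball 0 1).
rewrite -(sqr_sqrtr m0) -[leLHS](expr1n _ 2) lerXn2r ?nnegrE//.
Qed.

Lemma cutoff_const_ge0 : 0 <= cutoff_const R.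
Proof.
by apply: mulr_ge0; apply: mulr_ge0; try exact: ler0n; [apply: mulr_ge0; exact: ler0n|exact: sqr_ge0].
Qed.

(** If [N > t + 1], then in [mass_inequality] every term that involves the ball
    of radius [r] is bounded by a multiple of [r^al] with [al > 0].  Letting [r]
    tend to 0 leaves [t X <= cutoff_const Y c 18^n], where [X] bounds the
    weight from below within distance 3/2 and [Y] bounds it from above between 8
    and 9; since [Y <= X], this contradicts [tc]. *)
Lemma vanishing_le N k :
  (\forall r \near 0^'+, (lebesgue_rV R n (eball p r) `^ (- 2^-1) *
      LpC 2%:E (eball p r) u <= (k * r `^ N)%:E)%E) ->
  N <= t + 1.
Proof.
move=> van; rewrite leNgt; apply/negP => tN.
have [rho /= rho0 hrho] : exists2 rho : R, 0 < rho & forall r, 0 < r -> r < rho ->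
   (lebesgue_rV R n (eball p r) `^ (- 2^-1) * LpC 2%:E (eball p r) u <= (k * r `^ N)%:E)%E.
  move: van => [rho /= rho0 h]; exists rho => // r r0 rr; apply: h => //.
  by rewrite /ball /= sub0r normrN gtr0_norm.
have t0 : 0 < t by apply: lt_le_trans t20.
pose al := 2 * (N - t - 1).
have al0 : 0 < al by rewrite mulr_gt0//; lra.
pose X := expR (- t * ln (9 / 4)).
pose Y := expR (- (t + 1) * ln 64 + t / 200 * 81).
pose D2 : set 'rV[R]_n := eball p 9 `\` eball p 8.
(* The coefficient of r^al: the first summand comes from removing the ball of
   radius r from the unit ball, the second from the inner cutoff. *)
pose J := k ^+ 2 * 2 ^+ n * (t * X + cutoff_const R * expR ((t + 1) * ln 5 + t / 200)).
have c0 : 0 <= c.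
  have B0 : B 0 by rewrite /B ball10E /= /sq big1// => i _; rewrite /crd subrr expr0n.
  exact: le_trans (abs2_ge0 u 0) (bu B0).
have Ca0 := cutoff_const_ge0.
have X0 : 0 <= t * X by apply: mulr_ge0; [exact: ltW|exact: expR_ge0].
have mD2 : mass u D2 <= c * 18 ^+ n.
  apply: (mass_le oB fB cu bu) => //.
  - by apply: measurableD; exact: eball_measurable.
  - by move=> x [h _]; apply: (@sub81 9) h.
  - apply: (@le_trans _ _ (lebesgue_rV R n (eball p 9))).
      apply: le_measure; rewrite ?inE; [|exact: eball_measurable|by move=> x []].
      by apply: measurableD; exact: eball_measurable.
    by apply: le_trans (eball_lty _ _) _ => //; rewrite -natrM.
have main : t * X <= cutoff_const R * (Y * (c * 18 ^+ n)).
  apply: (@small_radius_limit _ _ _ J al (Num.min rho 1)) => //.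
    by rewrite lt_min rho0 ltr01.
  move=> r r0; rewrite lt_min => /andP[rrho /ltW r1].
  have rB : eball p r `<=` B by apply: sub81 => //; apply: le_trans r1 _; rewrite ler1n.
  have mr := vanishing_mass oB fB cu bu r0 r1 rB (hrho r r0 rrho).
  set mm := mass u (eball p r) in mr.
  have mm0 : 0 <= mm by exact: mass_ge0.
  have lr0 : ln r <= 0 by apply: ln_le0.
  have massE : 1 - mm <= mass u (eball p (3 / 2) `\` eball p r).
    have h : mass u (eball 0 1) <= mass u (eball p (3 / 2) `\` eball p r) + mm.
      apply: (mass_sub oB fB cu bu) => //.
      - exact: eball_measurable.
      - by apply: measurableD; apply: eball_measurable.
      - exact: eball_measurable.
      - by move=> x [h _]; apply: (@sub81 (3 / 2)) h; lra.
      - move=> x x1; have [xr|xr] := pselect (eball p r x); [by right|left; split=> //].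
        move: x1; rewrite eballE// expr1n /= => x1.
        by rewrite eballE; [exact: unit_ball_near_center|lra].
    by have := le_trans unit_mass h; lra.
  have ineq := mass_inequality n_gt0 ph t20 nt ha hb hWr hWi eqa eqb Mt VRM Wrm Wim gWr gWi VW
    bu r0 r1.
  have h1 : t * X * (1 - mm) <= t * X * mass u (eball p (3 / 2) `\` eball p r).
    by rewrite ler_wpM2l.
  have h2 := le_trans h1 ineq.
  have h3 : t * X <= cutoff_const R * (Y * (c * 18 ^+ n)) + (t * X * mm +
      cutoff_const R * (expR (- (t + 1) * ln (r ^+ 2 / 5) + t / 200) * mm)).
    have h4 : cutoff_const R * (Y * mass u D2) <= cutoff_const R * (Y * (c * 18 ^+ n)).
      by apply: ler_wpM2l => //; apply: ler_wpM2l => //; exact: expR_ge0.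
    move: h2 h4; rewrite mulrBr mulr1 mulrDr -/Y -/D2.
    move: (t * X * mm) (t * X) (cutoff_const R * _) (cutoff_const R * _) (cutoff_const R * _).
    by move=> y1 y2 y3 y4 y5; lra.
  apply: le_trans h3 _; rewrite lerD2l.
  have e1 : mm <= k ^+ 2 * 2 ^+ n * expR (al * ln r).
    apply: le_trans mr _; apply: ler_wpM2l; first by apply: mulr_ge0; [exact: sqr_ge0|exact: exprn_ge0].
    rewrite ler_expR -subr_ge0 /al (_ : _ - _ = 2 * (t + 1) * - ln r); last by ring.
    by rewrite mulr_ge0 ?oppr_ge0// mulr_ge0//; lra.
  have e2 : expR (- (t + 1) * ln (r ^+ 2 / 5) + t / 200) * mm <=
     expR ((t + 1) * ln 5 + t / 200) * (k ^+ 2 * 2 ^+ n * expR (al * ln r)).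
    apply: le_trans (ler_wpM2l (expR_ge0 _) mr) _.
    rewrite [leLHS]mulrCA [leRHS]mulrCA -!expRD.
    apply: ler_wpM2l; first by apply: mulr_ge0; [exact: sqr_ge0|exact: exprn_ge0].
    rewrite ler_expR ln_div ?posrE ?exprn_gt0// lnXn// /al.
    by rewrite le_eqVlt; apply/orP; left; apply/eqP; move: (ln r) (ln 5) => l l5; ring.
  have -> : J * expR (al * ln r) = t * X * (k ^+ 2 * 2 ^+ n * expR (al * ln r)) +
     cutoff_const R * (expR ((t + 1) * ln 5 + t / 200) *
       (k ^+ 2 * 2 ^+ n * expR (al * ln r))).
    rewrite /J; move: (k ^+ 2 * _) (expR (al * _)) (t * X) (cutoff_const R) (expR _).
    by move=> y1 y2 y3 y4 y5; ring.
  by apply: lerD; apply: ler_wpM2l.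
(* With 9/256 = (9/4)/64, the claim reduces to
   ln (9/256) <= - 81/200, which follows from ln y <= y - 1. *)
have XY : Y <= X.
  rewrite ler_expR.
  have l1 : ln (9 / 256 : R) <= - (247 / 256).
    have := @le_ln1Dx R (- (247 / 256)); rewrite (_ : 1 + _ = 9 / 256); last by field.
    by apply; lra.
  have l2 : ln (9 / 4 : R) = ln (9 / 256) + ln 64.
    have e : 9 / 4 = 9 / 256 * 64 :> R by field.
    by rewrite e lnM ?posrE//; lra.
  have l64 : 0 <= ln (64 : R) by apply: ln_ge0; lra.
  rewrite l2 -subr_ge0 (_ : _ - _ = t * (- ln (9 / 256) - 81 / 200) + ln 64); last by field.
  by apply: addr_ge0 => //; apply: mulr_ge0; [exact: ltW|lra].
have fin : t * X <= cutoff_const R * (c * 18 ^+ n) * X.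
  apply: le_trans main _; rewrite mulrCA mulrC; apply: ler_wpM2l => //.
  by apply: mulr_ge0 => //; apply: mulr_ge0 => //; apply: exprn_ge0.
move: fin; rewrite ler_pM2r ?expR_gt0// => fin.
by have := lt_le_trans tc fin; rewrite ltxx.
Qed.

End VanishingBound.

(** * Smoothing a Hoelder potential *)

Section HolderPotential.
Context (R : realType) (n : nat) (n_gt0 : (0 < n)%N).
Variables (beta M : R) (V : 'rV[R]_n -> R[i]).
Hypotheses (beta_gt0 : 0 < beta) (beta_lt1 : beta < 1) (M1 : 1 <= M).
Let B : set 'rV[R]_n := eball 0 10.
Hypothesis hV : (holder_norm beta B V <= M%:E)%E.

Lemma abs_Re_le (z : R[i]) : `|complex.Re z| <= Normc.normc z.
Proof.
case: z => x y /=; rewrite -sqrtr_sqr ler_sqrt ?addr_ge0 ?sqr_ge0//.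
by rewrite lerDl sqr_ge0.
Qed.

Lemma abs_Im_le (z : R[i]) : `|complex.Im z| <= Normc.normc z.
Proof.
case: z => x y /=; rewrite -sqrtr_sqr ler_sqrt ?addr_ge0 ?sqr_ge0//.
by rewrite lerDr sqr_ge0.
Qed.

(** At [x = y] the seminorm gives no information, but the difference is 0. *)
Lemma holder_diff x y : B x -> B y ->
  Normc.normc (V y - V x) <= M * enorm (y - x) `^ beta.
Proof.
move=> Bx By; have [->|yx] := eqVneq y x.
  rewrite subrr (_ : Normc.normc 0 = 0); last by rewrite /= expr0n addr0 sqrtr0.
  by rewrite mulr_ge0 ?powR_ge0//; apply: le_trans M1.
have e0 : 0 < enorm (y - x).
  rewrite enorm_sq sqrtr_gt0 lt_def sq_ge0 andbT; apply: contraNneq yx => h.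
  apply/eqP/rowP => i; apply/eqP; rewrite -subr_eq0 -sqrf_eq0.
  by apply/eqP/le_anti; rewrite sqr_ge0 andbT -h; exact: crd_le_sq.
move: hV; rewrite /holder_norm ge_max => /andP[_ h].
have : ((Normc.normc (V y - V x) / enorm (y - x) `^ beta)%:E <= M%:E)%E.
  apply: le_trans h; apply: ereal_sup_ubound; exists (y, x) => //=; split => //.
  exact/eqP.
by rewrite lee_fin ler_pdivrMr// powR_gt0.
Qed.

Lemma ReB (z w : R[i]) : complex.Re (z - w) = complex.Re z - complex.Re w.
Proof. by case: z; case: w. Qed.

Lemma ImB (z w : R[i]) : complex.Im (z - w) = complex.Im z - complex.Im w.
Proof. by case: z; case: w. Qed.

(** [|V|] is at most [M] at some point of the ball, and the Hoelder bound
    propagates this over a diameter of 20: [M + 20^beta M <= 21 M]. *)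
Lemma potential_bound x : B x ->
  `|complex.Re (V x)| <= 21 * M /\ `|complex.Im (V x)| <= 21 * M.
Proof.
move=> Bx.
have B0 : B !=set0 by exists x.
have oB : open B by apply: eball_open.
have h : (LpC +oo B V <= M%:E)%E by move: hV; rewrite /holder_norm ge_max => /andP[].
have [y By /(_ By) Vy] := ae_open oB B0 (LpC_oo_ae h).
have d := holder_diff By Bx.
have M0 : 0 <= M by apply: le_trans M1.
have e20 : enorm (x - y) <= 20.
  rewrite enorm_sq; have -> : 20 = Num.sqrt (20 ^+ 2) :> R by rewrite sqrtr_sqr ger0_norm.
  apply: ler_wsqrtr.
  have s2 : sq y x <= 2 * sq 0 x + 2 * sq 0 y.
    rewrite /sq !mulr_sumr -big_split /=; apply: ler_sum => i _.
    rewrite /crd !mxE !subr0 -subr_ge0 (_ : _ - _ = (x ord0 i + y ord0 i) ^+ 2) ?sqr_ge0//.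
    by ring.
  move: Bx By; rewrite /B ball10E /= => h1 h2.
  by apply: le_trans s2 _; rewrite expr2; lra.
have p20 : enorm (x - y) `^ beta <= 20.
  apply: (@le_trans _ _ (20 `^ beta)).
    apply: ge0_ler_powR; rewrite ?nnegrE ?(ltW beta_gt0)//.
    by rewrite enorm_sq sqrtr_ge0.
  rewrite -[leRHS]powRr1//; apply: ler_powR; first by rewrite ler1n.
  exact: ltW.
have d2 : Normc.normc (V x - V y) <= M * 20 by apply: le_trans d _; rewrite ler_wpM2l.
have tri (v w : R) : `|v - w| <= M * 20 -> `|w| <= M -> `|v| <= 21 * M.
  move=> h1 h2; rewrite -(subrK w v); apply: le_trans (ler_normD _ _) _.
  by apply: le_trans (lerD h1 h2) _; lra.
split.
  apply: (tri _ (complex.Re (V y))); last exact: le_trans (abs_Re_le _) Vy.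
  by rewrite -ReB; exact: le_trans (abs_Re_le _) d2.
apply: (tri _ (complex.Im (V y))); last exact: le_trans (abs_Im_le _) Vy.
by rewrite -ImB; exact: le_trans (abs_Im_le _) d2.
Qed.

(* The scale eps must satisfy M eps^beta <= t^(3/2) and M eps^(beta-1) <= t^2 up
   to constants; the smallest admissible t is S^2, reached at eps = 1/S. *)
Let S := M `^ (1 / (3 + beta)).

Let b3 : 0 < 3 + beta. Proof. by have := beta_gt0; lra. Qed.

Lemma scale_ge1 : 1 <= S.
Proof.
have := @ler_powR _ M M1 0 (1 / (3 + beta)); rewrite powRr0; apply.
by rewrite divr_ge0// ltW.
Qed.

Lemma scale_powE (x : R) : M `^ (x / (3 + beta)) = S `^ x.
Proof. by rewrite /S -powRrM; congr (_ `^ _); field; rewrite gt_eqF. Qed.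

Lemma scale_M : M = S `^ (3 + beta).
Proof. by rewrite -scale_powE divff ?powRr1//; [apply: le_trans M1|rewrite gt_eqF]. Qed.

Lemma M_le_scale4 : M <= S ^+ 4.
Proof.
rewrite {1}scale_M -powR_mulrn; last by apply: le_trans scale_ge1.
by apply: ler_powR; [exact: scale_ge1|have := beta_lt1; lra].
Qed.

(* The mollifier looks at points whose coordinates differ by at most 4 eps; their
   Euclidean distance is then at most 4 eps n = 1/(10 S), which keeps them
   in the ball of radius 10. *)
Let eps := 1 / (40 * n%:R * S).

Let n1 : 1 <= n%:R :> R. Proof. by rewrite ler1n. Qed.
Let S1 := scale_ge1.
Let S0 : 0 < S. Proof. exact: lt_le_trans S1. Qed.
Let n0 : 0 < n%:R :> R. Proof. exact: lt_le_trans n1. Qed.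

Let eps0 : 0 < eps.
Proof. by rewrite divr_gt0// !mulr_gt0. Qed.

Let hE : 4 * eps * n%:R = 1 / 10 / S.
Proof. by rewrite /eps; field; rewrite !gt_eqF. Qed.

Let hE10 : 4 * eps * n%:R <= 1 / 10.
Proof. by rewrite hE ler_pdivrMr// -[leLHS]mulr1; apply: ler_wpM2l; [lra|exact: S1]. Qed.

Let eps3 : eps <= 1 / 3.
Proof.
have h : eps <= eps * n%:R by rewrite -[leLHS]mulr1 ler_wpM2l// ltW.
have h2 := hE10; lra.
Qed.

(** At distance at most [1/S] the potential varies by at most
    [M S^(-beta) = S^3]. *)
Lemma oscillation (p x y : 'rV[R]_n) : eball 0 2^-1 p -> sq p x <= 81 ->
  (forall i, `|y ord0 i - x ord0 i| <= 4 * eps) ->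
  Normc.normc (V y - V x) <= S ^+ 3.
Proof.
move=> ph hx yx.
have h0 : 0 <= 4 * eps by rewrite mulr_ge0// ltW.
have [y10 dist] := perturb_in_ball ph hx n_gt0 h0 hE10 yx.
have Bx : B x by rewrite /B ball10E /=; have := near_center_in_ball ph hx; lra.
have By : B y by rewrite /B ball10E.
apply: le_trans (holder_diff Bx By) _.
have d2 : enorm (y - x) <= S^-1.
  apply: le_trans dist _; rewrite hE -[leRHS]mul1r ler_wpM2r ?invr_ge0 ?(ltW S0)//.
  by lra.
have d3 : enorm (y - x) `^ beta <= S `^ (- beta).
  have Si : 0 <= S^-1 by rewrite invr_ge0 ltW.
  have -> : S `^ (- beta) = S^-1 `^ beta.
    by rewrite -[S^-1](powR_inv1 (ltW S0)) -powRrM mulN1r.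
  apply: ge0_ler_powR; rewrite ?nnegrE//; first exact: ltW.
  by rewrite enorm_sq sqrtr_ge0.
have M0 : 0 <= M by apply: le_trans M1.
apply: le_trans (ler_wpM2l M0 d3) _.
rewrite {1}scale_M -powRD; last by apply/implyP => _; rewrite gt_eqF.
by rewrite addrK powR_mulrn// ltW.
Qed.

(** To be used for the real and the imaginary part of [V].  The gradient bound is
    in the form that [carleman] needs: 9 bounds the distance to [p], and
    [40 n^2 360^n S^4] bounds the length of the gradient. *)
Lemma smooth_component (F : 'rV[R]_n -> R) (p : 'rV[R]_n) : eball 0 2^-1 p ->
  (forall x y, `|F y - F x| <= Normc.normc (V y - V x)) ->
  exists2 W : 'rV[R]_n -> R, C1 setT W & forall x, sq p x <= 81 ->
    `|F x - W x| <= S ^+ 3 * 360 ^+ n /\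
    gam p W W x <= (9 * (40 * n%:R ^+ 2 * 360 ^+ n * S ^+ 4)) ^+ 2.
Proof.
move=> ph FV.
have [W hW H] := mollifier F eps0 eps3.
exists W => // x hx.
have x10 i : `|x ord0 i| <= 10.
  have h := @crd_sq_bound _ _ 0 x 10 i (ler0n _ 10).
  move: h; rewrite mxE subr0; apply; rewrite expr2.
  by have := near_center_in_ball ph hx; lra.
have osc (y : 'rV[R]_n) : (forall i, `|y ord0 i - x ord0 i| <= 4 * eps) -> `|F y - F x| <= S ^+ 3.
  by move=> h; apply: le_trans (FV _ _) _; exact: oscillation ph hx h.
have P0 : 0 <= 360 ^+ n :> R by apply: exprn_ge0; exact: ler0n.
have := H x (S ^+ 3) x10 osc.
move: (360 ^+ n : R) P0 => P P0 [h1 h2].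
split; first by rewrite distrC.
have c0 : 0 <= 40 * n%:R * P * S ^+ 4.
  apply: mulr_ge0; last by apply: exprn_ge0; exact: ltW.
  by apply: mulr_ge0 => //; apply: mulr_ge0; exact: ler0n.
have h3 i : partial i W x ^+ 2 <= (40 * n%:R * P * S ^+ 4) ^+ 2.
  rewrite -(real_normK (num_real (partial i W x))); apply: lerXn2r; rewrite ?nnegrE//.
  apply: le_trans (h2 i) _; rewrite le_eqVlt; apply/orP; left; apply/eqP.
  by rewrite /eps; field; rewrite !gt_eqF.
have h4 : \sum_i partial i W x * partial i W x <= n%:R * (40 * n%:R * P * S ^+ 4) ^+ 2.
  apply: (@le_trans _ _ (\sum_(i < n) (40 * n%:R * P * S ^+ 4) ^+ 2)).
    by apply: ler_sum => i _; rewrite -expr2; exact: h3.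
  by rewrite sumr_const card_ord [leRHS]mulr_natl.
have h5 : n%:R * (40 * n%:R * P * S ^+ 4) ^+ 2 <= (40 * n%:R ^+ 2 * P * S ^+ 4) ^+ 2.
  rewrite (_ : (40 * n%:R ^+ 2 * P * S ^+ 4) ^+ 2 =
     n%:R ^+ 2 * (40 * n%:R * P * S ^+ 4) ^+ 2); last by ring.
  by apply: ler_wpM2r; [exact: sqr_ge0|rewrite expr2 -[leLHS]mulr1 ler_wpM2l].
have h6 : 81 * (n%:R * (40 * n%:R * P * S ^+ 4) ^+ 2) <=
    (9 * (40 * n%:R ^+ 2 * P * S ^+ 4)) ^+ 2.
  move: h5; move: (40 * n%:R ^+ 2 * P * S ^+ 4) (n%:R * _) => X Y XY.
  by rewrite (_ : (9 * X) ^+ 2 = 81 * X ^+ 2); [apply: ler_wpM2l|ring].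
apply: le_trans h6; apply: ler_pM => //; first exact: sq_ge0.
by apply: sumr_ge0 => i _; rewrite -expr2 sqr_ge0.
Qed.

End HolderPotential.

(** [D] collects the constants of the smoothing and [t = T S^2]; after division by
    powers of [S] these are the hypotheses of [vanishing_le] on the potential.  The
    factor [10^6] makes the second and the third hold with room. *)
Lemma constants_fit (R : realFieldType) (D T : R) : 21 <= D -> 100 * 100 * 100 * D <= T ->
  [/\ 21 <= T ^+ 2, 2 * D <= T ^+ 2 / 100 / 100 & 2 * D ^+ 2 <= T ^+ 3 / 81 / 800].
Proof.
move=> D21 DT.
have D0 : 0 < D by lra.
have T0 : 0 < T by lra.
have h2 : 100 * 100 * 100 * D * T <= T ^+ 2 by rewrite expr2 ler_wpM2r// ltW.
have h1 : 100 * 100 * 100 * D * (100 * 100 * 100 * D) <= 100 * 100 * 100 * D * T.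
  by apply: ler_wpM2l => //; rewrite !mulr_ge0// ltW.
have D2 : 21 * D <= D ^+ 2 by rewrite expr2 ler_wpM2r// ltW.
have h3 : D ^+ 2 * (100 * 100 * 100 * 100 * 100 * 100) * T <= T ^+ 3.
  rewrite [T ^+ 3]exprSr; apply: ler_wpM2r; first exact: ltW.
  by apply: le_trans h2; apply: le_trans h1; rewrite le_eqVlt; apply/orP; left; apply/eqP; ring.
have h4 : D ^+ 2 * (100 * 100 * 100 * 100 * 100 * 100) * 21 <= D ^+ 2 * (100 * 100 * 100 * 100 * 100 * 100) * T.
  apply: ler_wpM2l; last by lra.
  by apply: mulr_ge0; [exact: sqr_ge0|do !(apply: mulr_ge0; last exact: ler0n); exact: ler0n].
by split; lra.
Qed.

(** * The vanishing-order bound *)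

Lemma solution_components (R : realType) (n : nat) (V u : 'rV[R]_n -> R[i]) x :
  - laplacianC u x + V x * u x = 0 ->
  laplacian (@complex.Re R \o u) x =
    complex.Re (V x) * complex.Re (u x) - complex.Im (V x) * complex.Im (u x) /\
  laplacian (@complex.Im R \o u) x =
    complex.Re (V x) * complex.Im (u x) + complex.Im (V x) * complex.Re (u x).
Proof.
move/eqP; rewrite addrC subr_eq0 => /eqP E.
have : complex.Re (V x * u x) = complex.Re (laplacianC u x) by rewrite E.
have : complex.Im (V x * u x) = complex.Im (laplacianC u x) by rewrite E.
rewrite /laplacianC /=; case: (V x) (u x) => [v1 v2] [w1 w2] /= <- <-.
by [].
Qed.

Unset Implicit Arguments.

Theorem corollary1 (R : realType) (n : nat) (beta C0 : R)
    (n_gt0 : (0 < n)%N) (beta_gt0 : 0 < beta) (beta_lt1 : beta < 1) :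
  exists C : R, forall (M : R) (V u : 'rV[R]_n -> R[i]),
    1 <= M ->
    classical_solution (eball 0 10) V u ->
    (holder_norm beta (eball 0 10) V <= M%:E)%E ->
    (LpC +oo (eball 0 10) u <= C0%:E)%E ->
    (1 <= LpC 2%:E (eball 0 1) u)%E ->
    forall x0 : 'rV[R]_n, eball 0 2^-1 x0 ->
      (vanishing_order u x0 <= (C * M `^ (2 / (beta + 3)))%:E)%E.
Proof.
have n1 : 1 <= n%:R :> R by rewrite ler1n.
have [P P1 PE] : exists2 P : R, 1 <= P & P = 360 ^+ n.
  by exists (360 ^+ n) => //; apply: exprn_ege1; rewrite ler1n.
pose D := 40 * n%:R ^+ 2 * P + 21 : R.
have nn : n%:R <= n%:R ^+ 2 :> R by rewrite expr2 -[leLHS]mulr1 ler_wpM2l.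
have D1 : 40 * n%:R ^+ 2 * P <= D by rewrite lerDl.
have nP : n%:R ^+ 2 <= n%:R ^+ 2 * P :> R by rewrite -[leLHS]mulr1 ler_wpM2l// sqr_ge0.
have nnP : P <= n%:R ^+ 2 * P.
  by rewrite -[leLHS]mul1r ler_wpM2r//; [exact: le_trans P1|exact: le_trans n1 nn].
have D2 : P + 21 <= D.
  by rewrite /D -mulrA; move: nnP P1; move: (n%:R ^+ 2 * P) => X; lra.
have Dn : n%:R <= D.
  by rewrite /D -mulrA; move: nn nP n1; move: (n%:R : R) (n%:R ^+ 2) (n%:R ^+ 2 * P) => X Y Z; lra.
have D21 : 21 <= D by lra.
pose Cs := cutoff_const R * (C0 ^+ 2 * 18 ^+ n).
have Cs0 : 0 <= Cs.
  apply: mulr_ge0; first exact: cutoff_const_ge0.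
  by apply: mulr_ge0; [exact: sqr_ge0|apply: exprn_ge0; exact: ler0n].
pose T := 100 * 100 * 100 * D + Cs + 1.
have DT : 100 * 100 * 100 * D <= T by rewrite /T -addrA lerDl addr_ge0.
have [T1 T2 T3] := constants_fit D21 DT.
have T20 : 20 <= T by lra.
have nT : n%:R <= T by lra.
have CsT : Cs < T by rewrite /T; lra.
exists (T + 1) => M V u M1 [ha hb hu] hV hu_oo hu1 x0 hx0.
pose S := M `^ (1 / (3 + beta)).
have S1 : 1 <= S by exact: scale_ge1 beta_gt0 M1.
have S0 : 0 < S by exact: lt_le_trans S1.
have b3 : 0 < 3 + beta by lra.
have SE : M `^ (2 / (beta + 3)) = S ^+ 2.
  by rewrite [beta + 3]addrC (scale_powE _ beta_gt0) powR_mulrn// ltW.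
have MS : M <= S ^+ 4 by exact: M_le_scale4 beta_gt0 beta_lt1 M1.
have S2 : 1 <= S ^+ 2 by exact: exprn_ege1.
pose t := T * S ^+ 2.
have T0 : 0 <= T by lra.
have Tt : T <= t by rewrite -[leLHS]mulr1 ler_wpM2l.
have t2 : t ^+ 2 = T ^+ 2 * S ^+ 4 by rewrite /t; ring.
have t3 : t ^+ 3 = T ^+ 3 * S ^+ 6 by rewrite /t; ring.
have S4 : 0 < S ^+ 4 by exact: exprn_gt0.
have S34 : S ^+ 3 <= S ^+ 4 by rewrite [leRHS]exprSr -[leLHS]mulr1 ler_wpM2l// exprn_ge0// ltW.
pose m := t ^+ 2 / 100 / 100.
have mD : 2 * D * S ^+ 4 <= m.
  have -> : m = T ^+ 2 / 100 / 100 * S ^+ 4 by rewrite /m t2; ring.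
  by apply: ler_wpM2r => //; exact: ltW.
have [Wr hWr Wr_prop] := smooth_component n_gt0 beta_gt0 M1 hV hx0
  (F := fun x => complex.Re (V x))
  (fun x y => eq_ind _ (fun z => `|z| <= _) (abs_Re_le (V y - V x)) _ (ReB _ _)).
have [Wi hWi Wi_prop] := smooth_component n_gt0 beta_gt0 M1 hV hx0
  (F := fun x => complex.Im (V x))
  (fun x y => eq_ind _ (fun z => `|z| <= _) (abs_Im_le (V y - V x)) _ (ImB _ _)).
rewrite -PE -/S in Wr_prop Wi_prop.
have B81 x : sq x0 x <= 81 -> eball 0 10 x.
  by move=> h; rewrite ball10E /=; have := near_center_in_ball hx0 h; lra.
have Vb := potential_bound beta_gt0 beta_lt1 M1 hV.
have M21 : 21 * M <= t ^+ 2.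
  rewrite t2; apply: ler_pM => //; lra.
have Wbound (v w : R) : `|v| <= 21 * M -> `|v - w| <= S ^+ 3 * P -> `|w| <= m.
  move=> h1 h2; apply: le_trans mD.
  have h3 : `|w| <= `|v| + `|v - w|.
    by rewrite -[X in `|X| <= _](subKr v w); exact: ler_normB.
  have h4 : S ^+ 3 * P <= S ^+ 4 * P by apply: ler_wpM2r => //; exact: le_trans P1.
  have h5 : S ^+ 4 * (P + 21) <= S ^+ 4 * D by apply: ler_wpM2l => //; exact: ltW.
  have h6 : 0 <= S ^+ 4 * D by apply: mulr_ge0; [exact: ltW|lra].
  by move: h1 h2 h3 h4 h5 h6 MS; move: (S ^+ 4) (S ^+ 3) => X Y; lra.
have gbound (X : R) : X <= (9 * (40 * n%:R ^+ 2 * P * S ^+ 4)) ^+ 2 -> X <= (9 * m) ^+ 2.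
  move=> h; apply: le_trans h _.
  have h0 : 0 <= 40 * n%:R ^+ 2 * P * S ^+ 4.
    apply: mulr_ge0; last exact: ltW.
    apply: mulr_ge0; last exact: le_trans P1.
    by apply: mulr_ge0 => //; exact: sqr_ge0.
  have h1 : 40 * n%:R ^+ 2 * P * S ^+ 4 <= m.
    apply: le_trans mD; apply: ler_wpM2r; first exact: ltW.
    by apply: le_trans D1 _; lra.
  have h2 := le_trans h0 h1.
  apply: lerXn2r; rewrite ?nnegrE.
  - by apply: mulr_ge0 => //; exact: ler0n.
  - by apply: mulr_ge0 => //; exact: ler0n.
  - by apply: ler_wpM2l => //; exact: ler0n.
have u2 : forall x, eball 0 10 x -> abs2 u x <= C0 ^+ 2.
  apply: LpC_oo_abs2 => //; first by apply: eball_open.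
  move=> x Bx; apply: cont_abs2.
    exact: (C1_cont (C2_C1 ha) Bx).
  exact: (C1_cont (C2_C1 hb) Bx).
have VWb x : sq x0 x <= 81 ->
    (complex.Re (V x) - Wr x) ^+ 2 + (complex.Im (V x) - Wi x) ^+ 2 <= t ^+ 3 / 81 / 800.
  move=> h; have [r1 _] := Wr_prop x h; have [i1 _] := Wi_prop x h.
  have PD : P <= D by lra.
  have sqb (z : R) : `|z| <= S ^+ 3 * P -> z ^+ 2 <= S ^+ 6 * D ^+ 2.
    move=> hz; rewrite -real_normK ?num_real//.
    have -> : S ^+ 6 * D ^+ 2 = (S ^+ 3 * D) ^+ 2 by ring.
    have h3 : S ^+ 3 * P <= S ^+ 3 * D.
      by apply: ler_wpM2l => //; apply: exprn_ge0; exact: ltW.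
    have h4 := le_trans hz h3.
    by apply: lerXn2r; rewrite ?nnegrE//; exact: le_trans (normr_ge0 z) h4.
  apply: le_trans (lerD (sqb _ r1) (sqb _ i1)) _.
  rewrite t3 (_ : _ + _ = S ^+ 6 * (2 * D ^+ 2)); last by ring.
  rewrite (_ : _ / 81 / 800 = S ^+ 6 * (T ^+ 3 / 81 / 800)); last by ring.
  by apply: ler_wpM2l => //; apply: exprn_ge0; exact: ltW.
rewrite SE; apply: ge_ereal_sup => _ [N [N0 [k hk]] <-]; rewrite lee_fin.
apply: (@le_trans _ _ (t + 1)); last first.
  by rewrite mulrDl mul1r lerD2l.
apply: (@vanishing_le R n n_gt0 x0 t (21 * M) (fun x => complex.Re (V x))
  (fun x => complex.Im (V x)) Wr Wi u hx0 _ _ ha hb hWr hWi _ _ M21 _ _ _ _ _ VWb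
  (C0 ^+ 2) u2 hu1 _ N k hk).
- exact: le_trans T20 Tt.
- exact: le_trans nT Tt.
- by move=> x Bx; have [] := @solution_components _ _ _ _ _ (hu x Bx).
- by move=> x Bx; have [] := @solution_components _ _ _ _ _ (hu x Bx).
- by move=> x Bx; have [] := Vb x Bx.
- move=> x h; have [r1 _] := Wr_prop x h; have [v1 _] := Vb x (B81 x h); exact: Wbound v1 r1.
- move=> x h; have [r1 _] := Wi_prop x h; have [_ v1] := Vb x (B81 x h); exact: Wbound v1 r1.
- by move=> x h; have [_ r1] := Wr_prop x h; exact: gbound.
- by move=> x h; have [_ r1] := Wi_prop x h; exact: gbound.
- exact: lt_le_trans CsT Tt.
Qed.
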